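(* Let $R\in(0,\infty]^d$ be such that $\mathcal M$ is defined and non-zero on $D_R$, and let $f\colon\mathbb C^d\to\mathbb C$ be entire with $|f(z)|\le C\exp(r\cdot|z|)$ for all $z\in\mathbb C^d$, for some $C>0$ and $r\in[0,\infty)^d$ with $r<R$. Let $f=\sum_Ia_I\,x^{\diamond I}/I!$ be its expansion in Appell polynomials, which converges absolutely locally uniformly and in $L^1(\mu)$. Then: (1) for every multiindex $K\in\mathbb N_0^d$, $a_K=\mathbb E[\partial_Kf(X)]$; (2) the Heisenberg commutation relation $[\partial_j,\,(\cdot)\diamond x^j]=\mathrm{id}$ holds for $j=1,\ldots,d$, i.e. $\partial_j(f\diamond x^j)-(\partial_jf)\diamond x^j=f$ for all such $f$.
   Context: $X$ is an $\mathbb R^d$-valued random variable with law $\mu$ and moment-generating function $\mathcal M(\theta)=\mathbb E\exp(\theta\cdot X)$. $D_R=\{\theta\in\mathbb C^d:|\theta_i|<R_i\ \forall i\}$, and $\mathcal M$ is defined on $D_R$ if $\mathbb E\exp(q\cdot|X|)<\infty$ for all $q\in[0,\infty)^d$ with $q<R$. Inequalities between vectors are entrywise and $|z|=(|z_1|,\ldots,|z_d|)$ in expressions such as $r\cdot|z|$. The Appell polynomials $z^{\diamond K}$, $K\in\mathbb N_0^d$, are defined by $\exp(\theta\cdot z)/\mathcal M(\theta)=\sum_Kz^{\diamond K}\theta^K/K!$ for $\theta$ near $0$. For entire $f=\sum_Ia_Ix^{\diamond I}/I!$ and $g=\sum_Jb_Jx^{\diamond J}/J!$ bounded in modulus by multiples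 of $e^{r_f\cdot|z|}$, $e^{r_g\cdot|z|}$ with $r_f+r_g<R$, the Wick product is the absolutely convergent series $f\diamond g=\sum_{I,J}a_Ib_J\,x^{\diamond(I+J)}/(I!J!)$. Here $x^j$ denotes the $j$-th coordinate function (so $x^j=x^{\diamond e_j}+\mathbb E X^j$, where $e_j$ is the $j$-th unit multiindex).
   Formalization: The stated modes of convergence do not determine the coefficients, so ''its expansion'' is taken to be one with |a_I| ≤ c q^I for some c and some q ∈ [0,∞)^d with q < R; the existence of such an expansion of f, with all the stated convergence, is proved. *)

(* Defs.v *)
From HB Require Import structures.
From mathcomp Require Import all_boot all_order all_algebra finmap complex.
From mathcomp Require Import summability.
From mathcomp Require Import all_classical all_reals all_analysis.

Set Implicit Arguments.
Unset Strict Implicit.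
Unset Printing Implicit Defensive.

Import Order.TTheory GRing.Theory Num.Theory.
Import numFieldNormedType.Exports.

Local Open Scope classical_set_scope.
Local Open Scope ring_scope.
Local Open Scope complex_scope.

(* R[i] as a normed space over itself, so that [differentiable], [derivable]
   and ['D_v] on 'rV[R[i]]_d are the complex notions. *)
HB.instance Definition _ (R : rcfType) := GRing.ComAlgebra.copy R[i] R[i]^o.
HB.instance Definition _ (R : rcfType) := Vector.copy R[i] R[i]^o.
HB.instance Definition _ (R : rcfType) := NormedModule.copy R[i] R[i]^o.

Section Multiindices.
Variable d : nat.

Definition multiindex : choiceType := {ffun 'I_d -> nat}.

Implicit Types I J K : multiindex.

Definition mfact K : nat := \prod_(i < d) (K i)`!.

Definition madd I J : multiindex := [ffun i => (I i + J i)%N].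

Definition mpow (S : comPzSemiRingType) (q : 'rV[S]_d) K : S :=
  \prod_(i < d) q ord0 i ^+ K i.

Definition dot (S : pzSemiRingType) (u v : 'rV[S]_d) : S :=
  \sum_(i < d) u ord0 i * v ord0 i.

End Multiindices.

Section ComplexFunctions.
Variables (R : realType) (d : nat).
Implicit Types (f : 'rV[R[i]]_d -> R[i]) (z : 'rV[R[i]]_d).

(* The modulus as a real number: the norm `|z| of R[i] lives in R[i]. *)
Definition cmod (z : R[i]) : R := ComplexField.Normc.normc z.

Definition cexp (z : R[i]) : R[i] :=
  (expR (complex.Re z))%:C * (cos (complex.Im z) +i* sin (complex.Im z)).

Definition absv z : 'rV[R]_d := map_mx cmod z.

Definition coordinate (j : 'I_d) : 'rV[R[i]]_d -> R[i] := fun z => z ord0 j.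

Definition entire f := forall z, differentiable f z.

Definition partial (j : 'I_d) f : 'rV[R[i]]_d -> R[i] :=
  fun z => 'D_(delta_mx ord0 j) f z.

Definition mpartial (K : multiindex d) f : 'rV[R[i]]_d -> R[i] :=
  foldr (fun j => iter (K j) (partial j)) f (enum 'I_d).

Definition radius_lt (q : 'rV[R]_d) (Rad : 'I_d -> \bar R) :=
  forall i, 0 <= q ord0 i /\ ((q ord0 i)%:E < Rad i)%E.

Definition polydisc (Rad : 'I_d -> \bar R) : set 'rV[R[i]]_d :=
  [set theta | forall i, ((cmod (theta ord0 i))%:E < Rad i)%E].

End ComplexFunctions.

Section RandomVector.
Variables (disp : measure_display) (T : measurableType disp) (R : realType).
Variables (P : probability T R) (d : nat) (X : 'I_d -> {RV P >-> R}).

Definition cintegrable (Y : T -> R[i]) :=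
  P.-integrable setT (fun w => (complex.Re (Y w))%:E) /\
  P.-integrable setT (fun w => (complex.Im (Y w))%:E).

Definition cexpectation (Y : T -> R[i]) : R[i] :=
  fine 'E_P[fun w => complex.Re (Y w)]%E
  +i* fine 'E_P[fun w => complex.Im (Y w)]%E.

Definition cvec (w : T) : 'rV[R[i]]_d := \row_i (X i w)%:C.

Definition mgf (theta : 'rV[R[i]]_d) : R[i] :=
  cexpectation (fun w => cexp (dot theta (cvec w))).

Definition mgf_defined (Rad : 'I_d -> \bar R) :=
  forall q : 'rV[R]_d, radius_lt q Rad ->
    ('E_P[fun w => expR (dot q (absv (cvec w)))] < +oo)%E.

(* Sums over multiindices are unordered sums (limits of the partial sums along
   the directed set of finite sets of indices), that is, absolutely convergent
   ones. *)
Definition appell_polynomials (A : multiindex d -> 'rV[R[i]]_d -> R[i]) :=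
  forall z, \forall theta \near (0 : 'rV[R[i]]_d),
    partial_sum (fun K => A K z * mpow theta K / (mfact K)%:R) @ totally
      --> cexp (dot theta z) / mgf theta.

Variables (A : multiindex d -> 'rV[R[i]]_d -> R[i]) (Rad : 'I_d -> \bar R).
Implicit Types (f g h : 'rV[R[i]]_d -> R[i]) (a b : multiindex d -> R[i]).

Definition appell_term a (I : multiindex d) (z : 'rV[R[i]]_d) : R[i] :=
  a I * A I z / (mfact I)%:R.

(* The three modes of convergence do not by themselves determine the
   coefficients: let X_1 be standard exponential, X_2 uniform on {0,1} and
   independent of X_1.  With a_(n,2) = 1 and all other coefficients zero the
   series converges absolutely locally uniformly to 0, and each of its terms
   vanishes almost surely.  The geometric bound on a selects the coefficients
   of the expansion of a function of exponential type below Rad, and makes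
   them unique. *)
Record appell_expansion f a : Prop := AppellExpansion {
  expansion_bound : exists (c : R) (q : 'rV[R]_d),
    radius_lt q Rad /\ forall I, cmod (a I) <= c * mpow q I;
  expansion_abs_locally_uniform : exists g,
    {family compact, (fun F : {fset multiindex d} =>
       fun z => partial_sum (fun I => `|appell_term a I z|) F) @ totally --> g};
  expansion_locally_uniform :
    {family compact, (fun F : {fset multiindex d} =>
       fun z => partial_sum (fun I => appell_term a I z) F) @ totally --> f};
  expansion_L1 :
    (fun F : {fset multiindex d} =>
       'E_P[fun w => cmod (partial_sum (fun I => appell_term a I (cvec w)) F
                           - f (cvec w))%R]%E) @ totally --> 0%E
}.

Definition wick_term a b (IJ : multiindex d * multiindex d)
    (z : 'rV[R[i]]_d) : R[i] :=
  a IJ.1 * b IJ.2 * A (madd IJ.1 IJ.2) z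
  / ((mfact IJ.1)%:R * (mfact IJ.2)%:R).

Definition is_wick f g h := exists a b,
  [/\ appell_expansion f a, appell_expansion g b &
      forall z,
        (\esum_(IJ in [set: multiindex d * multiindex d])
           (cmod (wick_term a b IJ z))%:E < +oo)%E /\
        partial_sum (fun IJ => wick_term a b IJ z) @ totally --> h z].

Definition wick f g : 'rV[R[i]]_d -> R[i] :=
  xget (fun=> 0) [set h | is_wick f g h].

End RandomVector.

(* Main.v *)
Require Import Defs.
From HB Require Import structures.
From mathcomp Require Import all_boot all_order all_algebra finmap complex.
From mathcomp Require Import summability ring lra.
From mathcomp Require Import all_classical all_reals all_analysis measurable_realfun.

Set Implicit Arguments.
Unset Strict Implicit.
Unset Printing Implicit Defensive.

Import Order.TTheory GRing.Theory Num.Theory.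
Import numFieldNormedType.Exports.

Local Open Scope classical_set_scope.
Local Open Scope ring_scope.
Local Open Scope complex_scope.

(** Write d_K for the K-th derivative at the origin.  A function f of exponential
    type r < R has derivatives phi_K = d_K f of at most geometric growth, say
    |phi_K| <= c q^K with q < R.  This is Cauchy's estimate on the polydisc of
    radii K_i / s_i with r < s < q ([exponential_type_pser]); conversely such a
    sequence phi sums to the entire function [pser phi].

    A power series v converging on D_R acts on sequences of geometric growth as
    the constant-coefficient differential operator v(d),
    (v(d) phi)_K = sum_J phi_(K+J) v_J with v_J the normalized coefficients
    ([mact]), and the product of power series, that is convolution of
    coefficients, becomes composition ([mact_mact]).  The moment-generating
    function M converges on D_R, and 1/M does as well, because it is holomorphic
    there; so M(d) and (1/M)(d) are mutually inverse.  Comparing coefficients in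
    the generating function, the Appell polynomials are x^(<>K) = K! times the
    coefficients of e^(theta.x) / M(theta), that is, the convolution of the
    coefficients of 1/M and of the exponential ([appell_ahat]).  Therefore the
    Appell series with coefficients a has sum [pser] of (1/M)(d) a
    ([appell_hassum]), and f has the Appell coefficients a = M(d) phi and no
    others growing at a rate below R.  All the sums involved are dominated by
    c e^(q.|z|), which is bounded on compact sets and, at z = X, integrable; this
    gives the locally uniform convergence and the convergence in L^1.

    The coefficients of M are the moments of X.  Hence
    a_K = sum_J phi_(K+J) E[X^J] / J!, which is E[d_K f(X)] by taking the
    expectation of the Taylor series of d_K f term by term
    ([mact_mhat_expectation]).

    In terms of Appell coefficients the derivative d_j is the shift
    a |-> a_(K + e_j), since shifts commute with M(d).  As x^j has the two
    coefficients E[X^j] and 1 at 0 and e_j, the Wick product with x^j is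
    a_K |-> K_j a_(K - e_j) + E[X^j] a_K, and the commutator of the two is the
    identity because (K_j + 1) - K_j = 1 ([wick_coef_commutator]).

    Cauchy's theory takes a discrete form.  Goursat's bisection argument applies
    to Riemann sums along the boundary of a rectangle, because these are additive
    under subdivision and vanish for affine functions.  Used for f o exp, it
    shows that the means of f over 2^n equidistant points of a circle are
    asymptotically independent of the radius.  Their limit along an ultrafilter
    is a bounded linear functional on all bounded functions on the circle, and
    Cauchy's formula holds for it ([cauchy_formula]); it can be iterated over the
    variables and exchanged with absolutely convergent sums, which gives the
    expansion on polydiscs ([polydisc_expansion]). *)

(** * The complex modulus *)

Section ComplexBasics.
Variable R : realType.
Implicit Types (x y : R) (z w : R[i]).

Lemma normcE z : `|z| = (cmod z)%:C.
Proof. by []. Qed.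

Lemma cmod_ge0 z : 0 <= cmod z.
Proof. by rewrite -lecR -normcE normr_ge0. Qed.

Lemma cmodM z w : cmod (z * w) = cmod z * cmod w.
Proof. exact: ComplexField.Normc.normcM. Qed.

Lemma cmodD z w : cmod (z + w) <= cmod z + cmod w.
Proof. by rewrite -lecR rmorphD -!normcE; exact: ler_normD. Qed.

Lemma cmodN z : cmod (- z) = cmod z.
Proof. by apply: (@complexI R); rewrite -!normcE normrN. Qed.

Lemma cmodBC z w : cmod (z - w) = cmod (w - z).
Proof. by rewrite -cmodN opprB. Qed.

Lemma cmodB z w : cmod (z - w) <= cmod z + cmod w.
Proof. by rewrite -(cmodN w) cmodD. Qed.

Lemma cmod0 : cmod (0 : R[i]) = 0.
Proof. exact: ComplexField.Normc.normc0. Qed.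

Lemma cmod1 : cmod (1 : R[i]) = 1.
Proof. exact: ComplexField.Normc.normc1. Qed.

Lemma cmod_eq0 z : (cmod z == 0) = (z == 0).
Proof.
apply/eqP/eqP => [/ComplexField.Normc.eq0_normc //|->]; exact: cmod0.
Qed.

Lemma cmod_gt0 z : (0 < cmod z) = (z != 0).
Proof. by rewrite lt_neqAle cmod_ge0 andbT eq_sym cmod_eq0. Qed.

Lemma cmodX z n : cmod (z ^+ n) = cmod z ^+ n.
Proof. by elim: n => [|n IH]; rewrite ?expr0 ?cmod1 // !exprS cmodM IH. Qed.

Lemma cmodV z : cmod (z^-1) = (cmod z)^-1.
Proof. exact: ComplexField.Normc.normcV. Qed.

Lemma cmod_real x : cmod x%:C = `|x|.
Proof. by rewrite /cmod /= expr0n /= addr0 sqrtr_sqr. Qed.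

Lemma cmod_nat n : cmod (n%:R : R[i]) = n%:R.
Proof. by rewrite -(rmorph_nat (real_complex R)) cmod_real normr_nat. Qed.

Lemma cmodi : cmod ('i : R[i]) = 1.
Proof. by rewrite /cmod /= expr0n expr1n /= add0r sqrtr1. Qed.

Lemma cmod_Re z : `|complex.Re z| <= cmod z.
Proof. by case: z => a b /=; rewrite -sqrtr_sqr ler_wsqrtr // lerDl sqr_ge0. Qed.

Lemma cmod_Im z : `|complex.Im z| <= cmod z.
Proof. by case: z => a b /=; rewrite -sqrtr_sqr ler_wsqrtr // lerDr sqr_ge0. Qed.

Lemma cmod_le_ReIm z : cmod z <= `|complex.Re z| + `|complex.Im z|.
Proof.
by rewrite {1}(complexE z) (le_trans (cmodD _ _)) // cmodM cmodi mul1r !cmod_real.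
Qed.

Lemma cmod_dist z w : `|cmod z - cmod w| <= cmod (z - w).
Proof.
rewrite ler_norml; apply/andP; split.
  rewrite lerNl opprB lerBlDr cmodBC.
  by rewrite (le_trans _ (cmodD _ _)) // subrK.
by rewrite lerBlDr (le_trans _ (cmodD _ _)) // subrK.
Qed.

Lemma cmod_sum (I : Type) (s : seq I) (p : pred I) (F : I -> R[i]) :
  cmod (\sum_(i <- s | p i) F i) <= \sum_(i <- s | p i) cmod (F i).
Proof.
elim/big_rec2: _ => [|i a b _ h]; first by rewrite cmod0.
by rewrite (le_trans (cmodD _ _)) // lerD2l.
Qed.

Lemma cmod_prod (I : Type) (s : seq I) (p : pred I) (F : I -> R[i]) :
  cmod (\prod_(i <- s | p i) F i) = \prod_(i <- s | p i) cmod (F i).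
Proof.
by elim/big_rec2: _ => [|i a b _ h]; rewrite ?cmod1 // cmodM h.
Qed.

Lemma gt0cE (e : R[i]) : 0 < e -> exists2 x, 0 < x & e = x%:C.
Proof.
case: e => a b; rewrite ltcE /= => /andP[/eqP -> a0].
by exists a.
Qed.

(** The norm of R[i] takes its values in R[i], so the generic characterizations
    of limits quantify over complex radii; here the radii are real. *)
Lemma cvgcP (T : Type) (F : set_system T) (FF : Filter F) (f : T -> R[i]) l :
  f @ F --> l <-> forall e : R, 0 < e -> \forall x \near F, cmod (f x - l) < e.
Proof.
split=> [/cvgrPdist_lt h e e0|h].
  have := h e%:C; rewrite ltcR => /(_ e0).
  by apply: filterS => x; rewrite normcE ltcR cmodBC.
apply/cvgrPdist_lt => e /gt0cE[x x0 ->].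
have := h x x0; apply: filterS => t.
by rewrite normcE ltcR cmodBC.
Qed.

Lemma nbhsc (z : R[i]) (A : set R[i]) :
  nbhs z A <-> exists2 e : R, 0 < e & forall w, cmod (w - z) < e -> A w.
Proof.
split.
  move=> /nbhs_ballP[e /= /gt0cE[x x0 ->]] h; exists x => // w wz.
  by apply: h; rewrite -ball_normE /ball_ /= normcE ltcR cmodBC.
move=> [e e0 h]; apply/nbhs_ballP; exists e%:C => /=; first by rewrite ltcR.
by move=> w; rewrite -ball_normE /ball_ /= normcE ltcR cmodBC; exact: h.
Qed.

(** Without division, so that the increment may vanish: the form which sums and
    products of estimates preserve. *)
Lemma derivableP_eps (d : nat) (f : 'rV[R[i]]_d -> R[i]) (z v : 'rV[R[i]]_d) (l : R[i]) :
  (forall e : R, 0 < e -> exists2 dl : R, 0 < dl & forall h : R[i],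
     cmod h < dl -> cmod (f (z + h *: v) - f z - h * l) <= e * cmod h) <->
  (derivable f z v /\ 'D_v f z = l).
Proof.
have key (e : R) (h : R[i]) : h != 0 ->
    (cmod (h^-1 *: (f (h *: v + z) - f z) - l) < e) =
    (cmod (f (z + h *: v) - f z - h * l) < e * cmod h).
  move=> h0; have -> : f (z + h *: v) - f z - h * l =
     h * (h^-1 *: (f (h *: v + z) - f z) - l).
    by rewrite mulrBr mulrA divff // mul1r [z + _]addrC.
  by rewrite cmodM mulrC ltr_pM2r // cmod_gt0.
split=> [H|[df lE] e e0].
  have hl : h^-1 *: ((f \o shift z) (h *: v) - f z) @[h --> 0^'] --> l.
    apply/cvgcP => e e0.
    have e2 : 0 < e / 2 by rewrite divr_gt0.
    have [dl dl0 hd] := H _ e2.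
    apply/nbhsc; exists dl => // h; rewrite subr0 => hdl h0.
    rewrite /= key //; apply: le_lt_trans (hd _ hdl) _.
    by rewrite ltr_pM2r ?cmod_gt0 // ltr_pdivrMr // mulr_natr mulr2n ltrDl.
  split; first by apply/cvg_ex; exists l.
  exact: cvg_lim hl.
have /cvgcP/(_ e e0) : h^-1 *: ((f \o shift z) (h *: v) - f z) @[h --> 0^'] --> l.
  by rewrite -lE; exact: df.
move=> /nbhsc[dl dl0 hd]; exists dl => // h hdl.
have [->|h0] := eqVneq h 0.
  by rewrite scale0r addr0 subrr mul0r subr0 cmod0 mulr0.
have hh : cmod (h - 0) < dl by rewrite subr0.
by have := hd h hh h0; rewrite /= key // => /ltW.
Qed.

End ComplexBasics.

(** * Unordered sums *)

#[local] Existing Instance totally_filter.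

Section RealFamilies.
Variables (R : realType) (I : choiceType).
Implicit Types (u v : I -> R) (F G : {fset I}).

(** For a nonnegative family this is convergence, with sum at most [B]. *)
Definition sumbound u (B : R) := forall F, \sum_(i <- F) u i <= B.

Lemma sum_fsetID (V : nmodType) (a : I -> V) F G : (F `<=` G)%fset ->
  \sum_(i <- G) a i = \sum_(i <- F) a i + \sum_(i <- (G `\` F)%fset) a i.
Proof.
move=> FG; rewrite (big_fsetID _ (mem F)) /=; congr (_ + _).
  apply: eq_fbigl => i; rewrite !inE; apply/idP/idP => [/andP[]//|iF].
  by rewrite iF (fsubsetP FG).
by apply: eq_fbigl => i; rewrite !inE andbC.
Qed.

Lemma sum_fset_ge0 u F : (forall i, 0 <= u i) -> 0 <= \sum_(i <- F) u i.
Proof. by move=> u0; apply: sumr_ge0. Qed.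

Lemma sum_fsetS u F G : (forall i, 0 <= u i) -> (F `<=` G)%fset ->
  \sum_(i <- F) u i <= \sum_(i <- G) u i.
Proof. by move=> u0 FG; rewrite (sum_fsetID _ FG) lerDl sum_fset_ge0. Qed.

Lemma sumbound_ge0 u B : sumbound u B -> 0 <= B.
Proof. by move=> /(_ fset0); rewrite big_seq_fset0. Qed.

Lemma sumbound_le u v B : (forall i, u i <= v i) -> sumbound v B -> sumbound u B.
Proof. by move=> uv vB F; rewrite (le_trans _ (vB F)) // ler_sum. Qed.

Lemma sumbound_term u B i : sumbound u B -> u i <= B.
Proof. by move=> /(_ [fset i]%fset); rewrite big_seq_fset1. Qed.

Lemma sumbound_single u i0 : 0 <= u i0 -> (forall i, i != i0 -> u i = 0) -> sumbound u (u i0).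
Proof.
move=> u0 ui F; have [F0|F0] := boolP (i0 \in F).
  rewrite (big_fsetD1 _ F0) /= big1_fset ?addr0 // => i.
  by rewrite !inE => /andP[ii0 _] _; exact: ui.
rewrite big1_fset // => i iF _; apply: ui.
by apply: contraNneq F0 => <-.
Qed.

Lemma sumbound_delta i0 (x : R) : 0 <= x -> sumbound (fun i => if i == i0 then x else 0) x.
Proof.
move=> x0; have := @sumbound_single (fun i => if i == i0 then x else 0) i0; rewrite eqxx.
by apply=> // i /negPf ->.
Qed.

Lemma sumboundZ u B c : 0 <= c -> sumbound u B -> sumbound (fun i => c * u i) (c * B).
Proof. by move=> c0 uB F; rewrite -mulr_sumr ler_wpM2l. Qed.

Lemma sumboundD u v A B : sumbound u A -> sumbound v B ->
  sumbound (fun i => u i + v i) (A + B).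
Proof. by move=> uA vB F; rewrite big_split lerD. Qed.

(** A bounded family of nonnegative numbers has small sums far out: this is the
    Cauchy criterion along finite sets. *)
Lemma sumbound_tail u B (e : R) : (forall i, 0 <= u i) -> sumbound u B -> 0 < e ->
  exists F0, forall F, [disjoint F & F0]%fset -> \sum_(i <- F) u i <= e.
Proof.
move=> u0 uB e0.
pose S := [set \sum_(i <- F) u i | F in [set: {fset I}]].
have hS : has_sup S.
  split; first by exists (\sum_(i <- fset0) u i); exists fset0.
  by exists B => _ [F _ <-].
have [_ [F0 _ <-] hF0] := sup_adherent e0 hS.
exists F0 => F dF.
have : \sum_(i <- (F0 `|` F)%fset) u i <= sup S.
  by apply: sup_upper_bound => //; exists (F0 `|` F)%fset.
rewrite (sum_fsetID _ (fsubsetUl F0 F)).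
have -> : ((F0 `|` F) `\` F0)%fset = F.
  apply/fsetP => i; rewrite !inE; have [iF0|] //= := boolP (i \in F0).
  by apply/esym/negP => iF; move/fdisjointP: dF => /(_ _ iF); rewrite iF0.
move=> h; rewrite -(lerD2l (\sum_(i <- F0) u i)) (le_trans h) // -lerBlDr.
exact: ltW.
Qed.

End RealFamilies.

Section UnorderedSums.
Variables (R : realType) (I : choiceType).
Implicit Types (a b : I -> R[i]) (F G : {fset I}) (l : R[i]).

Definition summ a := exists B : R, sumbound (fun i => cmod (a i)) B.

Definition hassum a l := forall e : R, 0 < e ->
  exists F0, forall F, (F0 `<=` F)%fset -> cmod (\sum_(i <- F) a i - l) <= e.

Definition usum a : R[i] := xget 0 [set l | hassum a l].

Lemma partial_sumE (V : zmodType) (a : I -> V) F : partial_sum a F = \sum_(i <- F) a i.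
Proof. by rewrite /partial_sum big_seq_fsetE. Qed.

Lemma hassum_cvg a l : hassum a l <-> partial_sum a @ totally --> l.
Proof.
split=> [h|/cvgcP h e e0].
  apply/cvgcP => e e0; have e2 : 0 < e / 2 by rewrite divr_gt0.
  have [F0 hF0] := h _ e2; exists F0 => // F F0F /=.
  rewrite partial_sumE (le_lt_trans (hF0 _ F0F)) //.
  by rewrite ltr_pdivrMr // mulr_natr mulr2n ltrDl.
have [F0 _ hF0] := h e e0; exists F0 => F F0F; apply: ltW.
by have := hF0 F F0F; rewrite /= partial_sumE.
Qed.

Lemma le_eps (x y : R) : (forall e, 0 < e -> x <= y + e) -> x <= y.
Proof. by move=> h; apply/ler_addgt0Pr. Qed.

Lemma cmod_eps (z : R[i]) : (forall e : R, 0 < e -> cmod z <= e) -> z = 0.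
Proof.
move=> h; apply/eqP; rewrite -cmod_eq0 eq_le cmod_ge0 andbT.
by apply: le_eps => e e0; rewrite add0r h.
Qed.

Lemma hassum_unique a l l' : hassum a l -> hassum a l' -> l = l'.
Proof.
move=> h h'; apply/eqP; rewrite -subr_eq0; apply/eqP; apply: cmod_eps => e e0.
have e2 : 0 < e / 2 by rewrite divr_gt0.
have [F hF] := h _ e2; have [G hG] := h' _ e2.
have := hF _ (fsubsetUl F G); have := hG _ (fsubsetUr F G).
set s := \sum_(i <- _) _ => h1 h2.
have -> : l - l' = (s - l') - (s - l) by ring.
rewrite (le_trans (cmodB _ _)) // (splitr e) lerD //.
Qed.

Lemma usumE a l : hassum a l -> usum a = l.
Proof.
by move=> h; rewrite /usum; case: xgetP => [l' _ h'|/(_ l)//]; exact: hassum_unique h' h.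
Qed.

Lemma hassum_single a i0 : (forall i, i != i0 -> a i = 0) -> hassum a (a i0).
Proof.
move=> ai e e0; exists [fset i0]%fset => F; rewrite fsub1set => F0.
rewrite (big_fsetD1 _ F0) /= big1_fset ?addr0 ?subrr ?cmod0 ?ltW // => i.
by rewrite !inE => /andP[ii0 _] _; exact: ai.
Qed.

Lemma hassum_delta i0 l : hassum (fun i => if i == i0 then l else 0) l.
Proof.
have := @hassum_single (fun i => if i == i0 then l else 0) i0; rewrite eqxx.
by apply=> i /negPf ->.
Qed.

Lemma hassum_nonneg (u : I -> R) B : (forall i, 0 <= u i) -> sumbound u B ->
  exists l, hassum (fun i => (u i)%:C) l.
Proof.
move=> u0 uB.
pose S := [set \sum_(i <- F) u i | F in [set: {fset I}]].
have hS : has_sup S.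
  split; first by exists (\sum_(i <- fset0) u i); exists fset0.
  by exists B => _ [F _ <-].
exists (sup S)%:C => e e0.
have [_ [F0 _ <-] hF0] := sup_adherent e0 hS.
exists F0 => F F0F.
rewrite -rmorph_sum -rmorphB cmod_real distrC ger0_norm.
  by rewrite lerBlDr -lerBlDl (le_trans (ltW hF0)) // sum_fsetS.
by rewrite subr_ge0; apply: sup_upper_bound => //; exists F.
Qed.

Lemma hassumD a b l l' : hassum a l -> hassum b l' ->
  hassum (fun i => a i + b i) (l + l').
Proof.
move=> h h' e e0; have e2 : 0 < e / 2 by rewrite divr_gt0.
have [F hF] := h _ e2; have [G hG] := h' _ e2; exists (F `|` G)%fset => H FGH.
rewrite big_split /= opprD addrACA (le_trans (cmodD _ _)) // (splitr e) lerD //.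
  by rewrite hF // (fsubset_trans (fsubsetUl _ _) FGH).
by rewrite hG // (fsubset_trans (fsubsetUr _ _) FGH).
Qed.

Lemma hassumZ c a l : hassum a l -> hassum (fun i => c * a i) (c * l).
Proof.
move=> h e e0; have c1 : 0 < cmod c + 1 by rewrite ltr_wpDl // cmod_ge0.
have [F0 hF0] := h _ (divr_gt0 e0 c1); exists F0 => F F0F.
rewrite -mulr_sumr -mulrBr cmodM (le_trans (ler_wpM2l (cmod_ge0 _) (hF0 _ F0F))) //.
rewrite mulrA ler_pdivrMr // mulrC ler_pM2l //.
by rewrite lerDl.
Qed.

Lemma hassumN a l : hassum a l -> hassum (fun i => - a i) (- l).
Proof.
move=> /(hassumZ (-1)); rewrite mulN1r.
by rewrite (_ : (fun i => -1 * a i) = (fun i => - a i)) //; apply/funext => i; rewrite mulN1r.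
Qed.

Lemma hassumB a b l l' : hassum a l -> hassum b l' ->
  hassum (fun i => a i - b i) (l - l').
Proof. by move=> h /hassumN; exact: hassumD. Qed.

(** Absolutely bounded families are summable: split each term into the positive
    and negative parts of its real and imaginary parts. *)
Lemma usumP a : summ a -> hassum a (usum a).
Proof.
move=> [B aB].
have real (u : I -> R) : (forall i, `|u i| <= cmod (a i)) -> exists l, hassum (fun i => (u i)%:C) l.
  move=> ua.
  have uB : sumbound (fun i => `|u i|) B by exact: sumbound_le ua aB.
  have [l hl] : exists l, hassum (fun i => `|u i|%:C) l by apply: hassum_nonneg uB.
  have [l' hl'] : exists l, hassum (fun i => (u i + `|u i|)%:C) l.
    have u0 i : 0 <= u i + `|u i| by rewrite -lerBlDl sub0r ler_normr lexx orbT.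
    apply: (hassum_nonneg u0 (B := B + B)).
    by apply: sumboundD (uB); apply: sumbound_le uB => i; exact: ler_norm.
  exists (l' - l).
  rewrite (_ : (fun i => (u i)%:C) = (fun i => (u i + `|u i|)%:C - `|u i|%:C)).
    exact: hassumB.
  by apply/funext => i; rewrite -rmorphB addrK.
have [l1 h1] := real (fun i => complex.Re (a i)) (fun i => cmod_Re _).
have [l2 h2] := real (fun i => complex.Im (a i)) (fun i => cmod_Im _).
have h : hassum a (l1 + 'i * l2).
  have := hassumD h1 (hassumZ 'i h2).
  rewrite (_ : (fun i => _ + _) = a) //.
  by apply/funext => i; rewrite -complexE.
by rewrite (usumE h).
Qed.

Lemma summ_le a (u : I -> R) B : (forall i, cmod (a i) <= u i) -> sumbound u B -> summ a.
Proof. by move=> h uB; exists B; exact: sumbound_le uB. Qed.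

Lemma summZ c a : summ a -> summ (fun i => c * a i).
Proof.
move=> [B aB]; exists (cmod c * B); apply: sumbound_le (sumboundZ (cmod_ge0 c) aB).
by move=> i; rewrite cmodM.
Qed.

Lemma usumZ c a : summ a -> usum (fun i => c * a i) = c * usum a.
Proof. by move=> /usumP h; apply: usumE; exact: hassumZ. Qed.

Lemma usumD a b : summ a -> summ b -> usum (fun i => a i + b i) = usum a + usum b.
Proof. by move=> /usumP h /usumP h'; apply: usumE; exact: hassumD. Qed.

Lemma hassum_le a l B : sumbound (fun i => cmod (a i)) B -> hassum a l -> cmod l <= B.
Proof.
move=> aB h; apply: le_eps => e e0; have [F hF] := h e e0.
have -> : l = \sum_(i <- F) a i - (\sum_(i <- F) a i - l) by ring.
rewrite (le_trans (cmodB _ _)) // lerD ?hF //.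
by rewrite (le_trans (cmod_sum _ _ _)).
Qed.

Lemma usum_le a B : sumbound (fun i => cmod (a i)) B -> cmod (usum a) <= B.
Proof. by move=> aB; apply: hassum_le (aB) _; apply: usumP; exists B. Qed.

Lemma hassum_dom a (u : I -> R) l m : (forall i, cmod (a i) <= u i) ->
  hassum a l -> hassum (fun i => (u i)%:C) m -> cmod l <= cmod m.
Proof.
move=> au h h'; apply: le_eps => e e0.
have e2 : 0 < e / 2 by rewrite divr_gt0.
have [F hF] := h _ e2; have [G hG] := h' _ e2.
have := hF _ (fsubsetUl F G); have := hG _ (fsubsetUr F G).
set FG := (F `|` G)%fset => h1 h2.
have h3 : cmod (\sum_(i <- FG) a i) <= cmod (\sum_(i <- FG) (u i)%:C).
  rewrite (le_trans (cmod_sum _ _ _)) // -rmorph_sum cmod_real.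
  by rewrite (le_trans _ (ler_norm _)) // ler_sum.
have h4 := cmod_dist (\sum_(i <- FG) a i) l.
have h5 := cmod_dist (\sum_(i <- FG) (u i)%:C) m.
move: h4 h5; rewrite !ler_norml => /andP[h4 h4'] /andP[h5 h5']; lra.
Qed.

(** Makes convergence uniform in parameters: when the terms are dominated by a
    convergent family, [sumbound_tail] provides [F] and [e] independently of the
    parameters. *)
Lemma hassum_tail a l F (e : R) : hassum a l ->
  (forall G, [disjoint G & F]%fset -> \sum_(i <- G) cmod (a i) <= e) ->
  cmod (\sum_(i <- F) a i - l) <= e.
Proof.
move=> h ht; apply: le_eps => e' e'0; have [F0 hF0] := h _ e'0.
have := hF0 _ (fsubsetUl F0 F); rewrite (sum_fsetID _ (fsubsetUr F0 F)).
set G := ((_ `|` _) `\` _)%fset.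
have dG : [disjoint G & F]%fset by apply/fsetDidPl; rewrite /G fsetDDl fsetUid.
have := ht G dG.
move=> hG hl.
have -> : \sum_(i <- F) a i - l =
  (\sum_(i <- F) a i + \sum_(i <- G) a i - l) - \sum_(i <- G) a i by ring.
rewrite (le_trans (cmodB _ _)) // addrC lerD //.
exact: le_trans (cmod_sum _ _ _) hG.
Qed.

(** Convergence of the partial sums along one exhausting sequence suffices to
    identify a sum that is known to exist. *)
Lemma hassum_cofinal a l (F : nat -> {fset I}) (x : R[i]) : hassum a l ->
  (forall G, exists N, forall n, (N <= n)%N -> (G `<=` F n)%fset) ->
  (forall e : R, 0 < e -> exists N, forall n, (N <= n)%N -> cmod (\sum_(i <- F n) a i - x) <= e) ->
  l = x.
Proof.
move=> h hF hx; apply/eqP; rewrite -subr_eq0; apply/eqP; apply: cmod_eps => e e0.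
have e2 : 0 < e / 2 by rewrite divr_gt0.
have [G hG] := h _ e2; have [N hN] := hF G; have [M hM] := hx _ e2.
pose n := maxn N M.
have := hG _ (hN n (leq_maxl _ _)); have := hM n (leq_maxr _ _).
set s := \sum_(i <- _) _ => h1 h2.
have -> : l - x = (s - x) - (s - l) by ring.
by rewrite (le_trans (cmodB _ _)) // (splitr e) lerD.
Qed.

End UnorderedSums.

(** Reindexing along an injection [io] with partial inverse [ka]: the indices
    outside the image of [io] are those that [io (ka i)] changes. *)

Section Reindex.
Variables (R : realType) (I J : choiceType) (io : J -> I) (ka : I -> J).
Hypothesis ioK : cancel io ka.

Let pre (F : {fset I}) : {fset J} := [fset ka i | i in F & io (ka i) == i]%fset.

Let preE (V : nmodType) (a : I -> V) (F : {fset I}) : (forall i, io (ka i) != i -> a i = 0) ->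
  \sum_(i <- F) a i = \sum_(j <- pre F) a (io j).
Proof.
move=> a0; rewrite /pre big_imfset /=; last first.
  move=> i i' /=. move=> /andP[_ /eqP h] /andP[_ /eqP h'] e.
  by rewrite -h -h' e.
rewrite big_filter.
rewrite (bigID (fun i => io (ka i) == i)) /= [X in _ + X]big1 ?addr0; last by move=> i /a0.
by apply: eq_bigr => i /eqP ->.
Qed.

Lemma sumbound_comp (u : I -> R) B : sumbound u B -> sumbound (u \o io) B.
Proof.
move=> uB F; have := uB [fset io j | j in F]%fset; rewrite big_imfset //=.
by move=> x y _ _; exact: can_inj ioK _ _.
Qed.

Lemma sumbound_reindex (u : I -> R) B : (forall i, io (ka i) != i -> u i = 0) ->
  sumbound (u \o io) B -> sumbound u B.
Proof. by move=> u0 uB F; rewrite preE // uB. Qed.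

Lemma hassum_reindex (a : I -> R[i]) l : (forall i, io (ka i) != i -> a i = 0) ->
  hassum (a \o io) l -> hassum a l.
Proof.
move=> a0 h e e0; have [F0 hF0] := h e e0.
exists [fset io j | j in F0]%fset => F hF; rewrite preE //; apply: hF0.
apply/fsubsetP => j jF0; apply/imfsetP; exists (io j) => /=; last by rewrite ioK.
apply/andP; rewrite ioK eqxx; split=> //; apply: (fsubsetP hF).
by apply/imfsetP; exists j.
Qed.

Lemma summ_comp (a : I -> R[i]) : summ a -> summ (a \o io).
Proof. by move=> [B /sumbound_comp aB]; exists B. Qed.

Lemma summ_reindex (a : I -> R[i]) : (forall i, io (ka i) != i -> a i = 0) ->
  summ (a \o io) -> summ a.
Proof.
move=> a0 [B aB]; exists B; apply: sumbound_reindex aB.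
by move=> i /a0 ->; rewrite cmod0.
Qed.

Lemma usum_reindex (a : I -> R[i]) : (forall i, io (ka i) != i -> a i = 0) ->
  summ (a \o io) -> usum a = usum (a \o io).
Proof. by move=> a0 /usumP h; apply: usumE; exact: hassum_reindex. Qed.

End Reindex.

Section Fubini.
Variables (R : realType) (I J : choiceType).

Lemma sum_fset_rect (V : nmodType) (a : I -> J -> V) (F : {fset I}) (G : {fset J}) :
  \sum_(p <- [fset p in [seq (i, j) | i <- F, j <- G]]%fset) a p.1 p.2 =
  \sum_(i <- F) \sum_(j <- G) a i j.
Proof.
rewrite -(@big_allpairs _ _ _ _ _ F G (fun p => a p.1 p.2)); apply: perm_big.
apply: uniq_perm; first exact: fset_uniq.
  by apply: allpairs_uniq; rewrite ?fset_uniq // => -[x y] [x' y'].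
by move=> p; rewrite inE.
Qed.

Lemma sub_rect (P : {fset I * J}) (F : {fset I}) (G : {fset J}) :
  ([fset p.1 | p in P] `<=` F)%fset -> ([fset p.2 | p in P] `<=` G)%fset ->
  (P `<=` [fset p in [seq (i, j) | i <- F, j <- G]])%fset.
Proof.
move=> /fsubsetP hF /fsubsetP hG; apply/fsubsetP => -[i j] hp; rewrite inE.
apply/allpairsP; exists (i, j); split => //=.
  by apply: hF; apply/imfsetP; exists (i, j).
by apply: hG; apply/imfsetP; exists (i, j).
Qed.

Lemma sumbound_pair (w : I -> J -> R) (v : I -> R) B : (forall i j, 0 <= w i j) ->
  (forall i, sumbound (w i) (v i)) -> sumbound v B ->
  sumbound (fun p : I * J => w p.1 p.2) B.
Proof.
move=> w0 wv vB P.
pose F := [fset p.1 | p in P]%fset; pose G := [fset p.2 | p in P]%fset.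
have PFG := sub_rect (fsubset_refl F) (fsubset_refl G).
rewrite (le_trans (sum_fsetS _ PFG)) //; rewrite sum_fset_rect.
by rewrite (le_trans _ (vB F)) // ler_sum // => i _; apply: wv.
Qed.

Lemma sumboundM (u : I -> R) (v : J -> R) A B : (forall i, 0 <= u i) ->
  (forall i, 0 <= v i) -> sumbound u A -> sumbound v B ->
  sumbound (fun p : I * J => u p.1 * v p.2) (A * B).
Proof.
move=> u0 v0 uA vB; apply: (@sumbound_pair (fun i j => u i * v j) (fun i => B * u i)).
- by move=> i j; rewrite mulr_ge0.
- by move=> i; rewrite mulrC; apply: sumboundZ.
- by rewrite mulrC; apply: sumboundZ => //; exact: sumbound_ge0 vB.
Qed.

Variable a : I -> J -> R[i].

Lemma sumbound_row B : sumbound (fun p : I * J => cmod (a p.1 p.2)) B ->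
  forall i, sumbound (fun j => cmod (a i j)) B.
Proof.
move=> aB i F; have := aB [fset (i, j) | j in F]%fset.
by rewrite big_imfset //= => x y _ _ [].
Qed.

Hypothesis rows : forall i, summ (a i).

(** Finitely many row sums are approximated at once by the sums over a common
    finite set of columns. *)
Lemma rows_approx (F : seq I) (G0 : {fset J}) (e : R) : 0 < e ->
  exists2 G, (G0 `<=` G)%fset &
    \sum_(i <- F) cmod (\sum_(j <- G) a i j - usum (a i)) <= e.
Proof.
move=> e0; suff [G1 hG1] : exists G1, forall G, (G1 `<=` G)%fset ->
    \sum_(i <- F) cmod (\sum_(j <- G) a i j - usum (a i)) <= e.
  exists (G0 `|` G1)%fset; first exact: fsubsetUl.
  by apply: hG1; exact: fsubsetUr.
elim: F e e0 => [|i F IH] e e0.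
  by exists fset0 => G _; rewrite big_nil ltW.
have e2 : 0 < e / 2 by rewrite divr_gt0.
have [G1 h1] := IH _ e2; have [G2 h2] := usumP (rows i) e2.
exists (G1 `|` G2)%fset => G; rewrite fsubUset => /andP[H1 H2].
by rewrite big_cons (splitr e) lerD ?h1 ?h2.
Qed.

Lemma sumbound_usum B : sumbound (fun p : I * J => cmod (a p.1 p.2)) B ->
  sumbound (fun i => cmod (usum (a i))) B.
Proof.
move=> aB F; apply: le_eps => e e0; have [G _ hG] := rows_approx F fset0 e0.
have := aB [fset p in [seq (i, j) | i <- F, j <- G]]%fset.
rewrite (sum_fset_rect (fun i j => cmod (a i j))) => h.
apply: le_trans (lerD h hG); rewrite -big_split /= ler_sum // => i _.
rewrite [X in cmod X <= _](_ : _ = \sum_(j <- G) a i j - (\sum_(j <- G) a i j - usum (a i))).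
  by rewrite (le_trans (cmodB _ _)) // lerD2r cmod_sum.
by ring.
Qed.

(** A finite set of pairs is contained in a rectangle, whose rows are enlarged
    until they reach their sums. *)
Lemma hassum_fubini l : hassum (fun p : I * J => a p.1 p.2) l ->
  hassum (fun i => usum (a i)) l.
Proof.
move=> h e e0; have [P hP] := h e e0.
exists [fset p.1 | p in P]%fset => F hF.
apply: le_eps => e' e'0.
have [G hG hG'] := rows_approx F [fset p.2 | p in P]%fset e'0.
have := hP _ (sub_rect hF hG); rewrite sum_fset_rect => h2.
set x := \sum_(i <- F) \sum_(j <- G) _ in h2.
have -> : \sum_(i <- F) usum (a i) - l = (x - l) - (x - \sum_(i <- F) usum (a i)) by ring.
rewrite (le_trans (cmodB _ _)) // lerD // -sumrB.
exact: le_trans (cmod_sum _ _ _) hG'.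
Qed.

End Fubini.

Section FubiniConsequences.
Variable R : realType.
Implicit Types I J : choiceType.

Lemma usum_fubini I J (a : I -> J -> R[i]) : summ (fun p : I * J => a p.1 p.2) ->
  usum (fun p : I * J => a p.1 p.2) = usum (fun i => usum (a i)).
Proof.
move=> sa; apply/esym/usumE/hassum_fubini; last exact: usumP.
by case: sa => B aB i; exists B; exact: sumbound_row aB i.
Qed.

Lemma usum_exchange I J (a : I -> J -> R[i]) : summ (fun p : I * J => a p.1 p.2) ->
  usum (fun i => usum (a i)) = usum (fun j => usum (a^~ j)).
Proof.
pose sw (K L : Type) (p : K * L) := (p.2, p.1).
have swK (K L : Type) : cancel (@sw K L) (@sw L K) by case.
have neq (p : I * J) : @sw J I (sw I J p) != p -> a p.1 p.2 = 0.
  by rewrite swK eqxx.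
move=> sa; have sa' := summ_comp (swK J I) sa.
rewrite -usum_fubini // (usum_reindex (swK J I)) //.
exact: (@usum_fubini J I (fun j i => a i j) sa').
Qed.

End FubiniConsequences.

Section Boxes.
Variable d : nat.

Definition mval n (f : {ffun 'I_d -> 'I_n}) : multiindex d := [ffun i => val (f i)].

Definition mbox n : {fset multiindex d} := [fset mval f | f in {ffun 'I_d -> 'I_n}]%fset.

Lemma mbox_exhausts (F : {fset multiindex d}) :
  exists N, forall n, (N <= n)%N -> (F `<=` mbox n)%fset.
Proof.
exists (\max_(K <- F) \max_(i < d) (K : multiindex d) i).+1 => n Fn.
apply/fsubsetP => K KF; have Kn i : (K i < n)%N.
  apply: leq_trans Fn; rewrite ltnS; apply: leq_trans (leq_bigmax_seq _ KF _) => //.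
  exact: (@leq_bigmax _ (fun i => (K : multiindex d) i)).
apply/imfsetP; exists [ffun i => Ordinal (Kn i)] => //=.
by apply/ffunP => i; rewrite !ffunE.
Qed.

End Boxes.

Section ProductFamilies.
Variables (R : realType) (d : nat).

(** By distributivity: the sum over a box of multiindices is a product of sums. *)
Lemma sumbound_prod (u : 'I_d -> nat -> R) (B : 'I_d -> R) :
  (forall i k, 0 <= u i k) -> (forall i n, \sum_(k < n) u i k <= B i) ->
  sumbound (fun K : multiindex d => \prod_(i < d) u i (K i)) (\prod_(i < d) B i).
Proof.
move=> u0 uB F; have [n /(_ n (leqnn n)) FG] := mbox_exhausts F.
have mval_inj : injective (@mval d n).
  move=> f g /ffunP h; apply/ffunP => i; apply: val_inj.
  by have := h i; rewrite !ffunE.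
rewrite (le_trans (sum_fsetS _ FG)) //; first by move=> K; apply: prodr_ge0.
rewrite big_imfset //=; last by move=> f g _ _; exact: mval_inj.
rewrite big_enum /= (eq_bigr (fun f : {ffun 'I_d -> 'I_n} => \prod_i u i (f i))); last first.
  by move=> f _; apply: eq_bigr => i _; rewrite ffunE.
rewrite -(bigA_distr_bigA (fun i (k : 'I_n) => u i k)) /=.
apply: ler_prod => i _; rewrite uB andbT.
by apply: sumr_ge0.
Qed.

End ProductFamilies.

(** * The complex exponential and complex differentiability *)

Section ComplexExp.
Variable R : realType.
Implicit Types (z w h : R[i]) (x y : R).

Lemma cexpE x y : cexp (x +i* y) = (expR x * cos y) +i* (expR x * sin y).
Proof. by rewrite /cexp /=; simpc. Qed.

Lemma cexpD z w : cexp (z + w) = cexp z * cexp w.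
Proof.
case: z w => [x y] [x' y']; have -> : (x +i* y) + (x' +i* y') = (x + x') +i* (y + y') by [].
rewrite !cexpE expRD cosD sinD; simpc.
by congr (_ +i* _); ring.
Qed.

Lemma cexp0 : cexp (0 : R[i]) = 1.
Proof. by have -> : (0 : R[i]) = 0 +i* 0 by []; rewrite cexpE expR0 cos0 sin0 mulr1 mulr0. Qed.

Lemma cmod_cexp z : cmod (cexp z) = expR (complex.Re z).
Proof.
case: z => x y; rewrite cexpE /cmod /= !exprMn -mulrDr cos2Dsin2 mulr1 sqrtr_sqr.
by rewrite ger0_norm // expR_ge0.
Qed.

Lemma cexp_neq0 z : cexp z != 0.
Proof. by rewrite -cmod_eq0 cmod_cexp gt_eqF // expR_gt0. Qed.

Lemma cexp_real x : cexp x%:C = (expR x)%:C.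
Proof. by rewrite cexpE cos0 sin0 mulr1 mulr0. Qed.

Lemma cexp_period x y : cexp (x +i* (y + 2 * pi)) = cexp (x +i* y).
Proof.
have h : cos (2 * pi : R) = 1 /\ sin (2 * pi : R) = 0.
  have -> : 2 * pi = pi + pi :> R by rewrite mulr_natl mulr2n.
  by rewrite cosD sinD !cospi !sinpi; split; ring.
by case: h => hc hs; rewrite !cexpE cosD sinD hc hs; congr (_ +i* _); ring.
Qed.

Lemma is_derive_eps (f : R -> R) x l : is_derive x 1 f l ->
  forall e, 0 < e -> exists2 dl, 0 < dl & forall h : R, `|h| < dl ->
    `|f (x + h) - f x - h * l| <= e * `|h|.
Proof.
move=> [df lE] e e0.
have /cvgrPdist_lt/(_ e e0) : h^-1 *: ((f \o shift x) (h *: 1) - f x) @[h --> 0^'] --> l.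
  by rewrite -lE; exact: df.
move=> /nbhs_ballP[dl /= dl0 hd]; exists dl => // h hdl.
have [->|h0] := eqVneq h 0; first by rewrite addr0 subrr mul0r subr0 normr0 mulr0.
have := hd h; rewrite -ball_normE /ball_ /= sub0r normrN => /(_ hdl h0).
rewrite /= /shift /= scaler1 => hl.
have -> : f (x + h) - f x - h * l = - (h * (l - h^-1 *: (f (h + x) - f x))).
  rewrite mulrBr /GRing.scale /= mulrA divff // mul1r [x + h]addrC; ring.
by rewrite normrN normrM mulrC ler_wpM2r // ltW.
Qed.

(** Complex differentiability of the exponential at the origin, from the real
    derivatives of exp, cos and sin:
    e^(x+iy) - 1 - (x+iy) = e^x (cos y - 1) + (e^x - 1 - x)
                            + i (e^x (sin y - y) + (e^x - 1) y). *)
Lemma cexp_eps (e : R) : 0 < e -> exists2 dl : R, 0 < dl & forall h,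
  cmod h < dl -> cmod (cexp h - 1 - h) <= e * cmod h.
Proof.
move=> e0; pose E := expR 1 : R; have E0 : 0 < E := expR_gt0 1.
(* The four terms of the decomposition are at most E e1 |h|, e1 |h|, E e1 |h| and
   (e / 2) |h|, where the last needs |h| <= e / 4. *)
pose e1 := e / (4 * (2 * E + 1)).
have k0 : 0 < 4 * (2 * E + 1) by rewrite mulr_gt0 // addr_gt0 // mulr_gt0.
have e10 : 0 < e1 by rewrite divr_gt0.
have e1E : (2 * E + 1) * e1 = e / 4.
  by rewrite /e1; field; rewrite gt_eqF // addr_gt0 // mulr_gt0.
have [d1 d10 h1] := is_derive_eps (is_derive_expR (0 : R)) e10.
have [d2 d20 h2] := is_derive_eps (is_derive_expR (0 : R)) (@ltr01 R).
have [d3 d30 h3] := is_derive_eps (is_derive_cos (0 : R)) e10.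
have [d4 d40 h4] := is_derive_eps (is_derive_sin (0 : R)) e10.
pose dl := Num.min 1 (Num.min (e / 4) (Num.min d1 (Num.min d2 (Num.min d3 d4)))).
have dl0 : 0 < dl by rewrite !lt_min ltr01 d10 d20 d30 d40 divr_gt0.
exists dl => // h; rewrite !lt_min => /and4P[hl1 hle hd1 /and3P[hd2 hd3 hd4]].
case: h hl1 hle hd1 hd2 hd3 hd4 => x y; set m := cmod _ => hl1 hle hd1 hd2 hd3 hd4.
have xm : `|x| <= m := cmod_Re (x +i* y).
have ym : `|y| <= m := cmod_Im (x +i* y).
have m0 : 0 <= m := cmod_ge0 _.
move: (h1 x (le_lt_trans xm hd1)) (h2 x (le_lt_trans xm hd2))
  (h3 y (le_lt_trans ym hd3)) (h4 y (le_lt_trans ym hd4)).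
rewrite !add0r expR0 cos0 sin0 oppr0 mulr0 !mulr1 !subr0 addr0 mul1r => {h1 h2 h3 h4}.
set A := expR x - 1 - x => h1 h2 h3 h4.
have ex : expR x <= E by rewrite ler_expR (le_trans (ler_norm _)) // (le_trans xm) // ltW.
have ex0 := expR_ge0 x.
have -> : cexp (x +i* y) - 1 - (x +i* y) =
  (expR x * (cos y - 1) + A) +i* (expR x * (sin y - y) + (expR x - 1) * y).
  have -> : (1 : R[i]) = 1 +i* 0 by [].
  by rewrite cexpE /A; simpc; congr (_ +i* _); ring.
rewrite (le_trans (cmod_le_ReIm _)) //=.
have b1 : `|expR x * (cos y - 1)| <= E * (e1 * m).
  rewrite normrM (ger0_norm ex0) ler_pM // (le_trans h3) // ler_wpM2l //; exact: ltW.
have b2 : `|A| <= e1 * m by rewrite (le_trans h1) // ler_wpM2l // ltW.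
have b3 : `|expR x * (sin y - y)| <= E * (e1 * m).
  rewrite normrM (ger0_norm ex0) ler_pM // (le_trans h4) // ler_wpM2l //; exact: ltW.
have b4 : `|(expR x - 1) * y| <= 2 * (e / 4) * m.
  rewrite normrM ler_pM //.
  have -> : expR x - 1 = A + x by rewrite /A; ring.
  rewrite (le_trans (ler_normD _ _)) //; move: (ltW hle); lra.
have := ler_normD (expR x * (cos y - 1)) A.
have := ler_normD (expR x * (sin y - y)) ((expR x - 1) * y).
have e1m : (2 * E + 1) * (e1 * m) = e / 4 * m by rewrite mulrA e1E.
have em : 0 <= e * m by rewrite mulr_ge0 // ltW.
lra.
Qed.

End ComplexExp.

Section ComplexDerivability.
Variable R : realType.
Implicit Types (f g k : R[i] -> R[i]) (z w h l : R[i]) (e : R).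

(** Continuity at the origin, and Caratheodory's form of complex
    differentiability: it turns the rules of calculus into algebra. *)
Definition cont0 f := forall e, 0 < e -> exists2 dl : R, 0 < dl &
  forall h, cmod h < dl -> cmod (f h - f 0) <= e.

Definition cdiff g w := exists2 f, cont0 f &
  exists2 dl : R, 0 < dl & forall h, cmod h < dl -> g (w + h) = g w + h * f h.

Lemma cont0_cst l : cont0 (fun=> l).
Proof. by move=> e e0; exists 1 => // h _; rewrite subrr cmod0 ltW. Qed.

Lemma cont0_id : cont0 (fun h => h).
Proof. by move=> e e0; exists e => // h hl; rewrite subr0 ltW. Qed.

Lemma cont0D f g : cont0 f -> cont0 g -> cont0 (fun h => f h + g h).
Proof.
move=> cf cg e e0; have e2 : 0 < e / 2 by rewrite divr_gt0.
have [d1 d10 h1] := cf _ e2; have [d2 d20 h2] := cg _ e2.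
exists (Num.min d1 d2); first by rewrite lt_min d10.
move=> h; rewrite lt_min => /andP[hd1 hd2].
by rewrite opprD addrACA (le_trans (cmodD _ _)) // (splitr e) lerD ?h1 ?h2.
Qed.

Lemma cont0_bound f : cont0 f -> exists2 dl : R, 0 < dl &
  forall h, cmod h < dl -> cmod (f h) <= cmod (f 0) + 1.
Proof.
move=> /(_ 1 ltr01)[dl dl0 hd]; exists dl => // h hl.
have -> : f h = f 0 + (f h - f 0) by ring.
by rewrite (le_trans (cmodD _ _)) // lerD2l hd.
Qed.

Lemma cont0M f g : cont0 f -> cont0 g -> cont0 (fun h => f h * g h).
Proof.
move=> cf cg e e0.
pose A := cmod (f 0) + 1 : R; pose B := cmod (g 0) + 1 : R.
have A0 : 0 < A by rewrite ltr_wpDl // cmod_ge0.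
have B0 : 0 < B by rewrite ltr_wpDl // cmod_ge0.
have eA : 0 < e / 2 / A by rewrite !divr_gt0.
have eB : 0 < e / 2 / B by rewrite !divr_gt0.
have [d1 d10 h1] := cf _ eB; have [d2 d20 h2] := cg _ eA.
have [d3 d30 h3] := cont0_bound cf.
exists (Num.min d1 (Num.min d2 d3)); first by rewrite !lt_min d10 d20.
move=> h; rewrite !lt_min => /and3P[hd1 hd2 hd3].
have -> : f h * g h - f 0 * g 0 = f h * (g h - g 0) + (f h - f 0) * g 0 by ring.
rewrite (le_trans (cmodD _ _)) // !cmodM (splitr e) lerD //.
  rewrite (@le_trans _ _ (A * (e / 2 / A))) //; last by rewrite mulrC divfK // gt_eqF.
  by rewrite ler_pM ?cmod_ge0 ?h3 ?h2.
rewrite (@le_trans _ _ (e / 2 / B * B)) //; last by rewrite divfK // gt_eqF.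
by rewrite ler_pM ?cmod_ge0 ?h1 // /B lerDl.
Qed.

Lemma cont0V f : cont0 f -> f 0 != 0 -> cont0 (fun h => (f h)^-1).
Proof.
move=> cf f0 e e0; pose m := cmod (f 0); have m0 : 0 < m by rewrite cmod_gt0.
have m2 : 0 < m / 2 by rewrite divr_gt0.
have em : 0 < e * (m / 2 * m) by rewrite !mulr_gt0.
have [d1 d10 h1] := cf _ m2; have [d2 d20 h2] := cf _ em.
exists (Num.min d1 d2); first by rewrite lt_min d10.
move=> h; rewrite lt_min => /andP[hd1 hd2].
have fh : m / 2 <= cmod (f h).
  have := h1 h hd1; rewrite cmodBC; have := cmodD (f 0 - f h) (f h).
  rewrite subrK -/m; lra.
have fh0 : f h != 0 by rewrite -cmod_gt0 (lt_le_trans m2).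
have -> : (f h)^-1 - (f 0)^-1 = (f 0 - f h) * (f h * f 0)^-1 by field; rewrite f0.
rewrite cmodM cmodV cmodBC ler_pdivrMr ?cmodM ?mulr_gt0 ?cmod_gt0 //.
by rewrite (le_trans (h2 h hd2)) // ler_wpM2l ?(ltW e0) // ler_wpM2r // ltW.
Qed.

Lemma cont0_comp f g : cont0 f -> g 0 = 0 -> cont0 g -> cont0 (fun h => f (g h)).
Proof.
move=> cf g0 cg e e0; have [d1 d10 h1] := cf _ e0.
have d2 : 0 < d1 / 2 by rewrite divr_gt0.
have [d3 d30 h3] := cg _ d2; exists d3 => // h hd.
rewrite g0 h1 // (@le_lt_trans _ _ (d1 / 2)) //; last lra.
by have := h3 h hd; rewrite g0 subr0.
Qed.

Lemma cont0_near f g dl : 0 < dl -> (forall h, cmod h < dl -> f h = g h) ->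
  cont0 f -> cont0 g.
Proof.
move=> dl0 fg cf e e0; have [d1 d10 h1] := cf _ e0.
exists (Num.min d1 dl); first by rewrite lt_min d10.
move=> h; rewrite lt_min => /andP[hd1 hd2].
by rewrite -!fg ?h1 // cmod0.
Qed.

Lemma cdiff_cont g w : cdiff g w -> cont0 (fun h => g (w + h)).
Proof.
move=> [f cf [dl dl0 hg]].
apply: (@cont0_near (fun h => g w + h * f h) _ dl dl0); first by move=> h /hg.
by apply: cont0D (cont0_cst _) _; apply: cont0M cf; exact: cont0_id.
Qed.

Lemma cdiff_near f g w dl : 0 < dl -> (forall h, cmod h < dl -> f (w + h) = g (w + h)) ->
  cdiff f w -> cdiff g w.
Proof.
move=> dl0 fg [k ck [d1 d10 hk]]; exists k => //.
exists (Num.min d1 dl); first by rewrite lt_min d10.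
move=> h; rewrite lt_min => /andP[hd1 hd2]; rewrite -fg // hk //.
by have := fg 0; rewrite addr0 => ->; rewrite ?cmod0.
Qed.

Lemma cdiff_cst l w : cdiff (fun=> l) w.
Proof. by exists (fun=> 0); [exact: cont0_cst|exists 1 => // h _; rewrite mulr0 addr0]. Qed.

Lemma cdiff_id w : cdiff (fun z => z) w.
Proof. by exists (fun=> 1); [exact: cont0_cst|exists 1 => // h _; rewrite mulr1]. Qed.

Lemma cdiffD f g w : cdiff f w -> cdiff g w -> cdiff (fun z => f z + g z) w.
Proof.
move=> [f' cf [d1 d10 h1]] [g' cg [d2 d20 h2]]; exists (fun h => f' h + g' h); first exact: cont0D.
exists (Num.min d1 d2); first by rewrite lt_min d10.
by move=> h; rewrite lt_min => /andP[hd1 hd2]; rewrite h1 // h2 //; ring.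
Qed.

Lemma cdiffM f g w : cdiff f w -> cdiff g w -> cdiff (fun z => f z * g z) w.
Proof.
move=> df dg; have cf0 := cdiff_cont df.
case: df dg => [f' cf [d1 d10 h1]] [g' cg [d2 d20 h2]].
exists (fun h => f (w + h) * g' h + f' h * g w).
  by apply: cont0D; apply: cont0M => //; exact: cont0_cst.
exists (Num.min d1 d2); first by rewrite lt_min d10.
by move=> h; rewrite lt_min => /andP[hd1 hd2]; rewrite h1 // h2 //; ring.
Qed.

Lemma cdiffB f g w : cdiff f w -> cdiff g w -> cdiff (fun z => f z - g z) w.
Proof.
move=> df dg; have := cdiffD df (cdiffM (cdiff_cst (-1) w) dg).
by apply: (@cdiff_near _ _ _ 1) => // h _; rewrite mulN1r.
Qed.

Lemma cont0_neq0 f : cont0 f -> f 0 != 0 -> exists2 dl : R, 0 < dl &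
  forall h, cmod h < dl -> f h != 0.
Proof.
move=> cf; rewrite -cmod_gt0 => f0; have f2 : 0 < cmod (f 0) / 2 by rewrite divr_gt0.
have [dl dl0 hd] := cf _ f2; exists dl => // h /hd; rewrite -cmod_gt0 cmodBC.
have := cmodD (f 0 - f h) (f h); rewrite subrK; lra.
Qed.

Lemma cdiffV f w : cdiff f w -> f w != 0 -> cdiff (fun z => (f z)^-1) w.
Proof.
move=> df fw; have cf0 := cdiff_cont df.
have fw0 : (fun h => f (w + h)) 0 != 0 by rewrite addr0.
have [d2 d20 h2] := cont0_neq0 cf0 fw0.
case: df => [f' cf [d1 d10 h1]].
exists (fun h => - f' h * (f (w + h))^-1 * (f w)^-1).
  apply: cont0M (cont0_cst _); apply: cont0M; last exact: cont0V.
  apply: (@cont0_near (fun h => -1 * f' h) _ 1 ltr01); first by move=> h _; rewrite mulN1r.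
  by apply: cont0M => //; exact: cont0_cst.
exists (Num.min d1 d2); first by rewrite lt_min d10.
move=> h; rewrite lt_min => /andP[hd1 hd2]; have := h2 h hd2; rewrite h1 // => fwh.
by field; rewrite fw fwh.
Qed.

Lemma cdiff_comp f g w : cdiff g w -> cdiff f (g w) -> cdiff (fun z => f (g z)) w.
Proof.
move=> [g' cg [d1 d10 h1]] [f' cf [d2 d20 h2]].
have cgh : cont0 (fun h => h * g' h) by apply: cont0M cg; exact: cont0_id.
exists (fun h => g' h * f' (h * g' h)).
  by apply: cont0M cg _; apply: cont0_comp cgh; rewrite ?mul0r.
have [d3 d30 h3] := cgh (d2 / 2) (divr_gt0 d20 (ltr0n R 2)).
exists (Num.min d1 d3); first by rewrite lt_min d10.
move=> h; rewrite lt_min => /andP[hd1 hd3]; rewrite h1 // h2; first by ring.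
have := h3 h hd3; rewrite mul0r subr0 => /le_lt_trans; apply; lra.
Qed.

(** The difference quotient, completed by the derivative at 0, is
    Caratheodory's function. *)
Lemma cdiff_epsP g w l : (forall e, 0 < e -> exists2 dl : R, 0 < dl & forall h,
     cmod h < dl -> cmod (g (w + h) - g w - h * l) <= e * cmod h) -> cdiff g w.
Proof.
move=> H; exists (fun h => if h == 0 then l else (g (w + h) - g w) / h).
  move=> e e0; have [dl dl0 hd] := H e e0; exists dl => // h hl.
  rewrite eqxx; have [_|h0] := eqVneq h 0; first by rewrite subrr cmod0 ltW.
  have -> : (g (w + h) - g w) / h - l = (g (w + h) - g w - h * l) * h^-1 by field.
  by rewrite cmodM cmodV ler_pdivrMr ?cmod_gt0 // hd.
exists 1 => // h _; have [->|h0] := eqVneq h 0; first by rewrite addr0 mul0r addr0.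
by field.
Qed.

Lemma cdiff_eps g w : cdiff g w -> exists l, forall e, 0 < e ->
  exists2 dl : R, 0 < dl & forall h, cmod h < dl ->
    cmod (g (w + h) - g w - h * l) <= e * cmod h.
Proof.
move=> [f cf [d1 d10 h1]]; exists (f 0) => e e0; have [d2 d20 h2] := cf e e0.
exists (Num.min d1 d2); first by rewrite lt_min d10.
move=> h; rewrite lt_min => /andP[hd1 hd2]; rewrite h1 //.
have -> : g w + h * f h - g w - h * f 0 = (f h - f 0) * h by ring.
by rewrite cmodM ler_wpM2r ?cmod_ge0 ?h2.
Qed.

Lemma cdiff_cexp w : cdiff (@cexp R) w.
Proof.
apply: (@cdiff_epsP _ _ (cexp w)) => e e0.
have c0 : 0 < cmod (cexp w) by rewrite cmod_gt0 cexp_neq0.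
have [dl dl0 hd] := cexp_eps (divr_gt0 e0 c0); exists dl => // h hl.
have -> : cexp (w + h) - cexp w - h * cexp w = cexp w * (cexp h - 1 - h).
  by rewrite cexpD; ring.
rewrite cmodM (le_trans (ler_wpM2l (cmod_ge0 _) (hd h hl))) //.
by rewrite mulrA [_ * (e / _)]mulrC divfK // gt_eqF.
Qed.

End ComplexDerivability.

(** * Goursat's lemma for Riemann sums *)

Section Goursat.

Lemma sum_const_pow2 (V : nzRingType) (n : nat) (c : V) :
  \sum_(k < 2 ^ n) c = 2 ^+ n * c.
Proof. by rewrite sumr_const card_ord -[LHS]mulr_natl natrX. Qed.

Variable R : realType.
Implicit Types (g : R[i] -> R[i]) (a b W H x y e : R) (n : nat).

(** Left Riemann sums with 2^n nodes of g dz along a horizontal and a vertical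
   segment starting at a + ib. *)
Definition hsum g n a b W : R[i] :=
  (W / 2 ^+ n)%:C * \sum_(k < 2 ^ n) g ((a + k%:R * (W / 2 ^+ n)) +i* b).

Definition vsum g n a b H : R[i] :=
  'i * (H / 2 ^+ n)%:C * \sum_(k < 2 ^ n) g (a +i* (b + k%:R * (H / 2 ^+ n))).

Definition rsum g n a b W H : R[i] :=
  hsum g n a b W - hsum g n a (b + H) W + vsum g n (a + W) b H - vsum g n a b H.

Let half2 (W : R) n : W / 2 ^+ n.+1 = W / 2 / 2 ^+ n.
Proof. by rewrite exprS; field; rewrite expf_neq0. Qed.

Let halfN (W : R) n : (2 ^ n)%:R * (W / 2 / 2 ^+ n) = W / 2.
Proof. by rewrite natrX; field; rewrite expf_neq0. Qed.

Lemma hsumS g n a b W :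
  hsum g n.+1 a b W = hsum g n a b (W / 2) + hsum g n (a + W / 2) b (W / 2).
Proof.
rewrite /hsum half2 -mulrDr; congr (_ * _).
rewrite expnS mul2n -addnn big_split_ord /=; congr (_ + _).
apply: eq_bigr => k _; congr (g (_ +i* _)).
by rewrite natrD mulrDl halfN addrA.
Qed.

Lemma vsumS g n a b H :
  vsum g n.+1 a b H = vsum g n a b (H / 2) + vsum g n a (b + H / 2) (H / 2).
Proof.
rewrite /vsum half2 -mulrDr; congr (_ * _).
rewrite expnS mul2n -addnn big_split_ord /=; congr (_ + _).
apply: eq_bigr => k _; congr (g (_ +i* _)).
by rewrite natrD mulrDl halfN addrA.
Qed.

Lemma rsumS g n a b W H : rsum g n.+1 a b W H =
  rsum g n a b (W / 2) (H / 2) + rsum g n (a + W / 2) b (W / 2) (H / 2) +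
  (rsum g n a (b + H / 2) (W / 2) (H / 2) +
   rsum g n (a + W / 2) (b + H / 2) (W / 2) (H / 2)).
Proof.
have h2 (c V : R) : c + V / 2 + V / 2 = c + V by field.
by rewrite /rsum !hsumS !vsumS !h2; ring.
Qed.

(** The Riemann sums of an affine function along opposite sides differ by exact
    constants, and these cancel. *)
Lemma rsum_affine n a b W H (c l w : R[i]) :
  rsum (fun z => c + (z - w) * l) n a b W H = 0.
Proof.
have cdivK (V : R) : (V / 2 ^+ n)%:C * 2 ^+ n = V%:C :> R[i].
  rewrite -[2 in X in _ * X](rmorph_nat (real_complex R)) -(rmorphXn (real_complex R)).
  by rewrite -(rmorphM (real_complex R)) divfK // expf_neq0.
have hB : hsum (fun z => c + (z - w) * l) n a b W -
    hsum (fun z => c + (z - w) * l) n a (b + H) W = - (W%:C * ('i * H%:C * l)).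
  rewrite /hsum -mulrBr -sumrB (eq_bigr (fun=> - ('i * H%:C * l))); last first.
    move=> k _; have -> : (a + k%:R * (W / 2 ^+ n)) +i* (b + H) =
      (a + k%:R * (W / 2 ^+ n)) +i* b + 'i * H%:C by simpc.
    by ring.
  by rewrite sum_const_pow2 mulrA cdivK; ring.
have vB : vsum (fun z => c + (z - w) * l) n (a + W) b H -
    vsum (fun z => c + (z - w) * l) n a b H = 'i * H%:C * (W%:C * l).
  rewrite /vsum -mulrBr -sumrB (eq_bigr (fun=> W%:C * l)); last first.
    move=> k _; have -> : (a + W) +i* (b + k%:R * (H / 2 ^+ n)) =
      a +i* (b + k%:R * (H / 2 ^+ n)) + W%:C by simpc.
    by ring.
  by rewrite sum_const_pow2 -(cdivK H) -!mulrA.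
by rewrite /rsum -addrA hB vB; ring.
Qed.

Lemma rsumB f g n a b W H :
  rsum (fun z => f z - g z) n a b W H = rsum f n a b W H - rsum g n a b W H.
Proof. by rewrite /rsum /hsum /vsum !sumrB; ring. Qed.

Lemma rsum_bound g n a b W H e : 0 <= W -> 0 <= H ->
  (forall x y, a <= x <= a + W -> b <= y <= b + H -> cmod (g (x +i* y)) <= e) ->
  cmod (rsum g n a b W H) <= 2 * (W + H) * e.
Proof.
move=> W0 H0 ge.
have two0 : (0 : R) < 2 ^+ n by rewrite exprn_gt0.
have node (c V : R) (k : 'I_(2 ^ n)) : 0 <= V -> c <= c + k%:R * (V / 2 ^+ n) <= c + V.
  move=> V0; rewrite lerDl mulr_ge0 ?divr_ge0 ?(ltW two0) //= lerD2l.
  rewrite mulrA ler_pdivrMr // mulrC ler_wpM2l //.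
  by rewrite -natrX ler_nat ltnW.
have avg (V : R) (F : 'I_(2 ^ n) -> R[i]) : 0 <= V -> (forall k, cmod (F k) <= e) ->
    cmod ((V / 2 ^+ n)%:C * \sum_k F k) <= V * e.
  move=> V0 Fe; rewrite cmodM cmod_real ger0_norm ?divr_ge0 ?(ltW two0) //.
  rewrite (@le_trans _ _ (V / 2 ^+ n * (e * 2 ^+ n))) //.
    rewrite ler_wpM2l ?divr_ge0 ?(ltW two0) // (le_trans (cmod_sum _ _ _)) //.
    rewrite (le_trans (ler_sum _ (fun i _ => Fe i))) //.
    by rewrite sum_const_pow2 mulrC.
  by rewrite mulrACA mulVf ?mulr1 // gt_eqF.
have hE b' : b <= b' <= b + H -> cmod (hsum g n a b' W) <= W * e.
  by move=> hb; apply: avg => // k; apply: ge => //; exact: node.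
have vE a' : a <= a' <= a + W -> cmod (vsum g n a' b H) <= H * e.
  move=> ha; rewrite /vsum -mulrA cmodM cmodi mul1r; apply: avg => // k.
  by apply: ge => //; exact: node.
have bb : b <= b <= b + H by rewrite lexx lerDl.
have bH : b <= b + H <= b + H by rewrite lexx lerDl H0.
have aa : a <= a <= a + W by rewrite lexx lerDl.
have aW : a <= a + W <= a + W by rewrite lexx lerDl W0.
rewrite /rsum (le_trans (cmodB _ _)) //.
have := cmodD (hsum g n a b W - hsum g n a (b + H) W) (vsum g n (a + W) b H).
have := cmodB (hsum g n a b W) (hsum g n a (b + H) W).
move: (hE _ bb) (hE _ bH) (vE _ aa) (vE _ aW); lra.
Qed.

Section Bisection.
Variables (g : R[i] -> R[i]) (a0 b0 W0 H0 e : R).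
Hypotheses (W0_gt0 : 0 < W0) (H0_gt0 : 0 < H0) (e_gt0 : 0 < e).
Hypothesis g_diff : forall x y, a0 <= x <= a0 + W0 -> b0 <= y <= b0 + H0 -> cdiff g (x +i* y).

(** Goursat's inequality for a rectangle: its sums are eventually at most e times
    its area.  The bound is proportional to the area, hence passes from the four
    quarters to the whole. *)
Definition rect_good (a b W H : R) :=
  exists N, forall n, (N <= n)%N -> cmod (rsum g n a b W H) <= e * (W * H).

Lemma rect_good_split a b W H :
  rect_good a b (W / 2) (H / 2) -> rect_good (a + W / 2) b (W / 2) (H / 2) ->
  rect_good a (b + H / 2) (W / 2) (H / 2) ->
  rect_good (a + W / 2) (b + H / 2) (W / 2) (H / 2) -> rect_good a b W H.
Proof.
move=> [N1 h1] [N2 h2] [N3 h3] [N4 h4].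
exists (maxn (maxn N1 N2) (maxn N3 N4)).+1 => -[//|n].
rewrite ltnS !geq_max => /andP[/andP[n1 n2] /andP[n3 n4]]; rewrite rsumS.
have := cmodD (rsum g n a b (W / 2) (H / 2) + rsum g n (a + W / 2) b (W / 2) (H / 2))
  (rsum g n a (b + H / 2) (W / 2) (H / 2) + rsum g n (a + W / 2) (b + H / 2) (W / 2) (H / 2)).
have := cmodD (rsum g n a b (W / 2) (H / 2)) (rsum g n (a + W / 2) b (W / 2) (H / 2)).
have := cmodD (rsum g n a (b + H / 2) (W / 2) (H / 2)) (rsum g n (a + W / 2) (b + H / 2) (W / 2) (H / 2)).
have -> : e * (W * H) = 4 * (e * (W / 2 * (H / 2))) by field.
move: (h1 n n1) (h2 n n2) (h3 n n3) (h4 n n4); lra.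
Qed.

Let wd m := W0 / 2 ^+ m.
Let ht m := H0 / 2 ^+ m.

Let wdS m : wd m / 2 = wd m.+1.
Proof. by rewrite /wd exprS; field; rewrite expf_neq0. Qed.

Let htS m : ht m / 2 = ht m.+1.
Proof. by rewrite /ht exprS; field; rewrite expf_neq0. Qed.

Let wd_gt0 m : 0 < wd m. Proof. by rewrite divr_gt0 // exprn_gt0. Qed.
Let ht_gt0 m : 0 < ht m. Proof. by rewrite divr_gt0 // exprn_gt0. Qed.

Let bad m (p : R * R) := ~ rect_good p.1 p.2 (wd m) (ht m).

Let sub m (p q : R * R) := [/\ p.1 <= q.1, q.1 + wd m.+1 <= p.1 + wd m,
  p.2 <= q.2 & q.2 + ht m.+1 <= p.2 + ht m].

Let bad_step m p : bad m p -> exists q, bad m.+1 q /\ sub m p q.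
Proof.
move=> hp; apply: contrapT => hq; apply: hp.
have good q : sub m p q -> rect_good q.1 q.2 (wd m.+1) (ht m.+1).
  by move=> pq; apply: contrapT => bq; apply: hq; exists q.
have hw := wdS m; have hh := htS m.
have w0 := wd_gt0 m; have h0 := ht_gt0 m.
apply: rect_good_split; rewrite hw hh.
- by apply: (good (p.1, p.2)); split => /=; lra.
- by apply: (good (p.1 + _, p.2)); split => /=; lra.
- by apply: (good (p.1, p.2 + _)); split => /=; lra.
- by apply: (good (p.1 + _, p.2 + _)); split => /=; lra.
Qed.

(** Goursat's lemma for Riemann sums.  A rectangle whose sums are not small
    compared with its area has a quarter with the same defect; the quarters
    shrink to a point, and differentiability there is contradicted. *)
Lemma goursat_good : rect_good a0 b0 W0 H0.
Proof.
apply: contrapT => bad0.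
have nxt m p : exists q, bad m p -> bad m.+1 q /\ sub m p q.
  have [hp|hp] := pselect (bad m p); last by exists p.
  by have [q hq] := bad_step hp; exists q.
have [F hF] := choice (fun mp : nat * (R * R) => nxt mp.1 mp.2).
pose P := fix P m := if m is m'.+1 then F (m', P m') else (a0, b0).
have badP m : bad m (P m).
  elim: m => [|m IH]; first by rewrite /bad /wd /ht expr0 !divr1.
  by have [] := hF (m, P m) IH.
have subP m : sub m (P m) (P m.+1) by have [] := hF (m, P m) (badP m).
have mono (m k : nat) : [/\ (P m).1 <= (P (m + k)%N).1, (P (m + k)%N).1 + wd (m + k) <= (P m).1 + wd m,
    (P m).2 <= (P (m + k)%N).2 & (P (m + k)%N).2 + ht (m + k) <= (P m).2 + ht m].
  elim: k => [|k [h1 h2 h3 h4]]; first by rewrite addn0.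
  rewrite addnS; have [h1' h2' h3' h4'] := subP (m + k)%N.
  by split; [exact: le_trans h1 h1'|exact: le_trans h2' h2|
             exact: le_trans h3 h3'|exact: le_trans h4' h4].
have cross1 m k : (P m).1 <= (P k).1 + wd k.
  have [h1 _ _ _] := mono m k; have [_ h2 _ _] := mono k m.
  rewrite (le_trans h1) // (le_trans _ h2) // addnC lerDl; exact: ltW.
have cross2 m k : (P m).2 <= (P k).2 + ht k.
  have [_ _ h1 _] := mono m k; have [_ _ _ h2] := mono k m.
  rewrite (le_trans h1) // (le_trans _ h2) // addnC lerDl; exact: ltW.
have limit (u v : nat -> R) : (forall m k, u m <= v k) -> exists x, forall m, u m <= x <= v m.
  move=> uv; have hs : has_sup (range u).
    by split; [exists (u 0%N), 0%N|exists (v 0%N) => _ [m _ <-]].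
  exists (sup (range u)) => m; apply/andP; split.
    by apply: sup_upper_bound => //; exists m.
  by apply: ge_sup; [case: hs|move=> _ [k _ <-]].
have [x hx] := limit _ _ cross1; have [y hy] := limit _ _ cross2.
have dxy : cdiff g (x +i* y).
  by apply: g_diff; [have := hx 0%N|have := hy 0%N]; rewrite /wd /ht expr0 divr1.
have [l hl] := cdiff_eps dxy.
(* In a rectangle of sides W0 / 2^m and H0 / 2^m containing the limit point, g
   differs from its affine part by at most e' (W0 + H0) / 2^m, and the sums by
   that times the perimeter: e' is such that the product is e times the area. *)
pose e' := e * (W0 * H0) / (2 * (W0 + H0) ^+ 2).
have S0 : 0 < W0 + H0 by rewrite addr_gt0.
have e'0 : 0 < e' by rewrite divr_gt0 ?mulr_gt0 ?exprn_gt0.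
have [dl dl0 hd] := hl _ e'0.
have [m hm] : exists m, (W0 + H0) / 2 ^+ m < dl.
  have [m hm] : exists m : nat, (W0 + H0) / dl < m%:R.
    by exists (Num.truncn ((W0 + H0) / dl)).+1; exact: truncnS_gt.
  exists m; rewrite ltr_pdivrMr ?exprn_gt0 // mulrC -ltr_pdivrMr //.
  rewrite (lt_le_trans hm) // -natrX ler_nat; exact: ltnW (ltn_expl _ _).
apply: (badP m); exists 0%N => n _.
set p := P m; pose L z := g (x +i* y) + (z - (x +i* y)) * l.
have -> : rsum g n p.1 p.2 (wd m) (ht m) =
   rsum (fun z => g z - L z) n p.1 p.2 (wd m) (ht m).
  by rewrite rsumB rsum_affine subr0.
have /andP[x1 x2] := hx m; have /andP[y1 y2] := hy m.
rewrite (le_trans (rsum_bound (e := e' * (wd m + ht m)) n (ltW (wd_gt0 m)) (ltW (ht_gt0 m)) _)) //.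
  move=> x' y' /andP[x'1 x'2] /andP[y'1 y'2].
  have hc : cmod ((x' +i* y') - (x +i* y)) <= wd m + ht m.
    have -> : (x' +i* y') - (x +i* y) = (x' - x) +i* (y' - y) by simpc.
    rewrite (le_trans (cmod_le_ReIm _)) //= lerD // ler_norml; lra.
  have := hd ((x' +i* y') - (x +i* y)).
  have -> : (x +i* y) + ((x' +i* y') - (x +i* y)) = x' +i* y' by ring.
  move=> hd'; rewrite /L opprD addrA (le_trans (hd' _)) //.
    by rewrite (le_lt_trans hc) // /wd /ht -mulrDl.
  by rewrite ler_wpM2l // ltW.
rewrite le_eqVlt; apply/orP; left; apply/eqP.
rewrite /e' /wd /ht; field.
by rewrite (gt_eqF S0) gt_eqF // exprn_gt0.
Qed.

End Bisection.

Lemma goursat g a b W H : 0 < W -> 0 < H ->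
  (forall x y, a <= x <= a + W -> b <= y <= b + H -> cdiff g (x +i* y)) ->
  forall e, 0 < e -> exists N, forall n, (N <= n)%N -> cmod (rsum g n a b W H) <= e.
Proof.
move=> W0 H0 gd e e0; have WH : 0 < W * H by rewrite mulr_gt0.
have [N hN] := goursat_good W0 H0 (divr_gt0 e0 WH) gd.
by exists N => n /hN; rewrite divfK // gt_eqF.
Qed.

End Goursat.

Section CircleMeans.
Variable R : realType.
Implicit Types (f : R[i] -> R[i]) (r s e : R).

(** Dyadic numbers of nodes fit the bisection of rectangles. *)
Definition unode n (k : nat) : R[i] := cexp (0 +i* (k%:R * (2 * pi / 2 ^+ n))).

Definition cmean n (f : R[i] -> R[i]) : R[i] := (2 ^+ n)^-1 * \sum_(k < 2 ^ n) f (unode n k).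

Lemma cmod_unode n k : cmod (unode n k) = 1.
Proof. by rewrite cmod_cexp expR0. Qed.

Lemma cmean_le n f e : (forall w, cmod w = 1 -> cmod (f w) <= e) -> cmod (cmean n f) <= e.
Proof.
move=> fe; rewrite cmodM cmodV cmodX cmod_nat ler_pdivrMl ?exprn_gt0 //.
rewrite (le_trans (cmod_sum _ _ _)) //.
rewrite -sum_const_pow2; apply: ler_sum => k _; exact: fe (cmod_unode n k).
Qed.

Lemma cmeanD n f g : cmean n (fun w => f w + g w) = cmean n f + cmean n g.
Proof. by rewrite /cmean big_split mulrDr. Qed.

Lemma cmeanZ n c f : cmean n (fun w => c * f w) = c * cmean n f.
Proof. by rewrite /cmean -mulr_sumr mulrCA. Qed.

Lemma cmean_cst n c : cmean n (fun=> c) = c.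
Proof.
by rewrite /cmean sum_const_pow2 mulKf // expf_neq0 // pnatr_eq0.
Qed.

Lemma eq_cmean n f g : (forall w, cmod w = 1 -> f w = g w) -> cmean n f = cmean n g.
Proof. by move=> fg; congr (_ * _); apply: eq_bigr => k _; rewrite fg // cmod_unode. Qed.

(** On an annulus of differentiability the circle means of f are asymptotically
    independent of the radius: this is Goursat's lemma for [f \o cexp] on a
    rectangle of height one period, whose horizontal sides cancel. *)
Lemma cmean_radius_lt f r s : 0 < r -> r < s ->
  (forall z, r <= cmod z <= s -> cdiff f z) ->
  forall e, 0 < e -> exists N, forall n, (N <= n)%N ->
    cmod (cmean n (fun w => f (s%:C * w)) - cmean n (fun w => f (r%:C * w))) <= e.
Proof.
move=> r0 rs fd e e0; have s0 := lt_trans r0 rs.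
pose g z := f (cexp z).
have W0 : 0 < ln s - ln r by rewrite subr_gt0 ltr_ln.
have pi0 : (0 : R) < 2 * pi by rewrite mulr_gt0 // pi_gt0.
have gd x y : ln r <= x <= ln r + (ln s - ln r) -> 0 <= y <= 0 + 2 * pi -> cdiff g (x +i* y).
  move=> /andP[x1 x2] _; apply: cdiff_comp; first exact: cdiff_cexp.
  apply: fd; rewrite cmod_cexp /= -{1}(lnK r0) -(lnK s0) !ler_expR x1 /=.
  by rewrite -[ln s](subrK (ln r)) addrC.
have [N hN] := goursat W0 pi0 gd (mulr_gt0 pi0 e0).
exists N => n /hN; rewrite /rsum.
have -> : hsum g n (ln r) (0 + 2 * pi) (ln s - ln r) = hsum g n (ln r) 0 (ln s - ln r).
  by congr (_ * _); apply: eq_bigr => k _; rewrite /g cexp_period.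
rewrite subrr add0r.
have vE t : 0 < t -> vsum g n (ln t) 0 (2 * pi) =
    'i * (2 * pi)%:C * cmean n (fun w => f (t%:C * w)).
  move=> t0; rewrite /vsum /cmean rmorphM fmorphV rmorphXn rmorph_nat -!mulrA; congr (_ * (_ * (_ * _))).
  apply: eq_bigr => k _; rewrite /g /unode -[in RHS](lnK t0) -cexp_real -cexpD add0r.
  by congr (f (cexp _)); simpc; rewrite -!mulrA.
have -> : ln r + (ln s - ln r) = ln s by ring.
rewrite vE // vE // -mulrBr !cmodM cmodi mul1r cmod_real gtr0_norm //.
by rewrite ler_pM2l.
Qed.

End CircleMeans.

(** * The circle mean and Cauchy's theorem *)

Section UltraLimit.

(** A free ultrafilter assigns to each bounded sequence a limit, linearly: this
    extends the limits of circle means from differentiable functions to all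
    bounded ones. *)
Definition ultra : set_system nat :=
  sval (cid (ultraFilterLemma (@eventually_filter))).

Lemma ultraP : UltraFilter ultra.
Proof. by rewrite /ultra; case: cid => G [/= u _]. Qed.

Lemma ultra_properP : ProperFilter ultra.
Proof. exact: (@ultra_proper _ _ ultraP). Qed.
#[global] Existing Instance ultra_properP.

Lemma ultra_eventually N : ultra [set n | (N <= n)%N].
Proof. by rewrite /ultra; case: cid => G /= [_ h]; apply: h; exists N. Qed.

Variable R : realType.
Implicit Types (u v : nat -> R[i]) (l : R[i]) (B e : R).

Definition ucvg u l := forall e : R, 0 < e -> ultra [set n | cmod (u n - l) <= e].

Definition ulim u : R[i] := xget 0 [set l | ucvg u l].

Lemma ucvg_le u l B : (forall n, cmod (u n) <= B) -> ucvg u l -> cmod l <= B.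
Proof.
move=> uB h; apply: le_eps => e e0.
have [n hn] := filter_ex (h e e0).
have -> : l = u n - (u n - l) by ring.
by rewrite (le_trans (cmodB _ _)) // lerD.
Qed.

Lemma ucvgD u v l l' : ucvg u l -> ucvg v l' -> ucvg (fun n => u n + v n) (l + l').
Proof.
move=> h h' e e0; have e2 : 0 < e / 2 by rewrite divr_gt0.
apply: filterS (filterI (h _ e2) (h' _ e2)) => n [/= h1 h2].
by rewrite opprD addrACA (le_trans (cmodD _ _)) // (splitr e) lerD.
Qed.

Lemma ucvgZ c u l : ucvg u l -> ucvg (fun n => c * u n) (c * l).
Proof.
move=> h e e0; have c1 : 0 < cmod c + 1 by rewrite ltr_wpDl // cmod_ge0.
apply: filterS (h _ (divr_gt0 e0 c1)) => n /= h1.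
rewrite -mulrBr cmodM (le_trans (ler_wpM2l (cmod_ge0 _) h1)) //.
rewrite mulrA ler_pdivrMr // mulrC ler_pM2l //.
by rewrite lerDl.
Qed.

Lemma ucvg_unique u l l' : ucvg u l -> ucvg u l' -> l = l'.
Proof.
move=> h h'; apply/eqP; rewrite -subr_eq0; apply/eqP; apply: cmod_eps => e e0.
have e2 : 0 < e / 2 by rewrite divr_gt0.
have [n [/= h1 h2]] := filter_ex (filterI (h _ e2) (h' _ e2)).
have -> : l - l' = (u n - l') - (u n - l) by ring.
by rewrite (le_trans (cmodB _ _)) // (splitr e) lerD.
Qed.

Lemma ulimE u l : ucvg u l -> ulim u = l.
Proof.
by move=> h; rewrite /ulim; case: xgetP => [l' _ h'|/(_ l)//]; exact: ucvg_unique h' h.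
Qed.

Lemma ucvg_eventually u l : (forall e, 0 < e -> exists N, forall n, (N <= n)%N ->
  cmod (u n - l) <= e) -> ucvg u l.
Proof.
by move=> h e /h[N hN]; apply: filterS (ultra_eventually N) => n /hN.
Qed.

(** The limit is the supremum of the levels that the sequence exceeds almost
    everywhere; ultrafilters decide on which side of a level it lies. *)
Lemma ucvg_real (u : nat -> R) B : (forall n, `|u n| <= B) ->
  exists l, ucvg (fun n => (u n)%:C) l.
Proof.
move=> uB; pose S := [set x | ultra [set n | x <= u n]].
have B_ub x : S x -> x <= B.
  by move=> /filter_ex[n /= h]; rewrite (le_trans h) // (le_trans (ler_norm _)).
have hS : has_sup S.
  split; last by exists B.
  exists (- B); rewrite /S /=; apply: filterE => n /=.
  by have := uB n; rewrite ler_norml => /andP[].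
exists (sup S)%:C => e e0.
have [x Sx hx] := sup_adherent e0 hS.
have nS : ultra (~` [set n | sup S + e <= u n]).
  have [h|//] := in_ultra_setVsetC [set n | sup S + e <= u n] ultraP.
  have : sup S + e <= sup S by apply: sup_upper_bound.
  by rewrite gerDl leNgt e0.
apply: filterS (filterI Sx nS) => n [h1 h2].
rewrite /mkset -(rmorphB (real_complex R)) cmod_real ler_norml.
have {}h1 : x <= u n by [].
have {}h2 : u n < sup S + e by rewrite ltNge; apply/negP.
by lra.
Qed.

Lemma ulimP u B : (forall n, cmod (u n) <= B) -> ucvg u (ulim u).
Proof.
move=> uB.
have [l1 h1] := @ucvg_real (fun n => complex.Re (u n)) B (fun n => le_trans (cmod_Re _) (uB n)).
have [l2 h2] := @ucvg_real (fun n => complex.Im (u n)) B (fun n => le_trans (cmod_Im _) (uB n)).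
have h : ucvg u (l1 + 'i * l2).
  have := ucvgD h1 (ucvgZ 'i h2).
  rewrite (_ : (fun n => _ + _) = u) //.
  by apply/funext => n; rewrite -complexE.
by rewrite (ulimE h).
Qed.

End UltraLimit.

Section CircleFunctional.
Variable R : realType.
Implicit Types (f g : R[i] -> R[i]) (B e : R).

(** The mean over the unit circle as a functional on bounded functions, with no
    continuity or measurability requirement. *)
Definition umean f : R[i] := ulim (fun n => cmean n f).

Definition ubounded f B := forall w, cmod w = 1 -> cmod (f w) <= B.

Lemma umeanP f B : ubounded f B -> ucvg (fun n => cmean n f) (umean f).
Proof. by move=> fB; apply: (@ulimP _ _ B) => n; exact: cmean_le. Qed.

Lemma umean_le f B : ubounded f B -> cmod (umean f) <= B.
Proof. by move=> fB; apply: ucvg_le (umeanP fB) => n; exact: cmean_le. Qed.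

Lemma umeanD f g A B : ubounded f A -> ubounded g B ->
  umean (fun w => f w + g w) = umean f + umean g.
Proof.
move=> fA gB; apply: ulimE.
rewrite (_ : (fun n => _) = (fun n => cmean n f + cmean n g)).
  by apply: ucvgD; [exact: umeanP fA|exact: umeanP gB].
by apply/funext => n; rewrite cmeanD.
Qed.

Lemma umeanZ c f B : ubounded f B -> umean (fun w => c * f w) = c * umean f.
Proof.
move=> fB; apply: ulimE; rewrite (_ : (fun n => _) = (fun n => c * cmean n f)).
  by apply: ucvgZ; exact: umeanP fB.
by apply/funext => n; rewrite cmeanZ.
Qed.

Lemma eq_umean f g : (forall w, cmod w = 1 -> f w = g w) -> umean f = umean g.
Proof.
by move=> fg; congr ulim; apply/funext => n; exact: eq_cmean.
Qed.

Lemma umean0 : umean (fun=> 0) = 0.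
Proof.
apply: ulimE => e e0; apply: filterS (@ultra_eventually 0%N) => n _ /=.
by rewrite cmean_cst subrr cmod0 ltW.
Qed.

Lemma uboundedZ c f B : ubounded f B -> ubounded (fun w => c * f w) (cmod c * B).
Proof. by move=> fB w w1; rewrite cmodM ler_wpM2l ?cmod_ge0 ?fB. Qed.

Lemma umean_sum (I : Type) (s : seq I) (F : I -> R[i] -> R[i]) (B : I -> R) :
  (forall i, ubounded (F i) (B i)) ->
  umean (fun w => \sum_(i <- s) F i w) = \sum_(i <- s) umean (F i).
Proof.
move=> FB; elim: s => [|i s IH].
  rewrite big_nil -[RHS]umean0; apply: eq_umean => w _; exact: big_nil.
rewrite big_cons -IH -(@umeanD _ _ (B i) (\sum_(i <- s) B i)) //.
  by apply: eq_umean => w _; rewrite big_cons.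
by move=> w w1; rewrite (le_trans (cmod_sum _ _ _)) // ler_sum // => j _; exact: FB.
Qed.

End CircleFunctional.

Section GeometricSums.
Variable R : realType.
Implicit Types x e C : R.

Lemma geom_sum_le x n : 0 <= x -> x < 1 -> \sum_(k < n) x ^+ k <= (1 - x)^-1.
Proof.
move=> x0 x1; have x1' : 0 < 1 - x by rewrite subr_gt0.
rewrite -[leRHS]mul1r ler_pdivlMr // mulrC.
have -> : (1 - x) * \sum_(k < n) x ^+ k = 1 - x ^+ n.
  by rewrite -[RHS]opprB subrX1 -mulNr opprB.
by rewrite gerBl exprn_ge0.
Qed.

Lemma expr_eventually_small x C : 0 <= x -> x < 1 -> forall e, 0 < e ->
  exists N, forall n, (N <= n)%N -> C * x ^+ n <= e.
Proof.
move=> x0 x1 e e0.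
have C0 : 0 < `|C| + 1 by rewrite ltr_wpDl.
have xn : `|x| < 1 by rewrite ger0_norm.
have /cvgrPdist_lt/(_ _ (divr_gt0 e0 C0))[N _ hN] := cvg_expr xn.
exists N => n Nn; have := hN n Nn; rewrite /= sub0r normrN ger0_norm ?exprn_ge0 // => h.
rewrite (@le_trans _ _ ((`|C| + 1) * x ^+ n)) //.
  by rewrite ler_wpM2r ?exprn_ge0 // (le_trans (ler_norm _)) // lerDl.
by rewrite mulrC -ler_pdivlMr // ltW.
Qed.

End GeometricSums.

Section CauchyTaylor.
Variable R : realType.
Implicit Types (f h : R[i] -> R[i]) (r s e : R) (a z w : R[i]).

Lemma cmean_le_angle n f e :
  (forall t, 0 <= t <= 2 * pi -> cmod (f (cexp (0 +i* t))) <= e) ->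
  cmod (cmean n f) <= e.
Proof.
move=> fe; rewrite cmodM cmodV cmodX cmod_nat ler_pdivrMl ?exprn_gt0 //.
rewrite (le_trans (cmod_sum _ _ _)) // -sum_const_pow2; apply: ler_sum => k _; apply: fe.
have pi0 : (0 : R) <= 2 * pi by rewrite mulr_ge0 // pi_ge0.
rewrite mulr_ge0 ?divr_ge0 ?exprn_ge0 //= mulrA ler_pdivrMr ?exprn_gt0 // mulrC.
by rewrite ler_wpM2l // -natrX ler_nat ltnW.
Qed.

Lemma cmeanB n f g : cmean n (fun w => f w - g w) = cmean n f - cmean n g.
Proof. by rewrite /cmean sumrB mulrBr. Qed.

(** A function that is merely continuous on a circle has circle means that vary
    continuously with the radius, uniformly in the number of nodes: this is
    uniform continuity, by compactness of the interval of angles. *)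
Lemma cmean_radius_near h r : 0 < r ->
  (forall z, cmod z = r -> cont0 (fun t => h (z + t))) ->
  forall e, 0 < e -> exists2 dl, 0 < dl & forall s n, `|s - r| < dl ->
    cmod (cmean n (fun w => h (s%:C * w)) - cmean n (fun w => h (r%:C * w))) <= e.
Proof.
move=> r0 hc e e0.
have /compact_near_coveringP cK := @segment_compact R 0 (2 * pi).
have e2 : 0 < e / 2 by rewrite divr_gt0.
have : \forall dl \near (0 : R)^'+, `[0, 2 * pi]%classic `<=`
    [set t | forall s, `|s - r| < dl ->
      cmod (h (s%:C * cexp (0 +i* t)) - h (r%:C * cexp (0 +i* t))) <= e].
  apply: cK => t0 _.
  set z0 := r%:C * cexp (0 +i* t0).
  have z0r : cmod z0 = r by rewrite /z0 cmodM cmod_cexp expR0 mulr1 cmod_real gtr0_norm.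
  have [d1 d10 h1] := hc _ z0r _ e2.
  have h2 z : cmod (z - z0) < d1 -> cmod (h z - h z0) <= e / 2.
    by move=> /h1; rewrite addr0; have -> : z0 + (z - z0) = z by ring.
  have d2 : 0 < d1 / 2 / r by rewrite !divr_gt0.
  have [d3 d30 h3] := cdiff_cont (cdiff_cexp (0 +i* t0)) d2.
  have h4 (t : R) : `|t - t0| < d3 -> cmod (r%:C * cexp (0 +i* t) - z0) <= d1 / 2.
    move=> ht; rewrite /z0 -mulrBr cmodM cmod_real gtr0_norm // mulrC -ler_pdivlMr //.
    have := h3 (0 +i* (t - t0)); rewrite addr0.
    have -> : (0 +i* t0) + (0 +i* (t - t0)) = 0 +i* t by simpc; rewrite addrC subrK.
    apply; rewrite (le_lt_trans (cmod_le_ReIm _)) //= normr0 add0r //.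
  exists ([set t | `|t - t0| < d3], [set dl | dl < d1 / 2]).
    split => /=.
      by apply/nbhs_ballP; exists d3 => // t; rewrite -ball_normE /ball_ /= distrC.
    have d12 : 0 < d1 / 2 by rewrite divr_gt0.
    exact: nbhs_right_lt.
  move=> [t dl] /= [ht hdl] s hs.
  have h5 := h4 t ht.
  have h6 : cmod (s%:C * cexp (0 +i* t) - r%:C * cexp (0 +i* t)) < d1 / 2.
    by rewrite -mulrBl -(rmorphB (real_complex R)) cmodM cmod_cexp expR0 mulr1 cmod_real (lt_trans hs).
  have A1 : cmod (h (r%:C * cexp (0 +i* t)) - h z0) <= e / 2 by apply: h2; lra.
  have A2 : cmod (h (s%:C * cexp (0 +i* t)) - h z0) <= e / 2.
    apply: h2; set z1 := s%:C * _ in h6 *; set z2 := r%:C * _ in h5 h6 *.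
    have -> : z1 - z0 = (z1 - z2) + (z2 - z0) by ring.
    rewrite (le_lt_trans (cmodD _ _)) //; lra.
  move: A1 A2; set x := h (s%:C * _); set y := h (r%:C * _) => A1 A2.
  have -> : x - y = (x - h z0) - (y - h z0) by ring.
  by rewrite (le_trans (cmodB _ _)) // (splitr e) lerD.
move=> hnear; have [dl [dl0 hdl]] := filter_ex (filterI (nbhs_right_gt (0 : R)) hnear).
exists dl => // s n hs; rewrite -cmeanB; apply: cmean_le_angle => t ht.
by apply: hdl => //=; rewrite in_itv.
Qed.

Lemma cmean_radius h r s : 0 < r -> 0 < s ->
  (forall z, Num.min r s <= cmod z <= Num.max r s -> cdiff h z) ->
  forall e, 0 < e -> exists N, forall n, (N <= n)%N ->
    cmod (cmean n (fun w => h (s%:C * w)) - cmean n (fun w => h (r%:C * w))) <= e.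
Proof.
move=> r0 s0; have [rs|sr|->] := ltgtP r s.
- by move=> hd e e0; exact: cmean_radius_lt.
- move=> hd e e0; have [N hN] := cmean_radius_lt s0 sr hd e0.
  by exists N => n /hN; rewrite cmodBC.
- by move=> _ e e0; exists 0%N => n _; rewrite subrr cmod0 ltW.
Qed.

(** Cauchy's theorem for a function vanishing at the origin that is
    differentiable except at one point, where it is continuous: from the circle of
    radius r the radius decreases to slightly above |a|, jumps by uniform
    continuity to slightly below |a|, and decreases further to where h is small. *)
Lemma cmean_cvg0 h a r : cmod a < r ->
  (forall z, cmod z <= r -> z != a -> cdiff h z) ->
  (forall z, cmod z <= r -> cont0 (fun t => h (z + t))) -> h 0 = 0 ->
  forall e, 0 < e -> exists N, forall n, (N <= n)%N ->
    cmod (cmean n (fun w => h (r%:C * w))) <= e.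
Proof.
move=> ar hd hc h0 e e0.
have r0 : 0 < r := le_lt_trans (cmod_ge0 a) ar.
pose m s n := cmean n (fun w => h (s%:C * w)).
have e4 : 0 < e / 4 by rewrite divr_gt0.
have small : exists2 s0, 0 < s0 & forall s n, 0 < s -> s < s0 -> cmod (m s n) <= e / 4.
  have [dl dl0 hdl] : exists2 dl, 0 < dl & forall t, cmod t < dl -> cmod (h t) <= e / 4.
    have [|dl dl0 hdl] := hc 0 _ _ e4; first by rewrite cmod0 ltW.
    by exists dl => // t /hdl; rewrite addr0 add0r h0 subr0.
  exists dl => // s n s0 sl; apply: cmean_le => w w1; apply: hdl.
  by rewrite cmodM w1 mulr1 cmod_real gtr0_norm.
case: small => s0 s00 small.
have [a0|a0] := eqVneq a 0.
  pose s := Num.min (s0 / 2) (r / 2).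
  have ss : 0 < s by rewrite lt_min !divr_gt0.
  have ss0 : s < s0 by rewrite gt_min; apply/orP; left; lra.
  have sr : s < r by rewrite gt_min; apply/orP; right; lra.
  have hsd z : s <= cmod z <= r -> cdiff h z.
    move=> /andP[sz zr]; apply: hd => //; rewrite a0 -cmod_gt0.
    exact: lt_le_trans sz.
  have [N hN] := cmean_radius_lt ss sr hsd e4.
  exists N => n /hN; have := small s n ss ss0; rewrite /m.
  set x := cmean _ _; set y := cmean _ _ => hx hy.
  have -> : y = (y - x) + x by ring.
  rewrite (le_trans (cmodD _ _)) //; lra.
have am : 0 < cmod a by rewrite cmod_gt0.
have hca z : cmod z = cmod a -> cont0 (fun t => h (z + t)).
  by move=> za; apply: hc; rewrite za ltW.
have [dl dl0 hdl] := cmean_radius_near am hca e4.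
pose s1 := Num.max (cmod a - dl / 2) (cmod a / 2).
pose s2 := Num.min (cmod a + dl / 2) ((cmod a + r) / 2).
pose s := Num.min (s0 / 2) s1.
have s1a : s1 < cmod a by rewrite gt_max; apply/andP; split; lra.
have s10 : 0 < s1 by rewrite lt_max; apply/orP; right; lra.
have s1dl : cmod a - dl < s1 by rewrite lt_max; apply/orP; left; lra.
have s2a : cmod a < s2 by rewrite lt_min; apply/andP; split; lra.
have s2r : s2 < r by rewrite gt_min; apply/orP; right; lra.
have s2dl : s2 < cmod a + dl by rewrite gt_min; apply/orP; left; lra.
have ss : 0 < s by rewrite lt_min s10 divr_gt0.
have ss0 : s < s0 by rewrite gt_min; apply/orP; left; lra.
have ss1 : s <= s1 by rewrite ge_min lexx orbT.
have near1 n : cmod (m s1 n - m (cmod a) n) <= e / 4.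
  by apply: hdl; rewrite ltr_norml; apply/andP; split; lra.
have near2 n : cmod (m s2 n - m (cmod a) n) <= e / 4.
  by apply: hdl; rewrite ltr_norml; apply/andP; split; lra.
have d1 z : Num.min s s1 <= cmod z <= Num.max s s1 -> cdiff h z.
  rewrite (max_idPr ss1) => /andP[_ hz]; apply: hd; first lra.
  by apply: contraTneq hz => ->; rewrite -ltNge.
have e8 : 0 < e / 8 by rewrite divr_gt0.
have [N1 hN1] := cmean_radius ss s10 d1 e8.
have s20 : 0 < s2 by lra.
have d2 z : s2 <= cmod z <= r -> cdiff h z.
  move=> /andP[hz hz']; apply: hd => //.
  by apply: contraTneq hz => ->; rewrite -ltNge.
have [N2 hN2] := cmean_radius_lt s20 s2r d2 e8.
exists (maxn N1 N2) => n; rewrite geq_max => /andP[/hN1 b1 /hN2 b2].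
have b3 := near1 n; have b4 := near2 n; have b5 := small s n ss ss0.
rewrite -/(m r n) -/(m s2 n) in b2; rewrite -/(m s1 n) -/(m s n) in b1.
rewrite -/(m r n).
have -> : m r n = (m r n - m s2 n) + (m s2 n - m (cmod a) n)
   - (m s1 n - m (cmod a) n) + (m s1 n - m s n) + m s n by ring.
have := cmodD ((m r n - m s2 n) + (m s2 n - m (cmod a) n) - (m s1 n - m (cmod a) n) + (m s1 n - m s n)) (m s n).
have := cmodD ((m r n - m s2 n) + (m s2 n - m (cmod a) n) - (m s1 n - m (cmod a) n)) (m s1 n - m s n).
have := cmodB ((m r n - m s2 n) + (m s2 n - m (cmod a) n)) (m s1 n - m (cmod a) n).
have := cmodD (m r n - m s2 n) (m s2 n - m (cmod a) n).
lra.
Qed.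

End CauchyTaylor.

(** * Cauchy's formula and Taylor series *)

Section InitialSegments.

Definition upto (n : nat) : {fset nat} := [fset m in iota 0 n]%fset.

Lemma mem_upto n m : (m \in upto n) = (m < n)%N.
Proof. by rewrite inE mem_iota add0n. Qed.

Lemma sum_upto (V : nmodType) (a : nat -> V) n :
  \sum_(m <- upto n) a m = \sum_(m < n) a m.
Proof.
rewrite -(big_mkord xpredT a); apply: perm_big.
by apply: uniq_perm; rewrite ?fset_uniq ?iota_uniq // => m; rewrite mem_upto mem_index_iota.
Qed.

Lemma sub_upto (F : {fset nat}) n : (\max_(m <- F) m < n)%N -> (F `<=` upto n)%fset.
Proof.
move=> Fn; apply/fsubsetP => m mF; rewrite mem_upto; apply: leq_ltn_trans Fn.
exact: (@leq_bigmax_seq _ _ xpredT id m mF isT).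
Qed.

End InitialSegments.

Section CauchyFormula.
Variables (R : realType) (f : R[i] -> R[i]) (r : R).
Hypotheses (r_gt0 : 0 < r) (f_diff : forall z, cmod z <= r -> cdiff f z).

Let rC0 : (r%:C : R[i]) != 0.
Proof. by rewrite -cmod_gt0 cmod_real gtr0_norm. Qed.

Let cmod_rw w : cmod w = 1 -> cmod (r%:C * w) = r.
Proof. by move=> w1; rewrite cmodM w1 mulr1 cmod_real gtr0_norm. Qed.

(** The circle can be enlarged, since the kernel is singular at [a] only, and the
    kernel tends to 1 at infinity. *)
Lemma cmean_kernel (a : R[i]) : cmod a < r -> forall e : R, 0 < e ->
  exists N, forall n, (N <= n)%N ->
    cmod (cmean n (fun w => r%:C * w / (r%:C * w - a)) - 1) <= e.
Proof.
move=> ar e e0; have a0 := cmod_ge0 a.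
have e2 : 0 < e / 2 by rewrite divr_gt0.
pose s := r + cmod a / (e / 2).
have rs : r <= s by rewrite lerDl divr_ge0 // ltW.
have as0 z : cmod a < cmod z -> z - a != 0.
  by apply: contraTneq => /subr0_eq ->; rewrite ltxx.
have near1 n t : cmod a < t -> cmod a / (t - cmod a) <= e / 2 ->
    cmod (cmean n (fun w => t%:C * w / (t%:C * w - a)) - 1) <= e / 2.
  move=> at0 hs; rewrite -[X in _ - X](cmean_cst n) -cmeanB; apply: cmean_le => w w1.
  have t0 : 0 < t by lra.
  have tw : cmod (t%:C * w) = t by rewrite cmodM w1 mulr1 cmod_real gtr0_norm.
  have hw : t%:C * w - a != 0 by apply: as0; rewrite tw.
  have -> : t%:C * w / (t%:C * w - a) - 1 = a / (t%:C * w - a) by field.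
  rewrite cmodM cmodV (le_trans _ hs) // ler_wpM2l // lef_pV2 ?posrE ?subr_gt0 //; last by rewrite cmod_gt0.
  by have := cmodD (t%:C * w - a) a; rewrite subrK tw; lra.
pose t := s + cmod a.
have hs : cmod a / (t - cmod a) <= e / 2.
  rewrite /t addrK ler_pdivrMr; last by lra.
  rewrite mulrC -ler_pdivrMr // /s; lra.
have at0 : cmod a < t by rewrite /t; lra.
have rt : r <= t by rewrite /t; lra.
have [rt'|tr] := ltP r t; last first.
  have -> : r = t by apply/eqP; rewrite eq_le rt tr.
  by exists 0%N => n _; rewrite (le_trans (near1 n _ at0 hs)) //; lra.
have kd z : r <= cmod z <= t -> cdiff (fun z => z / (z - a)) z.
  move=> /andP[rz _]; apply: cdiffM; first exact: cdiff_id.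
  apply: cdiffV; first by apply: cdiffB; [exact: cdiff_id|exact: cdiff_cst].
  by apply: as0; lra.
have [N hN] := cmean_radius_lt r_gt0 rt' kd e2.
exists N => n /hN h1; have h2 := near1 n _ at0 hs; move: h1 h2.
set x := cmean _ _; set y := cmean _ _ => h1 h2.
have -> : y - 1 = (x - 1) - (x - y) by ring.
by rewrite (le_trans (cmodB _ _)) // (splitr e) lerD.
Qed.

(** Cauchy's formula: Cauchy's theorem for the function z (f z - f a) / (z - a)
    reduces it to constant f, where enlarging the circle computes the mean of
    the kernel. *)
Lemma cauchy_formula (a : R[i]) : cmod a < r ->
  umean (fun w => f (r%:C * w) * (r%:C * w / (r%:C * w - a))) = f a.
Proof.
move=> ar; have [psi cpsi [d0 d00 fpsi]] := f_diff (ltW ar).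
(* [psi] is Caratheodory's function of f at a, so that h is continuous at a. *)
pose h z := if z == a then a * psi 0 else z * (f z - f a) / (z - a).
have hd z : cmod z <= r -> z != a -> cdiff h z.
  move=> zr za; have za0 : z - a != 0 by rewrite subr_eq0.
  have kd : cdiff (fun z => z * (f z - f a) / (z - a)) z.
    apply: cdiffM; last first.
      by apply: cdiffV => //; apply: cdiffB; [exact: cdiff_id|exact: cdiff_cst].
    apply: cdiffM; first exact: cdiff_id.
    by apply: cdiffB; [exact: f_diff|exact: cdiff_cst].
  apply: (@cdiff_near _ _ _ _ (cmod (z - a))) kd; first by rewrite cmod_gt0.
  move=> t ht; rewrite /h; case: eqP => // zta; move: ht.
  have -> : z - a = - t by rewrite -zta; ring.
  by rewrite cmodN ltxx.
have hc z : cmod z <= r -> cont0 (fun t => h (z + t)).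
  move=> zr; have [->|za] := eqVneq z a; last by apply: cdiff_cont; exact: hd.
  apply: (@cont0_near _ (fun t => (a + t) * psi t) _ d0) => //.
    move=> t /fpsi ft; rewrite /h; have [e|t0] := eqVneq (a + t) a.
      have -> : t = 0 by rewrite -(addKr a t) e addNr.
      by rewrite addr0.
    rewrite ft; have t0' : t != 0 by apply: contraNneq t0 => ->; rewrite addr0.
    by field; rewrite addrC addKr.
  apply: cont0M cpsi; apply: cont0D; [exact: cont0_cst|exact: cont0_id].
have h0 : h 0 = 0 by rewrite /h; case: eqP => [<-|_]; rewrite !mul0r.
apply: ulimE; apply: ucvg_eventually => e e0.
have e2 : 0 < e / 2 by rewrite divr_gt0.
have k0 : 0 < cmod (f a) + 1 by rewrite ltr_wpDl // cmod_ge0.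
have [N1 hN1] := cmean_cvg0 ar hd hc h0 e2.
have [N2 hN2] := cmean_kernel ar (divr_gt0 e2 k0).
exists (maxn N1 N2) => n; rewrite geq_max => /andP[/hN1 h1 /hN2 h2].
have -> : cmean n (fun w => f (r%:C * w) * (r%:C * w / (r%:C * w - a))) - f a =
  cmean n (fun w => h (r%:C * w)) +
  f a * (cmean n (fun w => r%:C * w / (r%:C * w - a)) - 1).
  rewrite mulrBr mulr1 addrA -cmeanZ -cmeanD; congr (_ - _); apply: eq_cmean => w w1.
  have wa : r%:C * w != a.
    by apply: contraTneq ar => <-; rewrite cmod_rw // ltxx.
  by rewrite /h (negPf wa); field; rewrite subr_eq0.
rewrite (le_trans (cmodD _ _)) // (splitr e) lerD // cmodM.
rewrite (le_trans (ler_wpM2l (cmod_ge0 _) h2)) // mulrA ler_pdivrMr // mulrC ler_pM2l //.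
by rewrite lerDl.
Qed.

(** Taylor coefficient at the origin as a mean over the circle of radius r. *)
Definition tcoef (g : R[i] -> R[i]) (m : nat) : R[i] :=
  (r%:C ^+ m)^-1 * umean (fun w => w^-1 ^+ m * g (r%:C * w)).

Variable B : R.
Hypothesis f_bound : forall z, cmod z = r -> cmod (f z) <= B.

Lemma ubounded_tcoef m : ubounded (fun w => w^-1 ^+ m * f (r%:C * w)) B.
Proof. by move=> w w1; rewrite cmodM cmodX cmodV w1 invr1 expr1n mul1r f_bound // cmod_rw. Qed.

Lemma tcoef_le m : cmod (tcoef f m) <= B / r ^+ m.
Proof.
rewrite cmodM cmodV cmodX cmod_real gtr0_norm // mulrC ler_wpM2r ?invr_ge0 ?exprn_ge0 ?(ltW r_gt0) //.
exact: umean_le (@ubounded_tcoef m).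
Qed.

(** Expand the kernel of Cauchy's formula into a finite geometric sum in
    a / (r w), with explicit remainder. *)
Lemma taylor_remainder (a : R[i]) M : cmod a < r ->
  cmod (\sum_(m < M) a ^+ m * tcoef f m - f a) <= B * (1 - cmod a / r)^-1 * (cmod a / r) ^+ M.
Proof.
move=> ar; have B0 : 0 <= B by rewrite (le_trans (cmod_ge0 (f r%:C))) // f_bound // cmod_real gtr0_norm.
pose x (w : R[i]) := a / (r%:C * w).
have xr w : cmod w = 1 -> cmod (x w) = cmod a / r by move=> w1; rewrite cmodM cmodV cmod_rw.
have q1 : cmod a / r < 1 by rewrite ltr_pdivrMr // mul1r.
have x1 w : cmod w = 1 -> 1 - x w != 0.
  move=> w1; rewrite subr_eq0; apply: contraTneq q1 => h.
  by rewrite -(xr w w1) -h cmod1 ltxx.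
pose rem w := x w ^+ M * (1 - x w)^-1 * f (r%:C * w).
have remB : ubounded rem (B * (1 - cmod a / r)^-1 * (cmod a / r) ^+ M).
  move=> w w1; rewrite !cmodM cmodX xr // cmodV mulrC [leRHS]mulrC mulrCA.
  rewrite ler_wpM2l ?exprn_ge0 ?divr_ge0 ?cmod_ge0 ?(ltW r_gt0) //.
  rewrite ler_pM ?cmod_ge0 ?invr_ge0 ?cmod_ge0 ?f_bound ?cmod_rw //.
  rewrite lef_pV2 ?posrE ?cmod_gt0 ?x1 ?subr_gt0 //.
  by have := cmodD (1 - x w) (x w); rewrite subrK cmod1 xr //; lra.
suff -> : \sum_(m < M) a ^+ m * tcoef f m - f a = - umean rem by rewrite cmodN; exact: umean_le.
rewrite -(cauchy_formula ar).
have -> : \sum_(m < M) a ^+ m * tcoef f m =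
    umean (fun w => \sum_(m < M) (a ^+ m * (r%:C ^+ m)^-1) * (w^-1 ^+ m * f (r%:C * w))).
  rewrite (umean_sum _ (fun m : 'I_M => uboundedZ (a ^+ m * (r%:C ^+ m)^-1) (@ubounded_tcoef m))).
  by apply: eq_bigr => m _; rewrite (umeanZ _ (@ubounded_tcoef m)) mulrA.
rewrite (@eq_umean _ (fun w => f (r%:C * w) * _)
  (fun w => \sum_(m < M) (a ^+ m * (r%:C ^+ m)^-1) * (w^-1 ^+ m * f (r%:C * w)) + rem w)).
  rewrite (umeanD _ remB (A := \sum_(m < M) cmod (a ^+ m * (r%:C ^+ m)^-1) * B)).
    by rewrite opprD addrA subrr add0r.
  move=> w w1; rewrite (le_trans (cmod_sum _ _ _)) // ler_sum // => m _.
  exact: (uboundedZ _ (@ubounded_tcoef m)).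
move=> w w1.
have w0 : w != 0 by rewrite -cmod_gt0 w1.
have -> : r%:C * w / (r%:C * w - a) = (1 - x w)^-1.
  have := x1 w w1; rewrite /x => h.
  have h' : r%:C * w - a != 0.
    apply: contraNneq h => h; have -> : a = r%:C * w by apply/esym/subr0_eq.
    by rewrite divff ?subrr // mulf_neq0.
  field; rewrite h' w0 rC0 /=.
  by [].
rewrite (eq_bigr (fun m : 'I_M => x w ^+ m * f (r%:C * w))); last first.
  move=> m _; rewrite mulrA; congr (_ * _).
  by rewrite /x -!exprVn -!exprMn invfM mulrA.
rewrite -mulr_suml /rem -mulrDl mulrC; congr (_ * _).
have := x1 w w1; move: (x w) => y y1.
have := subrX1 y M; set s := \sum_(i < M) _ => hy.
have -> : y ^+ M = 1 + (y - 1) * s by rewrite -hy; ring.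
by field.
Qed.

Lemma taylor_sumbound (a : R[i]) : cmod a < r ->
  sumbound (fun m => cmod (a ^+ m * tcoef f m)) (B * (1 - cmod a / r)^-1).
Proof.
move=> ar; have B0 : 0 <= B by rewrite (le_trans (cmod_ge0 (f r%:C))) // f_bound // cmod_real gtr0_norm.
have q1 : cmod a / r < 1 by rewrite ltr_pdivrMr // mul1r.
have q0 : 0 <= cmod a / r by rewrite divr_ge0 ?cmod_ge0 // ltW.
apply: (@sumbound_le _ _ _ (fun m => B * (cmod a / r) ^+ m)).
  move=> m; rewrite cmodM cmodX expr_div_n mulrCA.
  by rewrite ler_wpM2l ?exprn_ge0 ?cmod_ge0 ?tcoef_le.
apply: sumboundZ => // F.
have FM := @sub_upto F _ (leqnn _).
rewrite (le_trans (sum_fsetS _ FM)) //; first by move=> m; rewrite exprn_ge0.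
by rewrite sum_upto geom_sum_le.
Qed.

Lemma taylor (a : R[i]) : cmod a < r -> hassum (fun m => a ^+ m * tcoef f m) (f a).
Proof.
move=> ar; have := taylor_sumbound ar => sb.
have q1 : cmod a / r < 1 by rewrite ltr_pdivrMr // mul1r.
have q0 : 0 <= cmod a / r by rewrite divr_ge0 ?cmod_ge0 // ltW.
have hs : summ (fun m => a ^+ m * tcoef f m) by exists (B * (1 - cmod a / r)^-1).
have h := usumP hs; rewrite -[f a](hassum_cofinal h (F := upto)) //.
  by move=> F; exists (\max_(m <- F) m).+1 => n; exact: sub_upto.
move=> e e0.
have [N hN] := expr_eventually_small (B * (1 - cmod a / r)^-1) q0 q1 e0.
by exists N => n /hN; rewrite sum_upto; apply: le_trans; exact: taylor_remainder.
Qed.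

End CauchyFormula.

(** * Multiindices *)

Section Multiindex.
Variable d : nat.
Implicit Types (I J K L : multiindex d) (i j : 'I_d).

Definition munit j n : multiindex d := [ffun i => if i == j then n else 0%N].
Definition mzero : multiindex d := [ffun=> 0%N].
Definition msub K L : multiindex d := [ffun i => (K i - L i)%N].
Definition mleq L K := [forall i, (L i <= K i)%N].

Lemma maddC : commutative (@madd d).
Proof. by move=> I J; apply/ffunP => i; rewrite !ffunE addnC. Qed.

Lemma maddA : associative (@madd d).
Proof. by move=> I J K; apply/ffunP => i; rewrite !ffunE addnA. Qed.

Lemma madd0 K : madd K mzero = K.
Proof. by apply/ffunP => i; rewrite !ffunE addn0. Qed.

Lemma madd0m K : madd mzero K = K.
Proof. by rewrite maddC madd0. Qed.

Lemma mleqP L K : reflect (forall i, L i <= K i)%N (mleq L K).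
Proof. exact: forallP. Qed.

Lemma msubK L K : mleq L K -> madd (msub K L) L = K.
Proof. by move=> /mleqP h; apply/ffunP => i; rewrite !ffunE subnK. Qed.

Lemma maddK L : cancel (fun K => madd K L) (fun K => msub K L).
Proof. by move=> K; apply/ffunP => i; rewrite !ffunE addnK. Qed.

Lemma mleq_addl L K : mleq L (madd K L).
Proof. by apply/mleqP => i; rewrite ffunE leq_addl. Qed.

Lemma madd_neq L K : madd (msub K L) L != K -> ~~ mleq L K.
Proof. by apply: contra => /msubK ->. Qed.

Lemma mleq_munit j K : mleq (munit j 1) K = (K j != 0%N).
Proof.
apply/mleqP/idP => [/(_ j)|Kj i]; first by rewrite ffunE eqxx lt0n.
by rewrite ffunE; case: eqP => [->|//]; rewrite lt0n.
Qed.

Lemma mpowD (S : comPzSemiRingType) (z : 'rV[S]_d) K L : mpow z (madd K L) = mpow z K * mpow z L.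
Proof. by rewrite /mpow -big_split; apply: eq_bigr => i _; rewrite ffunE exprD. Qed.

Lemma mpow0 (S : comPzSemiRingType) (z : 'rV[S]_d) : mpow z mzero = 1.
Proof. by rewrite /mpow big1 // => i _; rewrite ffunE expr0. Qed.

Lemma mpow_at0 (S : comNzSemiRingType) K : K != mzero -> mpow (0 : 'rV[S]_d) K = 0.
Proof.
move=> K0; have [j Kj] : exists j, K j != 0%N.
  apply/existsP; apply: contraNT K0 => /existsPn h; apply/eqP/ffunP => i; rewrite ffunE.
  by apply/eqP; rewrite -[_ == _]negbK h.
rewrite /mpow (bigD1 j) //= mxE expr0n; move: Kj; case: (K j) => // n _.
by rewrite mul0r.
Qed.

Lemma mpow_split (S : comPzSemiRingType) (z : 'rV[S]_d) K j :
  mpow z K = z ord0 j ^+ K j * \prod_(i < d | i != j) z ord0 i ^+ K i.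
Proof. by rewrite /mpow (bigD1 j). Qed.

Lemma mfact_gt0 K : (0 < mfact K)%N.
Proof. by apply: prodn_gt0 => i; exact: fact_gt0. Qed.

Lemma mfact0 : mfact mzero = 1%N.
Proof. by rewrite /mfact big1 // => i _; rewrite ffunE. Qed.

Lemma mfactS K j : mfact (madd K (munit j 1)) = ((K j).+1 * mfact K)%N.
Proof.
rewrite /mfact (bigD1 j) //= [in RHS](bigD1 j) //= !ffunE eqxx addn1 factS -mulnA.
by congr (_ * (_ * _))%N; apply: eq_bigr => i /negPf ij; rewrite !ffunE ij addn0.
Qed.

Lemma mpow_munit (S : comPzSemiRingType) (z : 'rV[S]_d) j : mpow z (munit j 1) = z ord0 j.
Proof.
rewrite (@mpow_split _ z _ j) ffunE eqxx expr1 big1 ?mulr1 // => i /negPf ij.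
by rewrite ffunE ij expr0.
Qed.

Lemma mfact_munit j : mfact (munit j 1) = 1%N.
Proof.
rewrite /mfact big1 // => i _; rewrite ffunE; by case: eqP.
Qed.

End Multiindex.

(** * Taylor series on polydiscs *)

Section Update.
Variables (R : realType) (d : nat).
Implicit Types (z : 'rV[R[i]]_d) (i j : 'I_d) (x : R[i]) (K : multiindex d).

Definition upd z j x : 'rV[R[i]]_d := \row_i (if i == j then x else z ord0 i).

Lemma updE z j x i : upd z j x ord0 i = if i == j then x else z ord0 i.
Proof. by rewrite mxE. Qed.

Lemma upd_id z j : upd z j (z ord0 j) = z.
Proof. by apply/rowP => i; rewrite mxE; case: eqP => [->|]. Qed.

Lemma upd_upd z j x y : upd (upd z j x) j y = upd z j y.
Proof. by apply/rowP => i; rewrite !mxE; case: eqP. Qed.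

Lemma upd_addr z j x : upd z j (z ord0 j + x) = z + x *: delta_mx ord0 j.
Proof.
apply/rowP => i; rewrite !mxE /=; case: eqP => [->|_].
  by rewrite mulr1.
by rewrite mulr0 addr0.
Qed.

Definition mset K j n : multiindex d := [ffun i => if i == j then n else K i].

Definition msupp (s : seq 'I_d) K := [forall i, (i \in s) || (K i == 0%N)].

End Update.

Section UmeanSum.
Variables (R : realType) (I : choiceType).

(** Dominated exchange of the circle mean with an unordered sum: the mean is
    bounded by the supremum, and the error is uniformly small. *)
Lemma hassum_umean (a : R[i] -> I -> R[i]) (g : R[i] -> R[i]) (u : I -> R) B :
  (forall w K, cmod w = 1 -> cmod (a w K) <= u K) -> sumbound u B ->
  (forall w, cmod w = 1 -> hassum (a w) (g w)) ->
  hassum (fun K => umean (fun w => a w K)) (umean g).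
Proof.
move=> au uB ag e e0.
have u0 K : 0 <= u K by apply: le_trans (au 1 K (cmod1 _)); exact: cmod_ge0.
have [F0 hF0] := sumbound_tail u0 uB e0; exists F0 => F F0F.
have aub K : ubounded (fun w => a w K) (u K) by move=> w w1; exact: au.
have gB : ubounded g B.
  move=> w w1; apply: hassum_le (ag w w1); apply: sumbound_le uB => K.
  exact: au.
rewrite -(umean_sum _ aub) -[X in _ - X]mul1r -mulNr -(umeanZ _ gB).
have sB : ubounded (fun w => \sum_(K <- F) a w K) (\sum_(K <- F) u K).
  by move=> w w1; rewrite (le_trans (cmod_sum _ _ _)) // ler_sum // => K _; exact: au.
rewrite -(umeanD sB (uboundedZ (-1) gB)); apply: umean_le => w w1.
rewrite mulN1r; apply: hassum_tail (ag w w1) _ => G dG.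
apply: le_trans (hF0 G _); first by apply: ler_sum => K _; exact: au.
by apply: fdisjointWr dG.
Qed.

End UmeanSum.

Section PolydiscExpansion.
Variables (R : realType) (d : nat) (f : 'rV[R[i]]_d -> R[i]) (rho : 'I_d -> R) (B : R).
Implicit Types (z : 'rV[R[i]]_d) (i j : 'I_d) (K : multiindex d) (s : seq 'I_d).
Hypothesis rho_gt0 : forall i, 0 < rho i.

Let closed (z : 'rV[R[i]]_d) := forall i, cmod (z ord0 i) <= rho i.

Hypothesis f_diff : forall z j, closed z -> cdiff (fun x => f (upd z j x)) (z ord0 j).
Hypothesis f_bound : forall z, closed z -> cmod (f z) <= B.

(** Coefficient of the Taylor expansion in the coordinates of [s] only, as a
    function of the other coordinates. *)
Definition pcoef (s : seq 'I_d) (K : multiindex d) : 'rV[R[i]]_d -> R[i] :=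
  foldr (fun j g z => tcoef (rho j) (fun x => g (upd z j x)) (K j)) f s.

Let closed_upd z j x : closed z -> cmod x <= rho j -> closed (upd z j x).
Proof. by move=> zc xr i; rewrite updE; case: eqP => [->|_]. Qed.

Let closed_updw z j w : closed z -> cmod w = 1 -> closed (upd z j ((rho j)%:C * w)).
Proof. by move=> zc w1; apply: closed_upd => //; rewrite cmodM w1 mulr1 cmod_real gtr0_norm. Qed.

Let B_ge0 : 0 <= B.
Proof.
rewrite (le_trans (cmod_ge0 (f 0))) // f_bound // => i.
by rewrite mxE cmod0 ltW.
Qed.

Lemma pcoef_le s K z : closed z -> cmod (pcoef s K z) <= B * \prod_(i <- s) (rho i ^+ K i)^-1.
Proof.
elim: s z => [|j s IH] z zc; first by rewrite big_nil mulr1 f_bound.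
rewrite big_cons mulrCA /= cmodM cmodV cmodX cmod_real gtr0_norm //.
rewrite ler_wpM2l ?invr_ge0 ?exprn_ge0 ?(ltW (rho_gt0 j)) //.
apply: umean_le => w w1; rewrite cmodM cmodX cmodV w1 invr1 expr1n mul1r.
by apply: IH; exact: closed_updw.
Qed.

Lemma pcoef_indep s K z z' : (forall i, i \notin s -> z ord0 i = z' ord0 i) ->
  pcoef s K z = pcoef s K z'.
Proof.
elim: s z z' => [|j s IH] z z' h /=; first by congr f; apply/rowP => i; exact: h.
congr (_ * _); apply: eq_umean => w _; congr (_ * _); apply: IH => i si.
rewrite !updE; case: eqP => // /eqP ij; apply: h.
by rewrite inE negb_or ij.
Qed.

Lemma pcoef_cons j s K z :
  pcoef (j :: s) K z = tcoef (rho j) (fun x => pcoef s K (upd z j x)) (K j).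
Proof. by []. Qed.

Lemma pcoef_ext s K K' : (forall i, i \in s -> K i = K' i) -> pcoef s K = pcoef s K'.
Proof.
elim: s => [|j s IH] h; first by [].
apply/funext => z; rewrite !pcoef_cons (h j (mem_head _ _)) IH // => i si.
by rewrite h // inE si orbT.
Qed.

Let pterm s z K := if msupp s K then pcoef s K z * \prod_(i <- s) z ord0 i ^+ K i else 0.

Let pdom s z K : R := if msupp s K then B * \prod_(i <- s) (cmod (z ord0 i) / rho i) ^+ K i else 0.

Let pterm_dom s z K : closed z -> cmod (pterm s z K) <= pdom s z K.
Proof.
rewrite /pterm /pdom; case: ifP => [_ zc|]; last by rewrite cmod0.
rewrite cmodM cmod_prod.
under [X in _ <= _ * X]eq_bigr do rewrite expr_div_n.
rewrite big_split /= mulrCA mulrC; under eq_bigr do rewrite cmodX.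
rewrite ler_wpM2l ?pcoef_le //.
by apply: prodr_ge0 => i _; rewrite exprn_ge0 // cmod_ge0.
Qed.

Let mio (j : 'I_d) (K : multiindex d) : nat * multiindex d := (K j, mset K j 0).
Let mka (j : 'I_d) (p : nat * multiindex d) : multiindex d := mset p.2 j p.1.

Let mioK j : cancel (mio j) (mka j).
Proof. by move=> K; apply/ffunP => i; rewrite !ffunE /=; case: eqP => [->|]. Qed.

Let mio_neq j (p : nat * multiindex d) : mio j (mka j p) != p -> p.2 j != 0%N.
Proof.
apply: contraNneq; case: p => m K /= Kj; rewrite /mio /mka /= ffunE eqxx.
apply/eqP; congr (_, _); apply/ffunP => i; rewrite !ffunE; case: eqP => [->|] //.
Qed.

Let msupp_cons j s (K : multiindex d) : j \notin s ->
  msupp (j :: s) K = msupp s (mset K j 0).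
Proof.
move=> js; apply: eq_forallb => i; rewrite inE ffunE.
by have [->|ij] := eqVneq i j; rewrite ?(negPf js) ?eqxx ?orbT.
Qed.

(** Induction on the list of expanded variables: the series of the tail is
    averaged over the circle in the new variable [j], which gives the rows of a
    double series; the pair (exponent of [j], remaining exponents) then makes up
    one multiindex. *)
Let pcoef_expansion s : uniq s -> forall z, closed z -> (forall i, i \in s -> cmod (z ord0 i) < rho i) ->
  sumbound (pdom s z) (B * \prod_(i <- s) (1 - cmod (z ord0 i) / rho i)^-1) /\
  hassum (pterm s z) (f z).
Proof.
elim: s => [|j s IH] /=.
  move=> _ z zc _; have K0 : msupp [::] (mzero d).
    by apply/forallP => i; rewrite ffunE.
  have Kn K : K != mzero d -> msupp [::] K = false.
    apply: contraNF => /forallP h; apply/eqP/ffunP => i; rewrite ffunE.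
    exact/eqP/h.
  have e1 : pdom [::] z (mzero d) = B * \prod_(i <- [::]) (1 - cmod (z ord0 i) / rho i)^-1.
    by rewrite /pdom K0 !big_nil.
  have e2 : pterm [::] z (mzero d) = f z by rewrite /pterm K0 big_nil mulr1.
  split.
    rewrite -e1; apply: sumbound_single => [|K /Kn]; last by rewrite /pdom => ->.
    by rewrite e1 big_nil mulr1 (le_trans (cmod_ge0 (f z))) // f_bound.
  by rewrite -e2; apply: hassum_single => K /Kn; rewrite /pterm => ->.
move=> /andP[js us] z zc zs.
have zj : cmod (z ord0 j) < rho j by apply: zs; rewrite mem_head.
have zs' i : i \in s -> cmod (z ord0 i) < rho i by move=> si; apply: zs; rewrite inE si orbT.
pose q := cmod (z ord0 j) / rho j.
have q0 : 0 <= q by rewrite divr_ge0 ?cmod_ge0 // ltW.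
have q1 : q < 1 by rewrite ltr_pdivrMr // mul1r.
have updzi w i : i \in s -> upd z j w ord0 i = z ord0 i.
  by move=> si; rewrite updE; case: eqP => // ij; rewrite -ij si in js.
have IHw w : cmod w = 1 -> hassum (pterm s (upd z j ((rho j)%:C * w))) (f (upd z j ((rho j)%:C * w))).
  move=> w1; have [] // := IH us (upd z j ((rho j)%:C * w)).
    exact: closed_updw.
  by move=> i si; rewrite updzi ?zs'.
have [IHb _] := IH us z zc zs'.
have domw w K : cmod w = 1 -> cmod (pterm s (upd z j ((rho j)%:C * w)) K) <= pdom s z K.
  move=> w1; have -> : pdom s z K = pdom s (upd z j ((rho j)%:C * w)) K.
    rewrite /pdom; case: ifP => // _; congr (_ * _).
    by apply: eq_big_seq => i si; rewrite updzi.
  by apply: pterm_dom; exact: closed_updw.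
pose A (m : nat) K := z ord0 j ^+ m * (if msupp s K then
   tcoef (rho j) (fun x => pcoef s K (upd z j x)) m * \prod_(i <- s) z ord0 i ^+ K i else 0).
have A_dom m K : cmod (A m K) <= q ^+ m * pdom s z K.
  rewrite /A /pdom; case: ifP => [_|]; last by rewrite !mulr0 cmod0.
  rewrite !cmodM cmodX /q expr_div_n -!mulrA ler_wpM2l ?exprn_ge0 ?cmod_ge0 //.
  rewrite cmodV cmodX cmod_real gtr0_norm // ler_wpM2l ?invr_ge0 ?exprn_ge0 ?(ltW (rho_gt0 j)) //.
  rewrite cmod_prod; under [X in _ <= _ * X]eq_bigr do rewrite expr_div_n.
  rewrite big_split /= mulrCA mulrC; under eq_bigr do rewrite cmodX.
  rewrite ler_wpM2l //; first by apply: prodr_ge0 => i _; rewrite exprn_ge0 // cmod_ge0.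
  apply: umean_le => w w1; rewrite cmodM cmodX cmodV w1 invr1 expr1n mul1r.
  by apply: pcoef_le; exact: closed_updw.
have pdom_ge0 K : 0 <= pdom s z K.
  rewrite /pdom; case: ifP => // _; rewrite mulr_ge0 ?prodr_ge0 // => i _.
  by rewrite exprn_ge0 ?divr_ge0 ?cmod_ge0 // ltW.
have qB : sumbound (fun m => q ^+ m) (1 - q)^-1.
  move=> F; rewrite (le_trans (sum_fsetS _ (sub_upto (leqnn _)))) //; first by move=> m; rewrite exprn_ge0.
  by rewrite sum_upto geom_sum_le.
have sbP : sumbound (fun p : nat * multiindex d => q ^+ p.1 * pdom s z p.2)
    ((1 - q)^-1 * (B * \prod_(i <- s) (1 - cmod (z ord0 i) / rho i)^-1)).
  apply: (sumboundM (u := fun m => q ^+ m) (v := pdom s z)) => // m.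
  by rewrite exprn_ge0.
have sbA : sumbound (fun p : nat * multiindex d => cmod (A p.1 p.2))
    ((1 - q)^-1 * (B * \prod_(i <- s) (1 - cmod (z ord0 i) / rho i)^-1)).
  by apply: sumbound_le sbP => p; exact: A_dom.
have sA : summ (fun p : nat * multiindex d => A p.1 p.2) by eexists; exact: sbA.
have prodE (V : comNzRingType) (v : 'I_d -> V) K :
    \prod_(i <- s) v i ^+ mset K j 0 i = \prod_(i <- s) v i ^+ K i.
  apply: eq_big_seq => i si; rewrite ffunE; case: eqP => // ij.
  by rewrite -ij si in js.
have compA K : (fun p => A p.1 p.2) (mio j K) = pterm (j :: s) z K.
  rewrite /A /pterm msupp_cons //; case: ifP => _; last by rewrite mulr0.
  rewrite prodE big_cons [RHS]mulrCA.
  rewrite pcoef_cons (@pcoef_ext s K (mset K j 0)) // => i si.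
  by rewrite ffunE; case: eqP => // ij; rewrite -ij si in js.
have compD K : (fun p : nat * multiindex d => q ^+ p.1 * pdom s z p.2) (mio j K) = pdom (j :: s) z K.
  rewrite /pdom msupp_cons //; case: ifP => _; last by rewrite mulr0.
  by rewrite (prodE _ (fun i => cmod (z ord0 i) / rho i)) big_cons [RHS]mulrCA.
split.
  rewrite big_cons mulrCA; have := sumbound_comp (mioK j) sbP.
  by apply: sumbound_le => K; rewrite -compD.
have -> : pterm (j :: s) z = (fun p => A p.1 p.2) \o mio j by apply/funext => K; rewrite -compA.
have sAio := summ_comp (mioK j) sA.
suff -> : f z = usum ((fun p => A p.1 p.2) \o mio j) by exact: usumP.
rewrite -(usum_reindex (mioK j)) //; last first.
  move=> p /mio_neq pj; rewrite /A; case: ifP => [/forallP/(_ j)|]; last by rewrite mulr0.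
  by rewrite (negPf js) (negPf pj).
rewrite usum_fubini //; apply/esym/usumE.
have rowE m : usum (A m) = z ord0 j ^+ m * tcoef (rho j) (fun x => f (upd z j x)) m.
  apply: usumE; apply: hassumZ.
  have hm : hassum (fun K => umean (fun w => w^-1 ^+ m * pterm s (upd z j ((rho j)%:C * w)) K))
      (umean (fun w => w^-1 ^+ m * f (upd z j ((rho j)%:C * w)))).
    apply: (hassum_umean (u := pdom s z)) IHb _.
      by move=> w K w1; rewrite cmodM cmodX cmodV w1 invr1 expr1n mul1r; exact: domw.
    by move=> w w1; apply: hassumZ; exact: IHw.
  have := hassumZ ((rho j)%:C ^+ m)^-1 hm.
  congr hassum; apply/funext => K; rewrite /pterm; case: ifP => _; last first.
    rewrite (@eq_umean _ _ (fun=> 0)) ?umean0 ?mulr0 // => w _; by rewrite mulr0.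
  rewrite /tcoef -mulrA; congr (_ * _).
  pose Bp := B * \prod_(i <- s) (rho i ^+ K i)^-1.
  rewrite [RHS]mulrC -(@umeanZ _ _ _ Bp).
    apply: eq_umean => w w1; rewrite [RHS]mulrC -mulrA; congr (_ * (_ * _)).
    by apply: eq_big_seq => i si; rewrite updzi.
  move=> w w1; rewrite cmodM cmodX cmodV w1 invr1 expr1n mul1r.
  by apply: pcoef_le; exact: closed_updw.
have -> : (fun m => usum (A m)) = (fun m => z ord0 j ^+ m * tcoef (rho j) (fun x => f (upd z j x)) m).
  by apply/funext.
rewrite -{3}(upd_id z j).
apply: (@taylor _ (fun x => f (upd z j x)) (rho j) (rho_gt0 j) _ B) => //.
  move=> x xr; have := @f_diff (upd z j x) j (closed_upd zc xr).
  by rewrite updE eqxx (_ : (fun y => _) = (fun x => f (upd z j x))) //; apply/funext => y; rewrite upd_upd.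
by move=> x xr; apply: f_bound; apply: closed_upd => //; rewrite xr.
Qed.

(** Expanding successively in each coordinate gives a multiple power series
    together with Cauchy's bounds for its coefficients. *)
Lemma polydisc_expansion : exists c : multiindex d -> R[i],
  (forall K, cmod (c K) <= B * \prod_(i < d) (rho i ^+ K i)^-1) /\
  forall z : 'rV[R[i]]_d, (forall i, cmod (z ord0 i) < rho i) ->
    summ (fun K => c K * mpow z K) /\ hassum (fun K => c K * mpow z K) (f z).
Proof.
exists (fun K => pcoef (enum 'I_d) K 0); split.
  move=> K; rewrite -[X in _ * X]big_enum; apply: pcoef_le => i.
  by rewrite mxE cmod0 ltW.
move=> z zr; have zc : closed z by move=> i; exact: ltW.
have [h1 h2] := pcoef_expansion (enum_uniq 'I_d) zc (fun i (_ : i \in enum 'I_d) => zr i).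
have ptE : pterm (enum 'I_d) z = (fun K => pcoef (enum 'I_d) K 0 * mpow z K).
  apply/funext => K; rewrite /pterm ifT; last by apply/forallP => i; rewrite mem_enum.
  rewrite /mpow big_enum; congr (_ * _); apply: pcoef_indep => i.
  by rewrite mem_enum.
have sb := sumbound_le (fun K => pterm_dom (enum 'I_d) K zc) h1.
by rewrite ptE in h2 sb; split=> //; exists (B * \prod_(i <- enum 'I_d) (1 - cmod (z ord0 i) / rho i)^-1).
Qed.

End PolydiscExpansion.

(** * Elementary bounds *)

Section ElementaryBounds.
Variable R : realType.

(** Increments of powers are bounded by a power of the slightly larger number
    |x| + dl, without factors depending on n: so a power series at |x| + dl
    dominates first and second order increments at x. *)
Lemma exprD_bounds (x h : R[i]) (dl : R) n : 0 < dl -> cmod h <= dl ->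
  cmod ((x + h) ^+ n - x ^+ n) <= cmod h / dl * (cmod x + dl) ^+ n /\
  cmod ((x + h) ^+ n - x ^+ n - h * (n%:R * x ^+ n.-1)) <= (cmod h / dl) ^+ 2 * (cmod x + dl) ^+ n.
Proof.
move=> dl0 hd; set t := cmod h / dl; set Y := cmod x + dl.
have t0 : 0 <= t by rewrite divr_ge0 ?cmod_ge0 // ltW.
have td : t * dl = cmod h by rewrite /t divfK // gt_eqF.
have x0 := cmod_ge0 x; have Y0 : 0 <= Y by rewrite addr_ge0 // ltW.
elim: n => [|n [IH1 IH2]].
  by rewrite !expr0 subrr mul0r mulr0 subr0 cmod0 !mulr1 exprn_ge0.
have YY : Y * Y ^+ n = cmod x * Y ^+ n + dl * Y ^+ n by exact: mulrDl.
have xhY : cmod (x + h) <= Y by rewrite (le_trans (cmodD _ _)) // lerD2l.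
have xhn : cmod ((x + h) ^+ n) <= Y ^+ n by rewrite cmodX lerXn2r ?nnegrE ?cmod_ge0.
split.
  have -> : (x + h) ^+ n.+1 - x ^+ n.+1 = x * ((x + h) ^+ n - x ^+ n) + h * (x + h) ^+ n.
    by rewrite !exprS; ring.
  rewrite (le_trans (cmodD _ _)) // !cmodM -td [Y ^+ _.+1]exprS YY.
  have := ler_wpM2l x0 IH1; have := ler_wpM2l (mulr_ge0 t0 (ltW dl0)) xhn; lra.
have -> : (x + h) ^+ n.+1 - x ^+ n.+1 - h * (n.+1%:R * x ^+ n) =
    x * ((x + h) ^+ n - x ^+ n - h * (n%:R * x ^+ n.-1)) + h * ((x + h) ^+ n - x ^+ n).
  have -> : x * ((x + h) ^+ n - x ^+ n - h * (n%:R * x ^+ n.-1)) =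
     x * ((x + h) ^+ n - x ^+ n) - h * (n%:R * x ^+ n).
    by case: n {IH1 IH2 xhn YY} => [|n] /=; rewrite ?exprS; ring.
  by rewrite !exprS -natr1; ring.
rewrite (le_trans (cmodD _ _)) // !cmodM -td [Y ^+ _.+1]exprS YY.
have := ler_wpM2l x0 IH2; have := ler_wpM2l (mulr_ge0 t0 (ltW dl0)) IH1.
rewrite -/t => h1 h2; rewrite (le_trans (lerD h2 h1)) // le_eqVlt; apply/orP; left; apply/eqP.
by rewrite expr2; ring.
Qed.

Lemma expr_deriv_bound (x dl : R) n : 0 <= x -> 0 < dl ->
  n%:R * x ^+ n.-1 <= (x + dl) ^+ n / dl.
Proof.
move=> x0 dl0; rewrite ler_pdivlMr //; have dl0' := ltW dl0.
elim: n => [|n IH]; first by rewrite !mul0r exprn_ge0 // addr_ge0.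
have xn : x ^+ n <= (x + dl) ^+ n by rewrite lerXn2r ?nnegrE ?addr_ge0 // lerDl.
have -> : n.+1%:R * x ^+ n.+1.-1 * dl = x * (n%:R * x ^+ n.-1 * dl) + dl * x ^+ n.
  by case: n {IH xn} => [|n] /=; rewrite ?exprS -?natr1; ring.
rewrite exprS mulrDl lerD //; exact: ler_wpM2l.
Qed.

(** The elementary half of Stirling's formula, n! e^n <= e n n^n, by induction
    from (1 - 1 / (n+1))^(n+1) <= 1 / e. *)
Lemma fact_exp_le n : n.+1`!%:R * expR (n.+1%:R) <= expR 1 * n.+1%:R * n.+1%:R ^+ n.+1 :> R.
Proof.
elim: n => [|n IH]; first by rewrite (_ : 1`! = 1%N) // expr1 mul1r !mulr1.
have n2 : (0 : R) < n.+2%:R by rewrite ltr0n.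
have n1 : (0 : R) < n.+1%:R by rewrite ltr0n.
have -> : n.+2`!%:R * expR n.+2%:R = n.+2%:R * expR 1 * (n.+1`!%:R * expR n.+1%:R) :> R.
  by rewrite factS natrM -[in LHS](natr1 n.+1) [in LHS]addrC expRD; ring.
have h : expR 1 * n.+1%:R ^+ n.+2 <= n.+2%:R ^+ n.+2 :> R.
  have : (n.+1%:R / n.+2%:R) ^+ n.+2 <= (expR (- (n.+2%:R)^-1)) ^+ n.+2 :> R.
    rewrite lerXn2r ?nnegrE ?divr_ge0 ?expR_ge0 //.
    have -> : n.+1%:R / n.+2%:R = 1 - (n.+2%:R)^-1 :> R.
      by rewrite -[X in X / _](addrK 1) natr1 mulrBl divff ?gt_eqF // mul1r.
    exact: expR_ge1Dx.
  rewrite -expRM_natl mulrN divff ?gt_eqF // expRN expr_div_n.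
  rewrite ler_pdivrMr ?exprn_gt0 // mulrC -[X in _ <= X]/(_ * _) => hh.
  by rewrite mulrC -ler_pdivlMr ?expR_gt0.
rewrite (le_trans (ler_wpM2l _ IH)) ?mulr_ge0 ?expR_ge0 //.
have -> : n.+2%:R * expR 1 * (expR 1 * n.+1%:R * n.+1%:R ^+ n.+1) =
  expR 1 * n.+2%:R * (expR 1 * n.+1%:R ^+ n.+2) :> R by rewrite [in RHS]exprS; ring.
by rewrite ler_wpM2l ?mulr_ge0 ?expR_ge0.
Qed.

(** Optimizing the Cauchy bound for a function of exponential type r: the
    radius n / r gives n! e^n r^n / n^n, which is n r^n up to a constant. *)
Lemma cauchy_optimal (r q : R) : 0 < r -> r < q -> exists2 c, 0 <= c &
  forall n, exists2 rho, 0 < rho & n`!%:R * expR (r * rho) / rho ^+ n <= c * q ^+ n.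
Proof.
move=> r0 rq; pose dl := q / r - 1.
have dl0 : 0 < dl by rewrite subr_gt0 ltr_pdivlMr // mul1r.
have q0 := lt_trans r0 rq.
exists (expR r + expR 1 / dl); first by rewrite addr_ge0 ?divr_ge0 ?expR_ge0 // ltW.
case=> [|n].
  exists 1 => //; rewrite fact0 !expr0 divr1 !mulr1 mul1r lerDl.
  by rewrite divr_ge0 ?expR_ge0 // ltW.
have n1 : (0 : R) < n.+1%:R by rewrite ltr0n.
exists (n.+1%:R / r); first by rewrite divr_gt0.
rewrite mulrCA divff ?gt_eqF // mulr1 expr_div_n invf_div mulrA.
rewrite ler_pdivrMr ?exprn_gt0 //.
have h1 := fact_exp_le n.
have h2 : n.+1%:R * r ^+ n.+1 <= dl^-1 * q ^+ n.+1.
  have -> : q = r * (1 + dl) by rewrite /dl addrC subrK mulrC divfK // gt_eqF.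
  rewrite exprMn mulrC mulrCA ler_wpM2l ?exprn_ge0 ?(ltW r0) // mulrC.
  by have := @expr_deriv_bound 1 dl n.+1 ler01 dl0; rewrite expr1n mulr1.
have nn : (0 : R) <= n.+1%:R ^+ n.+1 by rewrite exprn_ge0.
have rr : 0 <= r ^+ n.+1 by rewrite exprn_ge0 // ltW.
rewrite (le_trans (ler_wpM2r rr h1)) //.
have -> : expR 1 * n.+1%:R * n.+1%:R ^+ n.+1 * r ^+ n.+1 =
  expR 1 * n.+1%:R ^+ n.+1 * (n.+1%:R * r ^+ n.+1) by ring.
rewrite (le_trans (ler_wpM2l (mulr_ge0 (expR_ge0 _) nn) h2)) //.
have -> : expR 1 * n.+1%:R ^+ n.+1 * (dl^-1 * q ^+ n.+1) =
   expR 1 / dl * q ^+ n.+1 * n.+1%:R ^+ n.+1 by ring.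
rewrite ler_wpM2r // ler_wpM2r ?exprn_ge0 ?(ltW q0) //.
by rewrite lerDr expR_ge0.
Qed.

Lemma lte_between (x : R) (e : \bar R) : (x%:E < e)%E -> exists2 y, x < y & (y%:E < e)%E.
Proof.
case: e => [e| |]; rewrite ?lte_fin.
- move=> xe; exists ((x + e) / 2); rewrite ?lte_fin; lra.
- by move=> _; exists (x + 1); rewrite ?ltry // ltrDl.
- by rewrite ltNge leNye.
Qed.

End ElementaryBounds.

(** * Power series in several variables *)

Section PowerSeries.
Variables (R : realType) (d : nat).
Implicit Types (Rad : 'I_d -> \bar R) (phi : multiindex d -> R[i]) (g : 'rV[R[i]]_d -> R[i]).
Implicit Types (z : 'rV[R[i]]_d) (i j : 'I_d) (K L : multiindex d).

Definition pterm phi z K : R[i] := phi K * mpow z K / (mfact K)%:R.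

Definition pser phi z : R[i] := usum (pterm phi z).

(** [phi] lists the derivatives at the origin, that is, the power series is
    exponential, as in the expansion in Appell polynomials. *)
Definition has_pser Rad phi g :=
  forall z, polydisc Rad z -> summ (pterm phi z) /\ pser phi z = g z.

Lemma cmod_mpow z K : cmod (mpow z K) = mpow (absv z) K.
Proof.
by rewrite /mpow cmod_prod; apply: eq_bigr => i _; rewrite cmodX mxE.
Qed.

Lemma cmod_pterm phi z K : cmod (pterm phi z K) = cmod (phi K) * mpow (absv z) K / (mfact K)%:R.
Proof. by rewrite !cmodM cmod_mpow cmodV cmod_nat. Qed.

Lemma absv_ge0 z i : 0 <= absv z ord0 i.
Proof. by rewrite mxE cmod_ge0. Qed.

Lemma mpow_le (x y : 'rV[R]_d) K : (forall i, 0 <= x ord0 i <= y ord0 i) -> mpow x K <= mpow y K.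
Proof.
move=> xy; apply: ler_prod => i _; have /andP[x0 xyi] := xy i.
by rewrite exprn_ge0 // lerXn2r // nnegrE // (le_trans x0).
Qed.

Lemma mfactR_gt0 K : (0 : R) < (mfact K)%:R.
Proof. by rewrite ltr0n mfact_gt0. Qed.

Lemma mfactC_neq0 K : ((mfact K)%:R : R[i]) != 0.
Proof. by rewrite pnatr_eq0 -lt0n mfact_gt0. Qed.

Definition cvect (x : 'rV[R]_d) : 'rV[R[i]]_d := \row_i (x ord0 i)%:C.

Lemma absv_cvect (x : 'rV[R]_d) : (forall i, 0 <= x ord0 i) -> absv (cvect x) = x.
Proof. by move=> x0; apply/rowP => i; rewrite !mxE cmod_real ger0_norm. Qed.

Lemma polydisc_cvect (x : 'rV[R]_d) Rad : (forall i, 0 <= x ord0 i) ->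
  (forall i, ((x ord0 i)%:E < Rad i)%E) -> polydisc Rad (cvect x).
Proof. by move=> x0 xR i /=; rewrite mxE cmod_real ger0_norm. Qed.

Lemma radius_between (x : 'I_d -> R) Rad : (forall i, ((x i)%:E < Rad i)%E) ->
  exists rho : 'I_d -> R, forall i, x i < rho i /\ ((rho i)%:E < Rad i)%E.
Proof.
move=> h; have hy i : exists y, x i < y /\ (y%:E < Rad i)%E.
  by have [y h1 h2] := lte_between (h i); exists y.
by have [rho hrho] := choice hy; exists rho.
Qed.

Lemma common_lower_bound (x : 'I_d -> R) : (forall i, 0 < x i) ->
  exists2 dl, 0 < dl & forall i, dl <= x i.
Proof.
move=> x0; pose S := 1 + \sum_i (x i)^-1.
have S0 : 0 < S by rewrite ltr_pwDl // sumr_ge0 // => i _; rewrite invr_ge0 ltW.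
exists S^-1; first by rewrite invr_gt0.
move=> i; rewrite -[leRHS]invrK lef_pV2 ?posrE ?invr_gt0 //.
rewrite /S (bigD1 i) //= addrCA lerDl addr_ge0 // sumr_ge0 // => k _.
by rewrite invr_ge0 ltW.
Qed.

Lemma polydisc_margin Rad z : polydisc Rad z -> exists2 dl, 0 < dl &
  forall i, ((cmod (z ord0 i) + dl)%:E < Rad i)%E.
Proof.
move=> /(radius_between (x := fun i => cmod (z ord0 i)))[rho hr].
have [|dl dl0 hd] := @common_lower_bound (fun i => rho i - cmod (z ord0 i)).
  by move=> i; rewrite subr_gt0; case: (hr i).
exists dl => // i; apply: le_lt_trans (proj2 (hr i)).
by rewrite lee_fin; have := hd i; lra.
Qed.

Lemma has_pser_ext Rad phi g h : (forall z, polydisc Rad z -> g z = h z) ->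
  has_pser Rad phi g -> has_pser Rad phi h.
Proof. by move=> gh hg z zR; rewrite -gh //; exact: hg. Qed.

Lemma has_pser_sub Rad Rad' phi g : (forall i, (Rad' i <= Rad i)%E) ->
  has_pser Rad phi g -> has_pser Rad' phi g.
Proof. by move=> RR hg z zR; apply: hg => i; exact: lt_le_trans (zR i) (RR i). Qed.

(** Termwise differentiation: by the second-order bound on increments of
    monomials, the remainder is at most (|h| / dl)^2 times the sum of the series
    of absolute values at a point with slightly larger coordinates. *)
Lemma pser_partial Rad phi g j z : has_pser Rad phi g -> polydisc Rad z ->
  summ (pterm (fun K => phi (madd K (munit j 1))) z) /\
  (derivable g z (delta_mx ord0 j) /\
   'D_(delta_mx ord0 j) g z = pser (fun K => phi (madd K (munit j 1))) z).
Proof.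
move=> hg zR; have [dl dl0 hdl] := polydisc_margin zR.
pose y : 'rV[R]_d := \row_i (cmod (z ord0 i) + if i == j then dl else 0).
have y0 i : 0 <= y ord0 i.
  by rewrite mxE addr_ge0 ?cmod_ge0 //; case: eqP => // _; exact: ltW.
have yR : polydisc Rad (cvect y).
  apply: polydisc_cvect => // i; rewrite mxE; case: eqP => [->|_] //.
  by rewrite addr0; exact: zR.
have [[B yB] _] := hg _ yR.
pose rest K := \prod_(i < d | i != j) z ord0 i ^+ K i.
pose D K := phi K * ((K j)%:R * z ord0 j ^+ (K j).-1 * rest K) / (mfact K)%:R.
have ytE K : cmod (pterm phi (cvect y) K) =
    cmod (phi K) * ((cmod (z ord0 j) + dl) ^+ K j * cmod (rest K)) / (mfact K)%:R.
  rewrite cmod_pterm absv_cvect // (@mpow_split _ _ y K j) mxE eqxx /rest cmod_prod.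
  congr (_ * (_ * _) / _); apply: eq_bigr => i /negPf ij.
  by rewrite mxE ij addr0 cmodX.
have DB K : cmod (D K) <= dl^-1 * cmod (pterm phi (cvect y) K).
  rewrite ytE /D !cmodM cmodV !cmod_nat cmodX [leRHS]mulrA ler_wpM2r ?invr_ge0 ?ler0n //.
  rewrite [leRHS]mulrCA ler_wpM2l ?cmod_ge0 // [leRHS]mulrA ler_wpM2r ?cmod_ge0 //.
  by rewrite [leRHS]mulrC; apply: expr_deriv_bound; rewrite ?cmod_ge0.
have sD : summ D by apply: summ_le DB (sumboundZ _ yB); rewrite invr_ge0 ltW.
have Dio : D \o (fun K => madd K (munit j 1)) = pterm (fun K => phi (madd K (munit j 1))) z.
  apply/funext => K; rewrite /D /pterm /= mfactS (@mpow_split _ _ z K j) !ffunE eqxx addn1 /=.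
  have -> : rest (madd K (munit j 1)) = rest K.
    by apply: eq_bigr => i /negPf ij; rewrite !ffunE ij addn0.
  rewrite -/(rest K) natrM; field.
  by rewrite mfactC_neq0 /= addrC natr1 pnatr_eq0.
have D0 K : madd (msub K (munit j 1)) (munit j 1) != K -> D K = 0.
  move=> /madd_neq; rewrite mleq_munit negbK => /eqP Kj.
  by rewrite /D Kj !mul0r mulr0 mul0r.
have sDio := summ_comp (@maddK d (munit j 1)) sD.
split; first by rewrite -Dio.
have -> : pser (fun K => phi (madd K (munit j 1))) z = usum D.
  by rewrite (usum_reindex (@maddK d (munit j 1))) // Dio.
have main (h : R[i]) : cmod h <= dl ->
    cmod (g (z + h *: delta_mx ord0 j) - g z - h * usum D) <= (cmod h / dl) ^+ 2 * B.
  move=> hd.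
  have zhE i : (z + h *: delta_mx ord0 j) ord0 i = if i == j then z ord0 j + h else z ord0 i.
    by rewrite !mxE /=; case: eqP => [->|_]; rewrite ?mulr1 ?mulr0 ?addr0.
  have zhR : polydisc Rad (z + h *: delta_mx ord0 j).
    move=> i; rewrite /= zhE; case: eqP => [->|_]; last exact: zR.
    apply: le_lt_trans (hdl j); rewrite lee_fin (le_trans (cmodD _ _)) //.
    by rewrite lerD2l.
  have [s1 <-] := hg _ zhR; have [s2 <-] := hg _ zR.
  have hs := hassumB (hassumB (usumP s1) (usumP s2)) (hassumZ h (usumP sD)).
  apply: hassum_le hs; have t0 : 0 <= (cmod h / dl) ^+ 2 by rewrite exprn_ge0 // divr_ge0 ?cmod_ge0 // ltW.
  apply: sumbound_le (sumboundZ t0 yB) => K.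
  rewrite ytE /pterm (@mpow_split _ _ _ K j) (@mpow_split _ _ z K j) zhE eqxx.
  have -> : \prod_(i < d | i != j) (z + h *: delta_mx ord0 j) ord0 i ^+ K i = rest K.
    by apply: eq_bigr => i /negPf ij; rewrite zhE ij.
  rewrite -/(rest K) /D.
  have -> : phi K * ((z ord0 j + h) ^+ K j * rest K) / (mfact K)%:R -
      phi K * (z ord0 j ^+ K j * rest K) / (mfact K)%:R -
      h * (phi K * ((K j)%:R * z ord0 j ^+ (K j).-1 * rest K) / (mfact K)%:R) =
    phi K * (((z ord0 j + h) ^+ K j - z ord0 j ^+ K j - h * ((K j)%:R * z ord0 j ^+ (K j).-1)) * rest K)
      / (mfact K)%:R by ring.
  rewrite !cmodM cmodV cmod_nat [leRHS]mulrA ler_wpM2r ?invr_ge0 ?ler0n //.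
  rewrite [leRHS]mulrCA ler_wpM2l ?cmod_ge0 // [leRHS]mulrA ler_wpM2r ?cmod_ge0 //.
  by have [] := exprD_bounds (z ord0 j) (K j) dl0 hd.
apply/derivableP_eps => e e0.
have B0 := sumbound_ge0 yB; have B1 : 0 < B + 1 by rewrite ltr_wpDl.
have ed : 0 < e * dl ^+ 2 / (B + 1) by rewrite divr_gt0 ?mulr_gt0 // exprn_gt0.
exists (Num.min dl (e * dl ^+ 2 / (B + 1))); first by rewrite lt_min dl0.
move=> h; rewrite lt_min => /andP[h1 h2].
rewrite (le_trans (main h (ltW h1))) //.
have h3 : cmod h * (B + 1) <= e * dl ^+ 2 by rewrite -ler_pdivlMr // ltW.
have -> : (cmod h / dl) ^+ 2 * B = (cmod h * B / dl ^+ 2) * cmod h.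
  by field; rewrite gt_eqF.
rewrite ler_wpM2r ?cmod_ge0 // ler_pdivrMr ?exprn_gt0 //.
rewrite (le_trans _ h3) // ler_wpM2l ?cmod_ge0 //.
by rewrite lerDl.
Qed.

Lemma has_pser_partial Rad phi g j : has_pser Rad phi g ->
  has_pser Rad (fun K => phi (madd K (munit j 1))) (partial j g).
Proof. by move=> hg z zR; have [h1 [_ h2]] := pser_partial j hg zR. Qed.

Lemma munitS j n : madd (munit j n) (munit j 1) = munit j n.+1.
Proof. by apply/ffunP => i; rewrite !ffunE; case: eqP => // _; rewrite addn1. Qed.

Lemma has_pser_mpartial Rad phi g K : has_pser Rad phi g ->
  has_pser Rad (fun L => phi (madd L K)) (mpartial K g).
Proof.
move=> hg.
have iterE h psi j n : has_pser Rad psi h ->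
    has_pser Rad (fun L => psi (madd L (munit j n))) (iter n (partial j) h).
  move=> hh; elim: n => [|n IH] /=.
    rewrite (_ : (fun L => _) = psi) //; apply/funext => L; congr psi.
    by apply/ffunP => i; rewrite !ffunE; case: eqP; rewrite addn0.
  have := has_pser_partial j IH; rewrite (_ : (fun L => _) = fun L => psi (madd L (munit j n.+1))) //.
  by apply/funext => L; rewrite -maddA [madd (munit j 1) _]maddC munitS.
have foldE s : uniq s ->
    has_pser Rad (fun L => phi (madd L [ffun i => if i \in s then K i else 0%N]))
      (foldr (fun j => iter (K j) (partial j)) g s).
  elim: s => [|j s IH] /=.
    move=> _; rewrite (_ : (fun L => _) = phi) //; apply/funext => L; congr phi.
    by apply/ffunP => i; rewrite !ffunE addn0.
  move=> /andP[js us]; have := iterE _ _ j (K j) (IH us).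
  rewrite (_ : (fun L => _) = fun L => phi (madd L [ffun i => if i \in j :: s then K i else 0%N])) //.
  apply/funext => L; rewrite -maddA; congr (phi (madd L _)).
  apply/ffunP => i; rewrite !ffunE inE; have [->|//] := eqVneq i j.
  by rewrite (negPf js) addn0.
have := foldE _ (enum_uniq 'I_d).
rewrite (_ : (fun L => _) = fun L => phi (madd L K)) //.
apply/funext => L; congr (phi (madd L _)); apply/ffunP => i.
by rewrite ffunE mem_enum.
Qed.

Lemma pser0 phi : pser phi 0 = phi (mzero d).
Proof.
have -> : phi (mzero d) = pterm phi 0 (mzero d) by rewrite /pterm mpow0 mfact0 mulr1 divr1.
by apply: usumE; apply: hassum_single => K K0; rewrite /pterm mpow_at0 // mulr0 mul0r.
Qed.

Lemma polydisc0 Rad : (forall i, 0 < Rad i)%E -> polydisc Rad (0 : 'rV[R[i]]_d).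
Proof. by move=> R0 i /=; rewrite mxE cmod0. Qed.

(** All terms but the first vanish at the origin, so the derivatives there read
    off the coefficients. *)
Lemma pser_coef Rad phi g K : (forall i, 0 < Rad i)%E -> has_pser Rad phi g ->
  phi K = mpartial K g 0.
Proof.
move=> R0 hg; have [_ <-] := has_pser_mpartial K hg (polydisc0 R0).
by rewrite pser0; congr phi; apply/ffunP => i; rewrite !ffunE.
Qed.

Lemma pser_unique Rad phi psi g h : (forall i, 0 < Rad i)%E ->
  has_pser Rad phi g -> has_pser Rad psi h -> (forall z, polydisc Rad z -> g z = h z) ->
  phi = psi.
Proof.
move=> R0 hg hh gh; apply/funext => K.
by rewrite (pser_coef K R0 hg) (pser_coef K R0 (has_pser_ext (fun z zR => esym (gh z zR)) hh)).
Qed.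

(** A function with partial derivatives on a polydisc, bounded on smaller ones,
    is the sum of its Taylor series there; the coefficients on the various
    smaller polydiscs agree, being derivatives at the origin. *)
Lemma has_pser_holomorphic Rad f : (forall i, 0 < Rad i)%E ->
  (forall z j, polydisc Rad z -> derivable f z (delta_mx ord0 j)) ->
  (forall rho : 'I_d -> R, (forall i, 0 < rho i /\ ((rho i)%:E < Rad i)%E) ->
     exists B, forall z, (forall i, cmod (z ord0 i) <= rho i) -> cmod (f z) <= B) ->
  has_pser Rad (fun K => mpartial K f 0) f /\
  (forall (rho : 'I_d -> R) B, (forall i, 0 < rho i /\ ((rho i)%:E < Rad i)%E) ->
     (forall z, (forall i, cmod (z ord0 i) <= rho i) -> cmod (f z) <= B) ->
     forall K, cmod (mpartial K f 0) <= (mfact K)%:R * (B * \prod_(i < d) (rho i ^+ K i)^-1)).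
Proof.
move=> R0 df bf.
have fdiff z j : polydisc Rad z -> cdiff (fun x => f (upd z j x)) (z ord0 j).
  move=> zR; have [_ /(_ (conj (df z j zR) erefl)) h] := derivableP_eps f z (delta_mx ord0 j) ('D_(delta_mx ord0 j) f z).
  apply: (@cdiff_epsP _ _ _ ('D_(delta_mx ord0 j) f z)) => e /h[dl dl0 hd].
  by exists dl => // t /hd; rewrite upd_addr upd_id.
have key (rho : 'I_d -> R) B : (forall i, 0 < rho i /\ ((rho i)%:E < Rad i)%E) ->
    (forall z, (forall i, cmod (z ord0 i) <= rho i) -> cmod (f z) <= B) ->
    has_pser (fun i => (rho i)%:E) (fun K => mpartial K f 0) f /\
    forall K, cmod (mpartial K f 0) <= (mfact K)%:R * (B * \prod_(i < d) (rho i ^+ K i)^-1).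
  move=> hr hB; have r0 i : 0 < rho i by case: (hr i).
  have closedR z : (forall i, cmod (z ord0 i) <= rho i) -> polydisc Rad z.
    by move=> zc i; apply: le_lt_trans (proj2 (hr i)); rewrite lee_fin.
  have [c [cB hc]] := polydisc_expansion r0 (fun z j zc => fdiff z j (closedR z zc)) hB.
  have hs : has_pser (fun i => (rho i)%:E) (fun K => (mfact K)%:R * c K) f.
    move=> z zR; have [h1 h2] := hc z zR.
    have tE : pterm (fun K => (mfact K)%:R * c K) z = (fun K => c K * mpow z K).
      by apply/funext => K; rewrite /pterm; field; exact: mfactC_neq0.
    by rewrite /pser tE; split=> //; exact: usumE.
  have cE K : mpartial K f 0 = (mfact K)%:R * c K.
    by rewrite -(pser_coef K _ hs) // => i; rewrite lte_fin.
  split; first by rewrite (_ : (fun K => _) = (fun K => (mfact K)%:R * c K)) //; apply/funext.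
  by move=> K; rewrite cE cmodM cmod_nat ler_wpM2l ?ler0n.
split; last by move=> rho B h1 h2; have [] := key rho B h1 h2.
move=> z zR; have [dl dl0 hd] := polydisc_margin zR.
have hr i : 0 < cmod (z ord0 i) + dl /\ ((cmod (z ord0 i) + dl)%:E < Rad i)%E.
  by split=> //; rewrite ltr_wpDl ?cmod_ge0.
have [B hB] := bf _ hr.
have [hs _] := key _ _ hr hB; apply: hs => i /=.
by rewrite lte_fin ltrDl.
Qed.

(** Telescoping a difference of products, with a relative error [t] for each
    factor. *)
Lemma cmod_prod_dist (s : seq 'I_d) (a b : 'I_d -> R[i]) (Y : 'I_d -> R) (t : R) :
  0 <= t -> (forall i, cmod (a i) <= Y i) -> (forall i, cmod (b i) <= Y i) ->
  (forall i, cmod (a i - b i) <= t * Y i) ->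
  cmod (\prod_(i <- s) a i - \prod_(i <- s) b i) <= (size s)%:R * t * \prod_(i <- s) Y i.
Proof.
move=> t0 aY bY abY; have Y0 i : 0 <= Y i := le_trans (cmod_ge0 _) (aY i).
elim: s => [|j s IH]; first by rewrite !big_nil subrr cmod0 !mul0r.
rewrite !big_cons; set A := \prod_(i <- s) a i; set B := \prod_(i <- s) b i.
have -> : a j * A - b j * B = a j * (A - B) + (a j - b j) * B by ring.
have BY : cmod B <= \prod_(i <- s) Y i.
  by rewrite cmod_prod; apply: ler_prod => i _; rewrite cmod_ge0 bY.
rewrite (le_trans (cmodD _ _)) // !cmodM.
have h1 := ler_pM (cmod_ge0 _) (cmod_ge0 _) (aY j) IH.
have h2 := ler_pM (cmod_ge0 _) (cmod_ge0 _) (abY j) BY.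
rewrite (le_trans (lerD h1 h2)) // le_eqVlt; apply/orP; left; apply/eqP.
by rewrite /= -natr1; ring.
Qed.

Lemma pser_continuous Rad phi g z : has_pser Rad phi g -> polydisc Rad z ->
  forall e : R, 0 < e -> exists2 dl : R, 0 < dl &
    forall z', (forall i, cmod (z' ord0 i - z ord0 i) <= dl) ->
      polydisc Rad z' /\ cmod (g z' - g z) <= e.
Proof.
move=> hg zR e e0; have [dl dl0 hdl] := polydisc_margin zR.
pose y : 'rV[R]_d := \row_i (cmod (z ord0 i) + dl).
have y0 i : 0 <= y ord0 i by rewrite mxE addr_ge0 ?cmod_ge0 // ltW.
have yR : polydisc Rad (cvect y) by apply: polydisc_cvect => // i; rewrite mxE.
have [[B yB] _] := hg _ yR; have B0 := sumbound_ge0 yB.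
have dB : 0 < d%:R * B + 1 by rewrite ltr_wpDl // mulr_ge0.
pose t := Num.min 1 (e / (d%:R * B + 1)).
have t0 : 0 < t by rewrite lt_min ltr01 divr_gt0.
have t1 : t <= 1 by rewrite ge_min lexx.
have te : t * (d%:R * B + 1) <= e by rewrite -ler_pdivlMr // ge_min lexx orbT.
exists (t * dl); first by rewrite mulr_gt0.
move=> z' zz'.
have hdl' i : cmod (z' ord0 i - z ord0 i) <= dl.
  by rewrite (le_trans (zz' i)) // ger_pMl.
have z'y i : cmod (z' ord0 i) <= y ord0 i.
  rewrite mxE; have -> : z' ord0 i = z ord0 i + (z' ord0 i - z ord0 i) by ring.
  by rewrite (le_trans (cmodD _ _)) // lerD2l.
have z'R : polydisc Rad z'.
  by move=> i; apply: le_lt_trans (hdl i); have := z'y i; rewrite mxE lee_fin.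
split=> //.
have [s1 <-] := hg _ z'R; have [s2 <-] := hg _ zR.
have hs := hassumB (usumP s1) (usumP s2).
have dt0 : 0 <= d%:R * t by rewrite mulr_ge0 // ltW.
apply: (@le_trans _ _ (d%:R * t * B)); last by move: te; rewrite mulrDr mulr1 mulrCA mulrA; lra.
apply: hassum_le hs; apply: sumbound_le (sumboundZ dt0 yB) => K.
rewrite cmod_pterm absv_cvect //.
have -> : pterm phi z' K - pterm phi z K = phi K * (mpow z' K - mpow z K) / (mfact K)%:R.
  by rewrite /pterm; ring.
rewrite !cmodM cmodV cmod_nat [leRHS]mulrA ler_wpM2r ?invr_ge0 ?ler0n //.
rewrite [leRHS]mulrCA ler_wpM2l ?cmod_ge0 //.
have := @cmod_prod_dist (index_enum 'I_d) (fun i => z' ord0 i ^+ K i) (fun i => z ord0 i ^+ K i)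
  (fun i => y ord0 i ^+ K i) t (ltW t0).
have -> : size (index_enum 'I_d) = d by rewrite -[RHS]card_ord cardT enumT.
apply=> i.
- by rewrite cmodX lerXn2r ?nnegrE ?cmod_ge0.
- rewrite cmodX lerXn2r ?nnegrE ?cmod_ge0 // mxE lerDl; exact: ltW.
have [h1 _] := exprD_bounds (z ord0 i) (K i) dl0 (hdl' i).
have zE : z ord0 i + (z' ord0 i - z ord0 i) = z' ord0 i by ring.
rewrite zE in h1; rewrite mxE (le_trans h1) //.
by rewrite ler_wpM2r ?exprn_ge0 ?addr_ge0 ?cmod_ge0 ?(ltW dl0) // ler_pdivrMr.
Qed.

(** Entire functions of exponential type: the coefficients grow at most
    geometrically, at any rate exceeding the type. *)
Lemma exponential_type_pser f (C : R) (r : 'rV[R]_d) Rad : entire f -> radius_lt r Rad ->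
  (forall z, cmod (f z) <= C * expR (dot r (absv z))) ->
  exists phi, has_pser (fun=> +oo%E) phi f /\ exists (c : R) (q : 'rV[R]_d),
    radius_lt q Rad /\ forall K, cmod (phi K) <= c * mpow q K.
Proof.
move=> fe rR fC; have r0 i : 0 <= r ord0 i by case: (rR i).
have C0 : 0 <= C.
  by have := le_trans (cmod_ge0 _) (fC 0); rewrite pmulr_lge0 // expR_gt0.
have [s hs] := radius_between (x := fun i => r ord0 i) (fun i => proj2 (rR i)).
have [q hq] := radius_between (x := s) (fun i => proj2 (hs i)).
have s0 i : 0 < s i by apply: le_lt_trans (r0 i) _; case: (hs i).
have fB (rho : 'I_d -> R) z : (forall i, cmod (z ord0 i) <= rho i) ->
    cmod (f z) <= C * \prod_i expR (s i * rho i).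
  move=> zr; rewrite (le_trans (fC z)) // ler_wpM2l // -expR_sum ler_expR ler_sum // => i _.
  by rewrite mxE ler_pM ?cmod_ge0 //; case: (hs i) => /ltW.
have [|||hp hb] := @has_pser_holomorphic (fun=> +oo%E) f.
- by move=> i; exact: ltry.
- by move=> z j _; apply: diff_derivable; exact: fe.
- by move=> rho _; exists (C * \prod_i expR (s i * rho i)) => z; exact: fB.
exists (fun K => mpartial K f 0); split=> //.
have opt i : exists c, 0 <= c /\ forall n, exists2 rho, 0 < rho &
    n`!%:R * expR (s i * rho) / rho ^+ n <= c * q i ^+ n.
  by have [c c0 hc] := cauchy_optimal (s0 i) (proj1 (hq i)); exists c.
have [c hc] := choice opt.
exists (C * \prod_i c i), (\row_i q i); split.
  move=> i; rewrite mxE; split; last by case: (hq i).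
  by apply: ltW; apply: lt_trans (s0 i) _; case: (hq i).
move=> K; have optK i : exists rho, 0 < rho /\ (K i)`!%:R * expR (s i * rho) / rho ^+ K i <= c i * q i ^+ K i.
  by have [rho] := proj2 (hc i) (K i); exists rho.
have [rho hrho] := choice optK.
have hrho' i : 0 < rho i /\ ((rho i)%:E < +oo)%E by split; [case: (hrho i)|exact: ltry].
rewrite (le_trans (hb rho _ hrho' (fB rho) K)) //.
have -> : (mfact K)%:R * (C * \prod_i expR (s i * rho i) * \prod_(i < d) (rho i ^+ K i)^-1) =
    C * \prod_i ((K i)`!%:R * expR (s i * rho i) / rho i ^+ K i).
  by rewrite !big_split /= /mfact natr_prod; ring.
have -> : C * \prod_i c i * mpow (\row_i q i) K = C * \prod_i (c i * q i ^+ K i).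
  rewrite big_split /= mulrA /mpow; congr (_ * _); apply: eq_bigr => i _.
  by rewrite mxE.
rewrite ler_wpM2l // ler_prod // => i _; have [h1 h2] := hrho i; rewrite h2 andbT.
by rewrite divr_ge0 ?mulr_ge0 ?expR_ge0 ?exprn_ge0 // ltW.
Qed.

End PowerSeries.

(** * Differential operators of infinite order *)

Section SequenceAlgebra.
Variables (R : realType) (d : nat).
Implicit Types (a u v : multiindex d -> R[i]) (q : 'rV[R]_d) (I J K L : multiindex d) (A B c : R).

Definition mconv u v K : R[i] := usum (fun J => if mleq J K then u (msub K J) * v J else 0).

(** Transpose of convolution: the constant-coefficient differential operator
    with symbol [v], acting on the sequence of derivatives at the origin. *)
Definition mact v a K : R[i] := usum (fun J => a (madd K J) * v J).

(** Sequences of geometric growth [geom] pair with sequences that are summable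
    with the corresponding geometric weights [wbound]; the former carry the
    derivatives of functions of exponential type, the latter the coefficients of
    power series on a polydisc. *)
Definition mpos q := forall i, 0 < q ord0 i.
Definition wbound q v B := sumbound (fun J => mpow q J * cmod (v J)) B.
Definition geom c q a := forall K, cmod (a K) <= c * mpow q K.

Lemma mpow_gt0 q K : mpos q -> 0 < mpow q K.
Proof. by move=> q0; apply: prodr_gt0 => i _; rewrite exprn_gt0. Qed.

Lemma geom_ge0 c q a : geom c q a -> 0 <= c.
Proof. by move=> /(_ (mzero d)); rewrite mpow0 mulr1; exact: le_trans (cmod_ge0 _). Qed.

Lemma mact_bound c q a v B K : mpos q -> geom c q a -> wbound q v B ->
  sumbound (fun J => cmod (a (madd K J) * v J)) (c * mpow q K * B).
Proof.
move=> q0 ga vB; have c0 := geom_ge0 ga.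
have cq : 0 <= c * mpow q K by rewrite mulr_ge0 // ltW // mpow_gt0.
apply: sumbound_le (sumboundZ cq vB) => J.
by rewrite cmodM mulrA ler_wpM2r ?cmod_ge0 // -mulrA -mpowD.
Qed.

Lemma mact_summ c q a v B K : mpos q -> geom c q a -> wbound q v B ->
  summ (fun J => a (madd K J) * v J).
Proof. by move=> q0 ga vB; exists (c * mpow q K * B); exact: mact_bound. Qed.

Lemma geom_mact c q a v B : mpos q -> geom c q a -> wbound q v B ->
  geom (c * B) q (mact v a).
Proof.
move=> q0 ga vB K; rewrite mulrAC; apply: usum_le; exact: mact_bound.
Qed.

(* The bijection (L, J) |-> (L + J, J) onto the pairs (K, J) with J <= K. *)
Let cio (p : multiindex d * multiindex d) := (madd p.1 p.2, p.2).
Let cka (p : multiindex d * multiindex d) := (msub p.1 p.2, p.2).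

Let cioK : cancel cio cka.
Proof. by case=> L J; rewrite /cio /cka /=; congr (_, _); exact: maddK. Qed.

Let cio_neq p : cio (cka p) != p -> mleq p.2 p.1 = false.
Proof.
case: p => K J /= h; apply/negbTE; apply: contra h => /msubK h.
by rewrite /cio /cka /= h.
Qed.

Lemma mconv_pairs q u v A B : mpos q -> wbound q u A -> wbound q v B ->
  sumbound (fun p : multiindex d * multiindex d =>
    cmod ((mpow q p.1)%:C * (if mleq p.2 p.1 then u (msub p.1 p.2) * v p.2 else 0))) (A * B).
Proof.
move=> q0 uA vB; apply: (sumbound_reindex (io := cio) (ka := cka)).
  by move=> p /cio_neq ->; rewrite mulr0 cmod0.
have q0' K : 0 <= mpow q K by rewrite ltW // mpow_gt0.
have := sumboundM (fun K => mulr_ge0 (q0' K) (cmod_ge0 (u K)))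
  (fun K => mulr_ge0 (q0' K) (cmod_ge0 (v K))) uA vB.
apply: sumbound_le => -[L J] /=; rewrite mleq_addl (maddK J L) !cmodM cmod_real ger0_norm //.
by rewrite mpowD mulrACA.
Qed.

Lemma mconv_summ q u v A B K : mpos q -> wbound q u A -> wbound q v B ->
  summ (fun J => if mleq J K then u (msub K J) * v J else 0).
Proof.
move=> q0 uA vB.
have hb := @sumbound_row _ _ _
  (fun K J => (mpow q K)%:C * (if mleq J K then u (msub K J) * v J else 0)) _
  (mconv_pairs q0 uA vB) K.
have qK : (mpow q K)%:C != 0 :> R[i].
  by rewrite -cmod_gt0 cmod_real gtr0_norm mpow_gt0.
have := summZ ((mpow q K)%:C)^-1 (ex_intro _ _ hb).
by congr summ; apply/funext => J; rewrite mulKf.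
Qed.

Lemma wbound_mconv q u v A B : mpos q -> wbound q u A -> wbound q v B ->
  wbound q (mconv u v) (A * B).
Proof.
move=> q0 uA vB.
have rows K : summ (fun J => (mpow q K)%:C * (if mleq J K then u (msub K J) * v J else 0)).
  by apply: summZ; exact: mconv_summ q0 uA vB.
have := @sumbound_usum _ _ _
  (fun K J => (mpow q K)%:C * (if mleq J K then u (msub K J) * v J else 0)) rows _
  (mconv_pairs q0 uA vB).
apply: sumbound_le => K; rewrite usumZ; last exact: mconv_summ q0 uA vB.
by rewrite cmodM cmod_real ger0_norm // ltW // mpow_gt0.
Qed.

(** Operators compose by convolution of their symbols: both sides sum
    a_(K+L+J) v_L u_J over pairs. *)
Lemma mact_mact c q a u v A B : mpos q -> geom c q a -> wbound q u A -> wbound q v B ->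
  mact u (mact v a) = mact (mconv v u) a.
Proof.
move=> q0 ga uA vB; apply/funext => K; have c0 := geom_ge0 ga.
have q0' J : 0 <= mpow q J by rewrite ltW // mpow_gt0.
pose F (L J : multiindex d) := a (madd K (madd L J)) * (v L * u J).
have FB : sumbound (fun p => cmod (F p.1 p.2)) (c * mpow q K * (B * A)).
  have := sumboundZ (mulr_ge0 c0 (q0' K)) (sumboundM (fun K => mulr_ge0 (q0' K) (cmod_ge0 (v K)))
    (fun K => mulr_ge0 (q0' K) (cmod_ge0 (u K))) vB uA).
  apply: sumbound_le => -[L J]; rewrite /F /= !cmodM.
  rewrite [leRHS](_ : _ = c * mpow q (madd K (madd L J)) * (cmod (v L) * cmod (u J))).
    by rewrite ler_wpM2r ?mulr_ge0 ?cmod_ge0.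
  by rewrite !mpowD; ring.
have sF : summ (fun p => F p.1 p.2) by eexists; exact: FB.
pose G (S J : multiindex d) := a (madd K S) * (if mleq J S then v (msub S J) * u J else 0).
have GF : (fun p => G p.1 p.2) \o cio = (fun p => F p.1 p.2).
  by apply/funext => -[L J]; rewrite /G /F /= mleq_addl (maddK J L).
have G0 p : cio (cka p) != p -> G p.1 p.2 = 0 by move=> /cio_neq h; rewrite /G h mulr0.
have sG : summ (fun p => G p.1 p.2) by apply: (summ_reindex G0); rewrite GF.
have -> : mact (mconv v u) a K = usum (fun S => usum (G S)).
  congr usum; apply/funext => S; rewrite /G usumZ //; exact: mconv_summ q0 vB uA.
rewrite -(usum_fubini (a := G) sG) (usum_reindex cioK G0) GF // usum_fubini // usum_exchange //.
congr usum; apply/funext => J; rewrite /mact mulrC -usumZ; last exact: mact_summ q0 ga vB.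
by congr usum; apply/funext => L; rewrite /F -maddA [madd J L]maddC; ring.
Qed.

Lemma mact_delta a : mact (fun K => (K == mzero d)%:R) a = a.
Proof.
apply/funext => K; apply: usumE.
rewrite -[X in hassum _ X](_ : a (madd K (mzero d)) * (mzero d == mzero d)%:R = _).
  by apply: hassum_single => L /negPf ->; rewrite mulr0.
by rewrite eqxx mulr1 madd0.
Qed.

(** Comparison with nonnegative sequences, which gives bounds that are uniform in
    a parameter of [u] and [v]. *)
Lemma mconv_dom q (u v : multiindex d -> R[i]) (u' v' : multiindex d -> R) A B K : mpos q ->
  (forall J, cmod (u J) <= u' J) -> (forall J, cmod (v J) <= v' J) ->
  wbound q (fun J => (u' J)%:C) A -> wbound q (fun J => (v' J)%:C) B ->
  cmod (mconv u v K) <= cmod (mconv (fun J => (u' J)%:C) (fun J => (v' J)%:C) K).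
Proof.
move=> q0 uu' vv' uA vB.
have wle (w : multiindex d -> R[i]) (w' : multiindex d -> R) W : (forall J, cmod (w J) <= w' J) ->
    wbound q (fun J => (w' J)%:C) W -> wbound q w W.
  move=> ww' wW; apply: sumbound_le wW => J; rewrite ler_wpM2l //; first by rewrite ltW // mpow_gt0.
  by rewrite cmod_real (le_trans (ww' J)) // ler_norm.
have h1 := usumP (mconv_summ K q0 (wle _ _ _ uu' uA) (wle _ _ _ vv' vB)).
have h2 := usumP (mconv_summ K q0 uA vB).
apply: (hassum_dom (u := fun J => if mleq J K then u' (msub K J) * v' J else 0)) h1 _.
  move=> J; case: ifP; last by rewrite cmod0.
  by rewrite cmodM ler_pM ?cmod_ge0.
rewrite /mconv; move: h2; congr hassum; apply/funext => J.
by case: ifP => // _; rewrite rmorphM.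
Qed.

(** [nrm phi] are the coefficients of the power series with derivatives [phi],
    [zhat z] those of theta |-> e^(theta.z). *)
Definition nrm (phi : multiindex d -> R[i]) K : R[i] := phi K / (mfact K)%:R.
Definition zhat (z : 'rV[R[i]]_d) K : R[i] := mpow z K / (mfact K)%:R.

(** Taylor's formula as the operator e^(z.d) evaluated at the origin. *)
Lemma pser_mact phi z : pser phi z = mact (zhat z) phi (mzero d).
Proof.
congr usum; apply/funext => K; rewrite /pterm /zhat mulrA; by rewrite madd0m.
Qed.

Lemma expR_partial_sum (x : R) n : 0 <= x -> \sum_(k < n) x ^+ k / k`!%:R <= expR x.
Proof.
move=> x0; have nd : nondecreasing_seq (series (exp_coeff x)).
  apply/nondecreasing_seqP => m; rewrite seriesSr lerDl /exp_coeff /=.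
  by rewrite divr_ge0 ?exprn_ge0.
have := nondecreasing_cvgn_le nd (is_cvg_series_exp_coeff x) n.
by rewrite /series /= big_mkord.
Qed.

Lemma expR_dot q (x : 'rV[R]_d) : expR (dot q x) = \prod_i expR (q ord0 i * x ord0 i).
Proof. by rewrite /dot expR_sum. Qed.

Lemma wbound_zhat q z : (forall i, 0 <= q ord0 i) -> wbound q (zhat z) (expR (dot q (absv z))).
Proof.
move=> q0; rewrite expR_dot.
have h i k : 0 <= (q ord0 i * absv z ord0 i) ^+ k / k`!%:R.
  by rewrite divr_ge0 ?exprn_ge0 // mulr_ge0 ?absv_ge0.
have := sumbound_prod h (fun i n => expR_partial_sum n (mulr_ge0 (q0 i) (absv_ge0 z i))).
apply: sumbound_le => K.
rewrite big_split /= /zhat cmodM cmodV cmod_nat cmod_mpow mulrA /mpow -big_split /=.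
have -> : ((mfact K)%:R : R)^-1 = \prod_i ((K i)`!%:R : R)^-1.
  by rewrite /mfact natr_prod prodfV.
rewrite le_eqVlt; apply/orP; left; apply/eqP; congr (_ * _); by apply: eq_bigr => i _; rewrite exprMn.
Qed.

Lemma pser_geom c q phi : mpos q -> geom c q phi ->
  has_pser (fun=> +oo%E) phi (pser phi).
Proof.
move=> q0 gphi z _; split=> //.
have := mact_summ (mzero d) q0 gphi (wbound_zhat z (fun i => ltW (q0 i))).
congr summ; apply/funext => K; rewrite /pterm /zhat mulrA; by rewrite madd0m.
Qed.

Lemma pterm_bound c q phi z : mpos q -> geom c q phi ->
  sumbound (fun K => cmod (pterm phi z K)) (c * expR (dot q (absv z))).
Proof.
move=> q0 gphi.
have := mact_bound (mzero d) q0 gphi (wbound_zhat z (fun i => ltW (q0 i))).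
rewrite mpow0 mulr1; apply: sumbound_le => K; rewrite /pterm /zhat mulrA.
by rewrite madd0m.
Qed.

Lemma wbound_pser Rad phi g q : mpos q -> (forall i, ((q ord0 i)%:E < Rad i)%E) ->
  has_pser Rad phi g -> exists B, wbound q (nrm phi) B.
Proof.
move=> q0 qR hg; have q0' i : 0 <= q ord0 i := ltW (q0 i).
have [[B hB] _] := hg _ (polydisc_cvect q0' qR); exists B.
apply: sumbound_le hB => K; rewrite cmod_pterm absv_cvect // /nrm cmodM cmodV cmod_nat.
by rewrite mulrA [mpow _ _ * _]mulrC.
Qed.

Lemma nrmK (u : multiindex d -> R[i]) : nrm (fun K => (mfact K)%:R * u K) = u.
Proof. by apply/funext => K; rewrite /nrm mulrAC divff ?mul1r ?mfactC_neq0. Qed.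

Lemma pterm_nrm phi z K : pterm phi z K = mpow z K * nrm phi K.
Proof. by rewrite /pterm /nrm; ring. Qed.

(** The sequence of powers of z is an eigenvector of every operator, with the
    value of the symbol at z as eigenvalue; so composition of operators becomes
    the product of power series. *)
Lemma has_pser_mul Rad phi psi g h : has_pser Rad phi g -> has_pser Rad psi h ->
  has_pser Rad (fun K => (mfact K)%:R * mconv (nrm phi) (nrm psi) K) (fun z => g z * h z).
Proof.
move=> hg hh z zR.
have [dl dl0 hdl] := polydisc_margin zR.
pose q : 'rV[R]_d := \row_i (cmod (z ord0 i) + dl).
have q0 : mpos q by move=> i; rewrite mxE ltr_wpDl ?cmod_ge0.
have qR i : ((q ord0 i)%:E < Rad i)%E by rewrite mxE.
have [A uA] := wbound_pser q0 qR hg; have [B vB] := wbound_pser q0 qR hh.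
have ga : geom 1 q (mpow z).
  move=> K; rewrite cmod_mpow mul1r; apply: mpow_le => i.
  by rewrite !mxE cmod_ge0 lerDl ltW.
have tE : pterm (fun K => (mfact K)%:R * mconv (nrm phi) (nrm psi) K) z =
    fun K => mpow z (madd (mzero d) K) * mconv (nrm phi) (nrm psi) K.
  apply/funext => K; rewrite pterm_nrm nrmK; by rewrite madd0m.
rewrite /pser tE; split; first exact: mact_summ q0 ga (wbound_mconv q0 uA vB).
rewrite -/(mact _ _ _) -(mact_mact q0 ga vB uA).
have act1 phi' g' K : has_pser Rad phi' g' -> mact (nrm phi') (mpow z) K = mpow z K * g' z.
  move=> hg'; have [s <-] := hg' z zR.
  have -> : pser phi' z = usum (fun J => mpow z J * nrm phi' J).
    by congr usum; apply/funext => J; exact: pterm_nrm.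
  rewrite -usumZ; last by move: s; congr summ; apply/funext => J; exact: pterm_nrm.
  by congr usum; apply/funext => J; rewrite mpowD -mulrA.
have -> : mact (nrm phi) (mpow z) = fun K => g z * mpow z K.
  by apply/funext => K; rewrite (act1 _ _ _ hg) mulrC.
have -> : mact (nrm psi) (fun K => g z * mpow z K) (mzero d) = g z * mact (nrm psi) (mpow z) (mzero d).
  rewrite /mact -usumZ; last exact: mact_summ q0 ga vB.
  by congr usum; apply/funext => J; rewrite mulrA.
by rewrite (act1 _ _ _ hh) mpow0 mul1r.
Qed.

Lemma has_pser_one Rad : has_pser Rad (fun K : multiindex d => (K == mzero d)%:R : R[i]) (fun=> 1).
Proof.
move=> z _; set t := pterm _ z.
have t1 : t (mzero d) = 1 by rewrite /t /pterm eqxx mpow0 mfact0 !mul1r invr1.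
have t0 K : K != mzero d -> t K = 0 by rewrite /t /pterm => /negPf ->; rewrite !mul0r.
have h := hassum_single t0; rewrite t1 in h; split; last exact: usumE h.
eexists; apply: (sumbound_single (i0 := mzero d)) => [|K /t0 ->]; [exact: cmod_ge0|exact: cmod0].
Qed.

Section Exponential.
Variable z : 'rV[R[i]]_d.

Lemma partial_cexp (k : R[i]) j :
  (forall t, derivable (fun t : 'rV[R[i]]_d => k * cexp (dot t z)) t (delta_mx ord0 j)) /\
  partial j (fun t => k * cexp (dot t z)) = (fun t => z ord0 j * k * cexp (dot t z)).
Proof.
have key t : derivable (fun t : 'rV[R[i]]_d => k * cexp (dot t z)) t (delta_mx ord0 j) /\
    'D_(delta_mx ord0 j) (fun t => k * cexp (dot t z)) t = z ord0 j * k * cexp (dot t z).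
  apply/derivableP_eps => e e0; set w := dot t z.
  have [kw kwE] : exists kw, kw = k * cexp w by eexists.
  pose M := (cmod (z ord0 j) + 1) * (cmod kw + 1).
  have z1 : 0 < cmod (z ord0 j) + 1 by rewrite ltr_wpDl ?cmod_ge0.
  have k1 : 0 < cmod kw + 1 by rewrite ltr_wpDl ?cmod_ge0.
  have [dl dl0 hd] := cexp_eps (divr_gt0 e0 (mulr_gt0 z1 k1)).
  exists (dl / (cmod (z ord0 j) + 1)); first by rewrite divr_gt0.
  move=> h; rewrite ltr_pdivlMr // => hh.
  have -> : dot (t + h *: delta_mx ord0 j) z = w + h * z ord0 j.
    rewrite /w /dot.
    have -> : h * z ord0 j = \sum_i (if i == j then h * z ord0 i else 0).
      by rewrite -big_mkcond big_pred1_eq.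
    rewrite -big_split; apply: eq_bigr => i _; rewrite !mxE /=.
    by case: (i == j); rewrite ?mulr1 ?mulr0 ?addr0 ?mulrDl.
  have hz : cmod (h * z ord0 j) < dl.
    by rewrite cmodM (le_lt_trans _ hh) // ler_wpM2l ?cmod_ge0 // lerDl.
  have -> : k * cexp (w + h * z ord0 j) - k * cexp w - h * (z ord0 j * k * cexp w) =
    kw * (cexp (h * z ord0 j) - 1 - h * z ord0 j) by rewrite cexpD kwE; ring.
  rewrite cmodM (le_trans (ler_wpM2l (cmod_ge0 _) (hd _ hz))) // cmodM.
  rewrite [leLHS](_ : _ = e * cmod h * (cmod kw * cmod (z ord0 j) / M)); last by rewrite -/M; ring.
  apply: ler_piMr; first by rewrite mulr_ge0 ?cmod_ge0 // ltW.
  rewrite ler_pdivrMr ?mulr_gt0 // mul1r /M mulrC ler_pM ?cmod_ge0 //.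
    by rewrite lerDl.
  by rewrite lerDl.
split; first by move=> t; case: (key t).
by apply/funext => t; case: (key t).
Qed.

(** The exponential is holomorphic and reproduces itself under differentiation,
    so the general expansion of holomorphic functions applies to it. *)
Lemma has_pser_cexp : has_pser (fun=> +oo%E) (mpow z) (fun t => cexp (dot t z)).
Proof.
have e1 : (fun t => cexp (dot t z)) = (fun t => 1 * cexp (dot t z)).
  by apply/funext => t; rewrite mul1r.
have [|||h _] := @has_pser_holomorphic R d (fun=> +oo%E) (fun t => cexp (dot t z)).
- by move=> i; exact: ltry.
- by move=> t j _; rewrite e1; case: (partial_cexp 1 j).
- move=> rho _; exists (expR (\sum_i rho i * cmod (z ord0 i))) => t tr.
  rewrite cmod_cexp ler_expR (le_trans (ler_norm _)) // (le_trans (cmod_Re _)) //.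
  rewrite (le_trans (cmod_sum _ _ _)) // ler_sum // => i _.
  by rewrite cmodM ler_wpM2r ?cmod_ge0.
rewrite (_ : mpow z = fun K => mpartial K (fun t => cexp (dot t z)) 0) //.
apply/funext => K.
have foldE s : foldr (fun j => iter (K j) (partial j)) (fun t => cexp (dot t z)) s =
    (fun t => \prod_(j <- s) z ord0 j ^+ K j * cexp (dot t z)).
  elim: s => [|j s IH] /=; first by rewrite {1}e1; apply/funext => t; rewrite big_nil.
  rewrite IH; set k := \prod_(i <- s) _.
  have iterE n : iter n (partial j) (fun t => k * cexp (dot t z)) =
      (fun t => z ord0 j ^+ n * k * cexp (dot t z)).
    elim: n => [|n IHn] /=; first by apply/funext => t; rewrite mul1r.
    by rewrite IHn; have [_ ->] := partial_cexp (z ord0 j ^+ n * k) j; apply/funext => t; rewrite exprS !mulrA.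
  by rewrite iterE big_cons.
rewrite /mpartial foldE big_enum /= /mpow.
rewrite (_ : dot 0 z = 0) ?cexp0 ?mulr1 //.
by rewrite /dot big1 // => i _; rewrite mxE mul0r.
Qed.

End Exponential.

End SequenceAlgebra.

(** * Complex expectations *)

Section ComplexExpectation.
Variables (disp : measure_display) (T : measurableType disp) (R : realType) (P : probability T R).
Implicit Types (Y Z : T -> R[i]).

Definition cmeasurable Y :=
  measurable_fun [set: T] (fun w => complex.Re (Y w)) /\
  measurable_fun [set: T] (fun w => complex.Im (Y w)).

Lemma ReM (z w : R[i]) : complex.Re (z * w) =
  complex.Re z * complex.Re w - complex.Im z * complex.Im w.
Proof. by case: z w => [a b] [c e]. Qed.

Lemma ImM (z w : R[i]) : complex.Im (z * w) =
  complex.Re z * complex.Im w + complex.Im z * complex.Re w.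
Proof. by case: z w => [a b] [c e]; rewrite /= addrC [b * c]mulrC. Qed.

Lemma ReD (z w : R[i]) : complex.Re (z + w) = complex.Re z + complex.Re w.
Proof. by case: z w => [a b] [c e]. Qed.

Lemma ImD (z w : R[i]) : complex.Im (z + w) = complex.Im z + complex.Im w.
Proof. by case: z w => [a b] [c e]. Qed.

Lemma ReN (z : R[i]) : complex.Re (- z) = - complex.Re z.
Proof. by case: z. Qed.

Lemma ImN (z : R[i]) : complex.Im (- z) = - complex.Im z.
Proof. by case: z. Qed.

Lemma cmeasurable_cst c : cmeasurable (fun=> c).
Proof. by split; exact: measurable_cst. Qed.

Lemma cmeasurable_real (X : T -> R) : measurable_fun [set: T] X -> cmeasurable (fun w => (X w)%:C).
Proof. by move=> mX; split => //=; exact: measurable_cst. Qed.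

Lemma cmeasurableD Y Z : cmeasurable Y -> cmeasurable Z -> cmeasurable (fun w => Y w + Z w).
Proof.
move=> [Y1 Y2] [Z1 Z2]; split.
  by under eq_fun do rewrite ReD; exact: measurable_funD.
by under eq_fun do rewrite ImD; exact: measurable_funD.
Qed.

Lemma cmeasurableN Y : cmeasurable Y -> cmeasurable (fun w => - Y w).
Proof.
move=> [Y1 Y2]; split.
  by under eq_fun do rewrite ReN; exact: measurable_funN.
by under eq_fun do rewrite ImN; exact: measurable_funN.
Qed.

Lemma cmeasurableM Y Z : cmeasurable Y -> cmeasurable Z -> cmeasurable (fun w => Y w * Z w).
Proof.
move=> [Y1 Y2] [Z1 Z2]; split.
  by under eq_fun do rewrite ReM; apply: measurable_funB; exact: measurable_funM.
by under eq_fun do rewrite ImM; apply: measurable_funD; exact: measurable_funM.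
Qed.

Lemma cmeasurable_sum (I : Type) (s : seq I) (F : I -> T -> R[i]) :
  (forall i, cmeasurable (F i)) -> cmeasurable (fun w => \sum_(i <- s) F i w).
Proof.
move=> mF; elim: s => [|i s IH].
  by under eq_fun do rewrite big_nil; exact: cmeasurable_cst.
by under eq_fun do rewrite big_cons; exact: cmeasurableD.
Qed.

Lemma cmeasurable_prod (I : Type) (s : seq I) (F : I -> T -> R[i]) :
  (forall i, cmeasurable (F i)) -> cmeasurable (fun w => \prod_(i <- s) F i w).
Proof.
move=> mF; elim: s => [|i s IH].
  by under eq_fun do rewrite big_nil; exact: cmeasurable_cst.
by under eq_fun do rewrite big_cons; exact: cmeasurableM.
Qed.

Lemma cmeasurableX Y n : cmeasurable Y -> cmeasurable (fun w => Y w ^+ n).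
Proof.
move=> mY; elim: n => [|n IH]; first exact: cmeasurable_cst.
by under eq_fun do rewrite exprS; exact: cmeasurableM.
Qed.

Lemma measurable_cmod Y : cmeasurable Y -> measurable_fun [set: T] (fun w => cmod (Y w)).
Proof.
move=> [Y1 Y2].
have -> : (fun w => cmod (Y w)) =
    Num.sqrt \o (fun w => complex.Re (Y w) ^+ 2 + complex.Im (Y w) ^+ 2).
  by apply/funext => w /=; case: (Y w).
apply: measurableT_comp.
  by apply: continuous_measurable_fun => x; exact: sqrt_continuous.
by apply: measurable_funD; exact: measurable_funX.
Qed.

Lemma cmeasurable_cvg (Y_ : nat -> T -> R[i]) Y : (forall n, cmeasurable (Y_ n)) ->
  (forall w (e : R), 0 < e -> exists N, forall n, (N <= n)%N -> cmod (Y_ n w - Y w) <= e) ->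
  cmeasurable Y.
Proof.
move=> mY h; split.
  apply: (@measurable_fun_cvg _ _ _ _ (fun n w => complex.Re (Y_ n w))) => [m|w _].
    by case: (mY m).
  apply/cvgrPdist_le => e e0; have [N hN] := h w e e0; exists N => // n /hN.
  by apply: le_trans; rewrite distrC -ReN -ReD; exact: cmod_Re.
apply: (@measurable_fun_cvg _ _ _ _ (fun n w => complex.Im (Y_ n w))) => [m|w _].
  by case: (mY m).
apply/cvgrPdist_le => e e0; have [N hN] := h w e e0; exists N => // n /hN.
by apply: le_trans; rewrite distrC -ImN -ImD; exact: cmod_Im.
Qed.

Lemma expectationE (X : T -> R) : 'E_P[X]%E = (\int[P]_w (X w)%:E)%E.
Proof. by rewrite unlock. Qed.

Lemma cexpectationE Y : cexpectation P Y =
  (\int[P]_w complex.Re (Y w)) +i* (\int[P]_w complex.Im (Y w)).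
Proof. by rewrite /cexpectation !expectationE. Qed.

(** Families of random variables with absolutely convergent sum, dominated by
    an integrable [G].  The sequence [F_] of finite sets exhausting the indices
    gives access to measurability of limits and to dominated convergence, which
    hold along sequences. *)

Section Dominated.
Variable G : T -> R.
Hypotheses (G_ge0 : forall w, 0 <= G w) (mG : measurable_fun [set: T] G).
Hypothesis G_fin : ('E_P[G] < +oo)%E.

Lemma integrable_dom : P.-integrable [set: T] (fun w => (G w)%:E).
Proof.
apply/integrableP; split; first exact/measurable_EFinP.
under eq_integral => w _ do rewrite gee0_abs ?lee_fin //.
by rewrite -expectationE.
Qed.

Lemma integrable_le (X : T -> R) : measurable_fun [set: T] X -> (forall w, `|X w| <= G w) ->
  P.-integrable [set: T] (fun w => (X w)%:E).
Proof.
move=> mX XG; apply: (le_integrable measurableT _ _ integrable_dom).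
  exact/measurable_EFinP.
by move=> w _ /=; rewrite lee_fin (le_trans (XG w)) // ler_norm.
Qed.

Lemma cintegrable_le Y : cmeasurable Y -> (forall w, cmod (Y w) <= G w) -> cintegrable P Y.
Proof.
move=> [Y1 Y2] YG; split; apply: integrable_le => // w.
  exact: le_trans (cmod_Re _) (YG w).
exact: le_trans (cmod_Im _) (YG w).
Qed.

Lemma integrable_cmod Y : cmeasurable Y -> (forall w, cmod (Y w) <= G w) ->
  P.-integrable [set: T] (fun w => (cmod (Y w))%:E).
Proof.
move=> mY YG; apply: integrable_le => //; first exact: measurable_cmod.
by move=> w; rewrite ger0_norm ?cmod_ge0.
Qed.

(** The factor 2 comes from bounding real and imaginary parts separately. *)
Lemma cexpectation_le Y : cmeasurable Y -> (forall w, cmod (Y w) <= G w) ->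
  cmod (cexpectation P Y) <= 2 * \int[P]_w cmod (Y w).
Proof.
move=> mY YG; have [i1 i2] := cintegrable_le mY YG; have ic := integrable_cmod mY YG.
rewrite cexpectationE (le_trans (cmod_le_ReIm _)) //= mulr_natl mulr2n lerD //.
  rewrite (le_trans (le_normr_Rintegral measurableT i1)) // le_Rintegral //.
    by apply: integrable_le; [apply: measurableT_comp => //; case: mY|move=> w; rewrite normr_id (le_trans (cmod_Re _))].
  by move=> w _; exact: cmod_Re.
rewrite (le_trans (le_normr_Rintegral measurableT i2)) // le_Rintegral //.
  by apply: integrable_le; [apply: measurableT_comp => //; case: mY|move=> w; rewrite normr_id (le_trans (cmod_Im _))].
by move=> w _; exact: cmod_Im.
Qed.

Lemma cexpectationD Y Z : cintegrable P Y -> cintegrable P Z ->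
  cexpectation P (fun w => Y w + Z w) = cexpectation P Y + cexpectation P Z.
Proof.
move=> [Y1 Y2] [Z1 Z2]; rewrite !cexpectationE.
have -> : \int[P]_w complex.Re (Y w + Z w) = \int[P]_w complex.Re (Y w) + \int[P]_w complex.Re (Z w).
  rewrite -RintegralD //; by apply: eq_Rintegral => w _; rewrite ReD.
have -> : \int[P]_w complex.Im (Y w + Z w) = \int[P]_w complex.Im (Y w) + \int[P]_w complex.Im (Z w).
  rewrite -RintegralD //; by apply: eq_Rintegral => w _; rewrite ImD.
by [].
Qed.

Lemma cexpectationZ c Y : cintegrable P Y ->
  cexpectation P (fun w => c * Y w) = c * cexpectation P Y.
Proof.
move=> [Y1 Y2]; rewrite !cexpectationE; case: c => a b.
have iZ (k : R) (X : T -> R) : P.-integrable [set: T] (fun w => (X w)%:E) ->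
    P.-integrable [set: T] (fun w => (k * X w)%:E).
  by move=> iX; under eq_fun do rewrite EFinM; exact: integrableZl.
have -> : \int[P]_w complex.Re ((a +i* b) * Y w) =
   a * \int[P]_w complex.Re (Y w) - b * \int[P]_w complex.Im (Y w).
  rewrite -!RintegralZl // -RintegralB //; try exact: iZ.
  by apply: eq_Rintegral => w _; rewrite ReM.
have -> : \int[P]_w complex.Im ((a +i* b) * Y w) =
   a * \int[P]_w complex.Im (Y w) + b * \int[P]_w complex.Re (Y w).
  rewrite -!RintegralZl // -RintegralD //; try exact: iZ.
  by apply: eq_Rintegral => w _; rewrite ImM.
by simpc.
Qed.

Variables (I : choiceType) (F_ : nat -> {fset I}).
Hypothesis F_exhausts : forall F : {fset I}, exists N, forall n, (N <= n)%N -> (F `<=` F_ n)%fset.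
Variables (Y_ : I -> T -> R[i]) (Y : T -> R[i]).
Hypothesis mY_ : forall i, cmeasurable (Y_ i).
Hypothesis Y_dom : forall w, sumbound (fun i => cmod (Y_ i w)) (G w).
Hypothesis Y_sum : forall w, hassum (fun i => Y_ i w) (Y w).

Lemma dom_term i w : cmod (Y_ i w) <= G w.
Proof. exact: sumbound_term (Y_dom w). Qed.

Lemma dom_sum w : cmod (Y w) <= G w.
Proof. exact: hassum_le (Y_dom w) (Y_sum w). Qed.

Lemma dom_psum (F : {fset I}) w : cmod (\sum_(i <- F) Y_ i w) <= G w.
Proof. exact: le_trans (cmod_sum _ _ _) (Y_dom w F). Qed.

Lemma cmeasurable_hassum : cmeasurable Y.
Proof.
apply: (@cmeasurable_cvg (fun n w => \sum_(i <- F_ n) Y_ i w)).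
  by move=> n; exact: cmeasurable_sum.
move=> w e e0; have [F hF] := Y_sum w e0; have [N hN] := F_exhausts F.
by exists N => n /hN; exact: hF.
Qed.

Lemma Rintegral_cmod_sum (s : seq I) :
  \sum_(i <- s) \int[P]_w cmod (Y_ i w) = \int[P]_w \sum_(i <- s) cmod (Y_ i w) /\
  P.-integrable [set: T] (fun w => (\sum_(i <- s) cmod (Y_ i w))%:E).
Proof.
elim: s => [|i s [IH1 IH2]].
  rewrite big_nil; split.
    rewrite (_ : (fun w => \sum_(i <- [::]) cmod (Y_ i w)) = fun=> 0) ?Rintegral_cst ?mul0r //.
    by apply/funext => w; rewrite big_nil.
  by under eq_fun do rewrite big_nil; exact: integrable0.
have ic := integrable_cmod (mY_ i) (dom_term i).
rewrite big_cons IH1 -RintegralD //; split.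
  by apply: eq_Rintegral => w _; rewrite big_cons.
under eq_fun do rewrite big_cons EFinD.
exact: integrableD.
Qed.

Lemma sumbound_int : sumbound (fun i => \int[P]_w cmod (Y_ i w)) (\int[P]_w G w).
Proof.
move=> F; have [-> iF] := Rintegral_cmod_sum F.
apply: le_Rintegral => //; first exact: integrable_dom.
by move=> w _; exact: Y_dom.
Qed.

(** Dominated convergence along finite sets: the distance to a finite partial
    sum is a limit of sums over further terms, whose integrals are small by the
    Cauchy criterion for the series of integrals. *)
Lemma hassum_L1 (e : R) : 0 < e -> exists F0, forall F, (F0 `<=` F)%fset ->
  \int[P]_w cmod (\sum_(i <- F) Y_ i w - Y w) <= e.
Proof.
move=> e0.
have int0 i : 0 <= \int[P]_w cmod (Y_ i w) by apply: Rintegral_ge0 => w _; exact: cmod_ge0.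
have [F0 hF0] := sumbound_tail int0 sumbound_int e0.
exists F0 => F F0F.
pose S n w := \sum_(i <- F) Y_ i w - \sum_(i <- (F `|` F_ n)%fset) Y_ i w.
have mS n : cmeasurable (S n).
  by apply: cmeasurableD; [|apply: cmeasurableN]; exact: cmeasurable_sum.
have SE n w : S n w = - \sum_(i <- ((F `|` F_ n) `\` F)%fset) Y_ i w.
  by rewrite /S (sum_fsetID _ (fsubsetUl F (F_ n))) opprD addrA subrr add0r.
have SG n w : cmod (S n w) <= G w by rewrite SE cmodN dom_psum.
have Sint n : \int[P]_w cmod (S n w) <= e.
  rewrite (@le_trans _ _ (\sum_(i <- ((F `|` F_ n) `\` F)%fset) \int[P]_w cmod (Y_ i w))) //; last first.
    apply: hF0; apply/fdisjointP => i; rewrite !inE => /andP[iF _].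
    by apply: contra iF; apply: (fsubsetP F0F).
  set s := ((F `|` F_ n) `\` F)%fset.
  have [-> iF] := Rintegral_cmod_sum s; apply: le_Rintegral => //.
    by apply: integrable_cmod.
  by move=> w _; rewrite SE cmodN cmod_sum.
have mY := cmeasurable_hassum.
have mD : cmeasurable (fun w => \sum_(i <- F) Y_ i w - Y w).
  by apply: cmeasurableD; [exact: cmeasurable_sum|exact: cmeasurableN].
have [|||||_ _ hcv] := @dominated_convergence _ T R P setT measurableT
   (fun n w => (cmod (S n w))%:E) (fun w => (cmod (\sum_(i <- F) Y_ i w - Y w))%:E) (fun w => (G w)%:E).
- by move=> n; apply/measurable_EFinP; exact: measurable_cmod.
- by apply/measurable_EFinP; exact: measurable_cmod.
- apply: aeW => w _; apply: cvg_EFin; first exact: nearW.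
  apply/cvgrPdist_le => e' e'0; have [F' hF'] := Y_sum w e'0; have [N hN] := F_exhausts F'.
  exists N => // n /hN h /=; rewrite (le_trans (cmod_dist _ _)) // /S opprB.
  rewrite addrC addrA subrK hF' //.
  exact: fsubset_trans h (fsubsetUr _ _).
- exact: integrable_dom.
- by apply: aeW => w n _; rewrite gee0_abs ?lee_fin ?cmod_ge0.
have intE n : (\int[P]_w (cmod (S n w))%:E = (\int[P]_w cmod (S n w))%:E)%E.
  rewrite fineK // ; apply: integrable_fin_num => //; exact: integrable_cmod.
have DG w : cmod (\sum_(i <- F) Y_ i w - Y w) <= G w + G w.
  by rewrite (le_trans (cmodB _ _)) // lerD ?dom_psum ?dom_sum.
have : (\int[P]_w (cmod (\sum_(i <- F) Y_ i w - Y w))%:E <= e%:E)%E.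
  have hl := @cvg_lim _ _ _ _ _ _ _ hcv; rewrite -hl //.
  apply: lime_le; first by apply/cvg_ex; eexists; exact: hcv.
  by apply: nearW => n; rewrite /= intE lee_fin.
rewrite /Rintegral -lee_fin => h; rewrite fineK //.
rewrite ge0_fin_numE; first by apply: le_lt_trans h _; exact: ltry.
by apply: integral_ge0 => w _; rewrite lee_fin cmod_ge0.
Qed.

Lemma cexpectation_sum (s : seq I) :
  cintegrable P (fun w => \sum_(i <- s) Y_ i w) /\
  cexpectation P (fun w => \sum_(i <- s) Y_ i w) = \sum_(i <- s) cexpectation P (Y_ i).
Proof.
elim: s => [|i s [IH1 IH2]].
  have -> : (fun w => \sum_(i <- [::]) Y_ i w) = fun=> 0 by apply/funext => w; rewrite big_nil.
  rewrite big_nil; split; last by rewrite cexpectationE /= Rintegral_cst // mul0r.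
  by split; exact: integrable0.
have iY := cintegrable_le (mY_ i) (dom_term i).
have -> : (fun w => \sum_(k <- i :: s) Y_ k w) = fun w => Y_ i w + \sum_(k <- s) Y_ k w.
  by apply/funext => w; rewrite big_cons.
rewrite cexpectationD // big_cons IH2; split=> //.
case: iY IH1 => [a1 a2] [b1 b2]; split.
  by under eq_fun do rewrite ReD EFinD; exact: integrableD.
by under eq_fun do rewrite ImD EFinD; exact: integrableD.
Qed.

Lemma hassum_cexpectation :
  hassum (fun i => cexpectation P (Y_ i)) (cexpectation P Y).
Proof.
move=> e e0; have e2 : 0 < e / 2 by rewrite divr_gt0.
have [F0 hF0] := hassum_L1 e2; exists F0 => F /hF0 hF.
have iY := cintegrable_le cmeasurable_hassum dom_sum.
have [iF <-] := cexpectation_sum F.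
have mS : cmeasurable (fun w => \sum_(i <- F) Y_ i w) by exact: cmeasurable_sum.
have mN : cmeasurable (fun w => -1 * Y w).
  by apply: cmeasurableM cmeasurable_hassum; exact: cmeasurable_cst.
have iN : cintegrable P (fun w => -1 * Y w).
  by apply: (cintegrable_le mN) => w; rewrite mulN1r cmodN dom_sum.
have dD w : cmod (\sum_(i <- F) Y_ i w + -1 * Y w) <= G w.
  by rewrite mulN1r; apply: hassum_tail (Y_sum w) _ => F' _; exact: Y_dom.
rewrite -mulN1r -(cexpectationZ _ iY) -(cexpectationD iF iN).
rewrite (le_trans (cexpectation_le (cmeasurableD mS mN) dD)) //.
rewrite mulrC -ler_pdivlMr // (le_trans _ hF) // le_eqVlt; apply/orP; left; apply/eqP.
by apply: eq_Rintegral => w _; rewrite mulN1r.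
Qed.

End Dominated.

End ComplexExpectation.

(** * Compactness and reciprocals of power series *)

Section ComplexSpaceTopology.
Variables (R : realType) (d : nat).
Implicit Types (z : 'rV[R[i]]_d).

Lemma nbhs_rowP z (A : set 'rV[R[i]]_d) : nbhs z A <->
  exists2 dl : R, 0 < dl & forall z', (forall i, cmod (z' ord0 i - z ord0 i) < dl) -> A z'.
Proof.
split.
  move=> [Q hQ hA].
  have he i : exists e : R, 0 < e /\ forall w, cmod (w - z ord0 i) < e -> Q ord0 i w.
    by have /nbhsc[e e0 h] := hQ ord0 i; exists e.
  have [e h] := choice he.
  have [dl dl0 hdl] := common_lower_bound (fun i => proj1 (h i)).
  exists dl => // z' hz'; apply: hA => k i; rewrite (ord1 k).
  by apply: (proj2 (h i)); exact: lt_le_trans (hz' i) (hdl i).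
move=> [dl dl0 hA]; exists (fun k i => [set w | cmod (w - z k i) < dl]).
  by move=> k i; apply/nbhsc; exists dl.
by move=> z' hz'; apply: hA => i; exact: hz'.
Qed.

(** The disc is covered by a compact real square, on which the condition
    |x + iy| <= r is closed. *)
Lemma compact_disc (r : R) : compact [set w : R[i] | cmod w <= r].
Proof.
apply/compact_near_coveringP => I F Q FF hQ.
have /compact_near_coveringP cK : compact (`[- r, r]%classic `*` `[- r, r]%classic : set (R * R)).
  by apply: compact_setX; exact: segment_compact.
have : \forall i \near F, (`[- r, r]%classic `*` `[- r, r]%classic) `<=`
    [set p : R * R | cmod (p.1 +i* p.2) <= r -> Q i (p.1 +i* p.2)].
  apply: cK => -[x y] _.
  have near_pair (e : R) : 0 < e -> \forall p \near (x, y), cmod ((p.1 +i* p.2) - (x +i* y)) < e.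
    move=> e0; have e2 : 0 < e / 2 by rewrite divr_gt0.
    exists ([set t | `|t - x| < e / 2], [set t | `|t - y| < e / 2]).
      by split; apply/nbhs_ballP; exists (e / 2) => // t; rewrite -ball_normE /ball_ /= distrC.
    move=> [s t] [hs ht].
    have {}hs : `|s - x| < e / 2 by [].
    have {}ht : `|t - y| < e / 2 by [].
    change (cmod ((s +i* t) - (x +i* y)) < e).
    have -> : (s +i* t) - (x +i* y) = (s - x) +i* (t - y) by simpc.
    by rewrite (le_lt_trans (cmod_le_ReIm _)) //= (splitr e) ltrD.
  have [xyr|xyr] := leP (cmod (x +i* y)) r.
    have [[A B] /= [hA hB] hAB] := hQ _ xyr.
    have /nbhsc[e e0 he] := hA.
    exists ([set p : R * R | cmod ((p.1 +i* p.2) - (x +i* y)) < e], B).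
      by split => //; exact: near_pair.
    move=> [p i] [hp Bi] _; apply: (hAB (p.1 +i* p.2, i)).
    by split=> //; exact: (he _ hp).
  exists ([set p : R * R | cmod ((p.1 +i* p.2) - (x +i* y)) < cmod (x +i* y) - r], setT).
    by split; [apply: near_pair; rewrite subr_gt0|exact: filterT].
  move=> [p i] [hp _] hr.
  have {}hp : cmod ((p.1 +i* p.2) - (x +i* y)) < cmod (x +i* y) - r by [].
  have {}hr : cmod (p.1 +i* p.2) <= r by [].
  have := cmodB (p.1 +i* p.2) ((p.1 +i* p.2) - (x +i* y)).
  by rewrite subKr; lra.
apply: filterS => i hi w wr.
have {}wr : cmod w <= r by [].
have hw : (complex.Re w +i* complex.Im w) = w by case: (w).
rewrite -hw; apply: (hi (complex.Re w, complex.Im w)); last by rewrite /mkset hw.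
by split => /=; rewrite in_itv /= -ler_norml (le_trans _ wr) // ?cmod_Re ?cmod_Im.
Qed.

Lemma compact_polydisc (r : 'I_d -> R) :
  compact [set z : 'rV[R[i]]_d | forall i, cmod (z ord0 i) <= r i].
Proof.
exact: (@rV_compact _ _ (fun i => [set w : R[i] | cmod w <= r i]) (fun i => @compact_disc (r i))).
Qed.

Lemma compact_bounded_rows (A : set 'rV[R[i]]_d) : compact A ->
  exists b : R, 0 <= b /\ forall z, A z -> forall i, cmod (z ord0 i) <= b.
Proof.
move=> /compact_near_coveringP cA.
have : \forall b \near +oo%R, A `<=` [set z | forall i, cmod (z ord0 i) <= b].
  apply: cA => z _.
  exists ([set z' : 'rV[R[i]]_d | forall i, cmod (z' ord0 i - z ord0 i) < 1],
          [set b : R | forall i, cmod (z ord0 i) + 1 <= b]).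
    split => /=; first by apply/nbhs_rowP; exists 1.
    exists (\sum_i (cmod (z ord0 i) + 1)); split; first exact: num_real.
    move=> b hb i; apply: ltW; apply: le_lt_trans hb.
    rewrite (bigD1 i) //= lerDl sumr_ge0 // => k _.
    by rewrite addr_ge0 ?cmod_ge0.
  move=> [z' b] /= [hz hb] i; have := hb i; have := hz i.
  by have := cmodD (z' ord0 i - z ord0 i) (z ord0 i); rewrite subrK; lra.
move=> h; have [b [b0 hb]] := filter_ex (filterI (nbhs_pinfty_ge (num_real (0 : R))) h).
by exists b; split.
Qed.

End ComplexSpaceTopology.

Section Reciprocal.
Variables (R : realType) (d : nat).
Implicit Types (f g : 'rV[R[i]]_d -> R[i]) (z : 'rV[R[i]]_d).

Lemma derivableV_row f z v : derivable f z v -> f z != 0 ->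
  derivable (fun t => (f t)^-1) z v.
Proof.
move=> df fz.
have cf : cdiff (fun h => f (z + h *: v)) 0.
  have [_ /(_ (conj df erefl)) h] := derivableP_eps f z v ('D_v f z).
  apply: (@cdiff_epsP _ _ _ ('D_v f z)) => e /h[dl dl0 hd].
  by exists dl => // t /hd; rewrite add0r scale0r addr0.
have cV : cdiff (fun h => (f (z + h *: v))^-1) 0.
  by apply: cdiffV cf _; rewrite scale0r addr0.
have [l hl] := cdiff_eps cV.
have [h _] := derivableP_eps (fun t => (f t)^-1) z v l.
suff : derivable (fun t => (f t)^-1) z v /\ 'D_v (fun t => (f t)^-1) z = l by case.
apply: h => e /hl[dl dl0 hd]; exists dl => // t /hd.
by rewrite add0r scale0r addr0.
Qed.

(** The reciprocal of a zero-free power series is one again on the whole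
    polydisc: it is holomorphic, and bounded on smaller closed polydiscs by
    compactness. *)
Lemma has_pserV Rad phi g : (forall i, 0 < Rad i)%E -> has_pser Rad phi g ->
  (forall z, polydisc Rad z -> g z != 0) ->
  has_pser Rad (fun K => mpartial K (fun t => (g t)^-1) 0) (fun t => (g t)^-1).
Proof.
move=> R0 hg g0.
have [|||h _] := @has_pser_holomorphic R d Rad (fun t => (g t)^-1) => //.
- move=> z j zR; apply: derivableV_row (g0 z zR).
  by have [_ []] := pser_partial j hg zR.
- move=> rho hr.
  have /compact_near_coveringP cK := @compact_polydisc R d rho.
  have : \forall e \near (0 : R)^'+, [set z : 'rV[R[i]]_d | forall i, cmod (z ord0 i) <= rho i] `<=`
      [set z | e <= cmod (g z)].
    apply: cK => z zr.
    have zR : polydisc Rad z.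
      by move=> i; apply: le_lt_trans (proj2 (hr i)); rewrite lee_fin; exact: zr.
    have m0 : 0 < cmod (g z) / 2 by rewrite divr_gt0 // cmod_gt0 g0.
    have [dl dl0 hd] := pser_continuous hg zR m0.
    exists ([set z' : 'rV[R[i]]_d | forall i, cmod (z' ord0 i - z ord0 i) < dl], [set e | e < cmod (g z) / 2]).
      split => /=; first by apply/nbhs_rowP; exists dl.
      exact: nbhs_right_lt.
    move=> [z' e] /= [hz he]; have [_] := hd z' (fun i => ltW (hz i)).
    rewrite cmodBC; have := cmodD (g z - g z') (g z'); rewrite subrK; lra.
  move=> hnear; have [e [e0 he]] := filter_ex (filterI (nbhs_right_gt (0 : R)) hnear).
  exists e^-1 => z zr; rewrite cmodV lef_pV2 ?posrE //; first exact: he.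
  exact: lt_le_trans e0 (he z zr).
Qed.

End Reciprocal.

(** * The moment-generating function *)

Section RandomVectorSeries.
Variables (disp : measure_display) (T : measurableType disp) (R : realType).
Variables (P : probability T R) (d : nat) (X : 'I_d -> {RV P >-> R}).
Variable Rad : 'I_d -> \bar R.
Hypothesis Rad_gt0 : forall i, (0 < Rad i)%E.
Hypothesis mgfX : mgf_defined X Rad.

Definition expdot (q : 'rV[R]_d) (w : T) : R := expR (dot q (absv (cvec X w))).

Lemma expdot_ge0 q w : 0 <= expdot q w.
Proof. exact: expR_ge0. Qed.

Lemma cmeasurable_mpow K : cmeasurable (fun w => mpow (cvec X w) K).
Proof.
apply: cmeasurable_prod => i; apply: cmeasurableX.
under eq_fun do rewrite mxE.
by apply: cmeasurable_real; exact: measurable_funPT.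
Qed.

Lemma measurable_expdot q : measurable_fun [set: T] (expdot q).
Proof.
apply: measurableT_comp => //; apply: measurable_sum => i.
under eq_fun do rewrite !mxE cmod_real.
apply: measurable_funM; first exact: measurable_cst.
by apply: measurableT_comp => //; exact: measurable_funPT.
Qed.

Lemma expdot_fin q : radius_lt q Rad -> ('E_P[expdot q] < +oo)%E.
Proof. exact: mgfX. Qed.

Definition moment K : R[i] := cexpectation P (fun w => mpow (cvec X w) K).

Lemma positive_radius : exists q : 'rV[R]_d, mpos q /\ radius_lt q Rad.
Proof.
have [|rho hr] := @radius_between R d (fun=> 0) Rad; first by move=> i; exact: Rad_gt0.
exists (\row_i rho i); split=> i; rewrite mxE; have [h1 h2] := hr i => //.
by split=> //; exact: ltW.
Qed.

(** A monomial is a constant times a term of the series of e^(q.|X|). *)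
Lemma cintegrable_mpow K : cintegrable P (fun w => mpow (cvec X w) K).
Proof.
have [q [q0 qR]] := positive_radius.
have c0 : 0 < mpow q K / (mfact K)%:R by rewrite divr_gt0 ?mpow_gt0 ?mfactR_gt0.
have mG : measurable_fun [set: T] (fun w => (mpow q K / (mfact K)%:R)^-1 * expdot q w).
  by apply: measurable_funM; [exact: measurable_cst|exact: measurable_expdot].
have G0 w : 0 <= (mpow q K / (mfact K)%:R)^-1 * expdot q w.
  by rewrite mulr_ge0 ?expdot_ge0 // invr_ge0 ltW.
apply: (cintegrable_le G0 mG) (cmeasurable_mpow K) _.
  rewrite expectationE; under eq_integral do rewrite EFinM.
  rewrite ge0_integralZl //; last 3 first.
  - by apply/measurable_EFinP; exact: measurable_expdot.
  - by move=> w _; rewrite lee_fin expdot_ge0.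
  - by rewrite lee_fin invr_ge0 ltW.
  by rewrite lte_mul_pinfty ?lee_fin ?invr_ge0 ?(ltW c0) // -expectationE expdot_fin.
move=> w; rewrite ler_pdivlMl //.
have := sumbound_term K (wbound_zhat (cvec X w) (fun i => ltW (q0 i))).
by rewrite /zhat cmodM cmodV cmod_nat mulrA mulrAC.
Qed.

(** Termwise expectation of the exponential series, dominated by e^(q.|X|) with
    q = |theta|. *)
Lemma mgf_pser : has_pser Rad moment (mgf X).
Proof.
move=> theta tR; pose q := absv theta.
have q0 i : 0 <= q ord0 i by exact: absv_ge0.
have qR : radius_lt q Rad by move=> i; rewrite mxE; split; [exact: cmod_ge0|exact: tR].
pose Y K w := mpow theta K / (mfact K)%:R * mpow (cvec X w) K.
have YE K w : Y K w = pterm (mpow (cvec X w)) theta K by rewrite /Y /pterm; ring.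
have mY K : cmeasurable (Y K).
  by apply: cmeasurableM (cmeasurable_cst _ _) (cmeasurable_mpow K).
have Ydom w : sumbound (fun K => cmod (Y K w)) (expdot q w).
  apply: sumbound_le (wbound_zhat (cvec X w) q0) => K.
  by rewrite /Y /zhat !cmodM cmod_mpow mulrAC mulrA.
have Ysum w : hassum (fun K => Y K w) (cexp (dot theta (cvec X w))).
  have [|s e] := @has_pser_cexp R d (cvec X w) theta; first by move=> i; exact: ltry.
  rewrite -e (_ : (fun K => Y K w) = pterm (mpow (cvec X w)) theta); first exact: usumP.
  by apply/funext => K; exact: YE.
have h := hassum_cexpectation (expdot_ge0 q) (measurable_expdot q) (expdot_fin qR)
  (@mbox_exhausts d) mY Ydom Ysum.
have EY K : cexpectation P (Y K) = pterm moment theta K.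
  by rewrite cexpectationZ; [rewrite /pterm /moment; ring|exact: cintegrable_mpow].
rewrite (_ : (fun K => _) = pterm moment theta) in h; last by apply/funext.
split; last exact: usumE.
exists (2 * \int[P]_w expdot q w).
apply: sumbound_le (sumboundZ _ (sumbound_int (expdot_ge0 q) (measurable_expdot q) (expdot_fin qR) mY Ydom)) => // K.
rewrite -EY; apply: (cexpectation_le (expdot_ge0 q) (measurable_expdot q) (expdot_fin qR)) => // w.
exact: (dom_term Ydom).
Qed.

End RandomVectorSeries.

(** * Locally uniform convergence *)

Section FamilyConvergence.
Variables (R : realType) (d : nat) (I : choiceType).

(** Weierstrass's test along finite sets. *)
Lemma family_cvg (t : I -> 'rV[R[i]]_d -> R[i]) (g : 'rV[R[i]]_d -> R[i]) :
  (forall b : R, 0 <= b -> exists u : I -> R, exists2 B, sumbound u B &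
     forall (z : 'rV[R[i]]_d) i, (forall k, cmod (z ord0 k) <= b) -> cmod (t i z) <= u i) ->
  (forall z, hassum (t^~ z) (g z)) ->
  {family compact, (fun F : {fset I} => fun z => partial_sum (fun i => t i z) F) @ totally --> g}.
Proof.
move=> ht hg; apply/fam_cvgP => A cA.
have [b [b0 hb]] := compact_bounded_rows cA.
have [u [B uB tu]] := ht b b0.
have u0 i : 0 <= u i.
  by apply: le_trans (cmod_ge0 (t i 0)) (tu 0 i _) => k; rewrite mxE cmod0.
move=> Q /uniform_nbhs[E [entE EQ]].
have [e e0 he] : exists2 e : R, 0 < e & forall x y : R[i], cmod (x - y) < e -> E (x, y).
  move: entE; rewrite -entourage_ballE => -[e /= /gt0cE[x x0 ->] he]; exists x => // y y' hy.
  by apply: he; rewrite /= -ball_normE /ball_ /= normcE ltcR.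
have e2 : 0 < e / 2 by rewrite divr_gt0.
have [F0 hF0] := sumbound_tail u0 uB e2.
exists F0 => // F F0F; apply: EQ => z Az.
apply: he; rewrite cmodBC partial_sumE.
apply: (@le_lt_trans _ _ (e / 2)); last by rewrite ltr_pdivrMr // mulr_natr mulr2n ltrDl.
apply: hassum_tail (hg z) _ => G dG.
apply: le_trans (hF0 G _); last by apply: fdisjointWr dG.
by apply: ler_sum => i _; apply: tu; exact: hb.
Qed.

Lemma family_cvg_pointwise (t : I -> 'rV[R[i]]_d -> R[i]) (g : 'rV[R[i]]_d -> R[i]) :
  {family compact, (fun F : {fset I} => fun z => partial_sum (fun i => t i z) F) @ totally --> g} ->
  forall z, hassum (t^~ z) (g z).
Proof.
move=> /fam_cvgP h z; have := h [set z] (@compact_set1 _ z) => hz.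
move=> e e0.
have : nbhs (g : {uniform` [set z] -> R[i]}) [set f | forall y, [set z] y -> cmod (g y - f y) < e].
  apply/uniform_nbhs; exists [set xy | cmod (xy.1 - xy.2) < e]; split => //.
  rewrite -entourage_ballE; exists e%:C => /=; first by rewrite ltcR.
  by move=> [x y] /=; rewrite -ball_normE /ball_ /= normcE ltcR.
move=> /hz[F0 _ hF0]; exists F0 => F F0F.
have := hF0 F F0F z erefl; rewrite partial_sumE cmodBC => /ltW; exact.
Qed.

End FamilyConvergence.

Section Enlarge.
Variables (R : realType) (d : nat) (Rad : 'I_d -> \bar R).

Lemma geom_mono c (q q' : 'rV[R]_d) (a : multiindex d -> R[i]) : (forall i, 0 <= q ord0 i <= q' ord0 i) ->
  geom c q a -> geom c q' a.
Proof.
move=> qq ga K; rewrite (le_trans (ga K)) // ler_wpM2l ?(geom_ge0 ga) //.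
exact: mpow_le.
Qed.

(** Strictly positive rates can be inverted, which the weighted sums require;
    the room below [Rad] allows increasing the rate. *)
Lemma geom_enlarge c (q : 'rV[R]_d) (a : multiindex d -> R[i]) : radius_lt q Rad -> geom c q a ->
  exists q' : 'rV[R]_d, [/\ mpos q', radius_lt q' Rad & geom c q' a].
Proof.
move=> qR ga; have [s hs] := radius_between (fun i => proj2 (qR i)).
have s0 i : 0 < s i by apply: le_lt_trans (proj1 (qR i)) _; case: (hs i).
exists (\row_i s i); split.
- by move=> i; rewrite mxE.
- by move=> i; rewrite mxE; split; [exact: ltW|case: (hs i)].
- apply: geom_mono ga => i; rewrite mxE; case: (qR i) => -> _ /=.
  by apply: ltW; case: (hs i).
Qed.

End Enlarge.

(** * Appell expansions *)

Section AppellExpansions.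
Variables (disp : measure_display) (T : measurableType disp) (R : realType).
Variables (P : probability T R) (d : nat) (X : 'I_d -> {RV P >-> R}).
Variable Rad : 'I_d -> \bar R.
Hypothesis Rad_gt0 : forall i, (0 < Rad i)%E.
Hypothesis mgfX : mgf_defined X Rad.
Hypothesis mgf_neq0 : forall theta, polydisc Rad theta -> mgf X theta != 0.
Variable A : multiindex d -> 'rV[R[i]]_d -> R[i].
Hypothesis appellA : appell_polynomials X A.
Implicit Types (a phi : multiindex d -> R[i]) (q : 'rV[R]_d) (z : 'rV[R[i]]_d).

(** Normalized Taylor coefficients of the moment-generating function and of its
    reciprocal, the symbols of two mutually inverse operators. *)
Definition mhat : multiindex d -> R[i] := nrm (moment X).
Definition nhat : multiindex d -> R[i] := nrm (fun K => mpartial K (fun t => (mgf X t)^-1) 0).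

Let hM : has_pser Rad (moment X) (mgf X) := mgf_pser Rad_gt0 mgfX.
Let hN : has_pser Rad (fun K => mpartial K (fun t => (mgf X t)^-1) 0) (fun t => (mgf X t)^-1) :=
  has_pserV Rad_gt0 hM mgf_neq0.

Let conv_inverse phi psi g h : has_pser Rad phi g -> has_pser Rad psi h ->
  (forall z, polydisc Rad z -> g z * h z = 1) ->
  mconv (nrm phi) (nrm psi) = fun K => (K == mzero d)%:R.
Proof.
move=> hg hh gh.
have e := pser_unique Rad_gt0 (has_pser_mul hg hh) (@has_pser_one R d Rad) gh.
rewrite -[LHS]nrmK e; apply/funext => K; rewrite /nrm.
by case: eqP => [->|_]; rewrite ?mul0r // mfact0 divr1.
Qed.

Lemma mconv_mhat_nhat : mconv mhat nhat = fun K => (K == mzero d)%:R.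
Proof. by apply: conv_inverse hM hN _ => z zR; rewrite divff // mgf_neq0. Qed.

Lemma mconv_nhat_mhat : mconv nhat mhat = fun K => (K == mzero d)%:R.
Proof. by apply: conv_inverse hN hM _ => z zR; rewrite mulVf // mgf_neq0. Qed.

Lemma wbound_mhat q : mpos q -> radius_lt q Rad -> exists B, wbound q mhat B.
Proof. by move=> q0 qR; apply: wbound_pser q0 _ hM => i; case: (qR i). Qed.

Lemma wbound_nhat q : mpos q -> radius_lt q Rad -> exists B, wbound q nhat B.
Proof. by move=> q0 qR; apply: wbound_pser q0 _ hN => i; case: (qR i). Qed.

Definition ahat z : multiindex d -> R[i] := mconv nhat (zhat z).

(** Comparison of coefficients in the defining expansion.  Its convergence near
    the origin bounds the terms at one point, which gives absolute convergence
    on a smaller polydisc, where power series have unique coefficients. *)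
Lemma appell_ahat K z : A K z = (mfact K)%:R * ahat z K.
Proof.
have hE := has_pser_mul hN (has_pser_sub (fun i => leey (Rad i)) (@has_pser_cexp R d z)).
have [dl dl0 hdl] := (nbhs_rowP _ _).1 (appellA z).
pose s := dl / 2; have s0 : 0 < s by rewrite divr_gt0.
have sdl : s < dl by rewrite /s; lra.
pose Rad' i : \bar R := Order.min s%:E (Rad i).
have Rad'0 i : (0 < Rad' i)%E by rewrite lt_min lte_fin s0 Rad_gt0.
have Rad'R i : (Rad' i <= Rad i)%E by rewrite ge_min lexx orbT.
have termE theta : (fun J => A J z * mpow theta J / (mfact J)%:R) = pterm (A^~ z) theta by [].
have hs (theta : 'rV[R[i]]_d) : (forall i, cmod (theta ord0 i) < dl) ->
    hassum (pterm (A^~ z) theta) (cexp (dot theta z) / mgf X theta).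
  move=> ht; apply/hassum_cvg; rewrite -termE; apply: hdl => i.
  by rewrite mxE subr0.
have [M hMb] : exists M, forall J, cmod (pterm (A^~ z) (cvect (const_mx s)) J) <= M.
  have [|F0 hF0] := hs (cvect (const_mx s)) _ 1 ltr01.
    by move=> i; rewrite !mxE cmod_real gtr0_norm.
  exists (1 + 1 + \sum_(J <- F0) cmod (pterm (A^~ z) (cvect (const_mx s)) J)) => J.
  have [JF|JF] := boolP (J \in F0).
    by rewrite (big_fsetD1 _ JF) /= addrCA lerDl addr_ge0 // sumr_ge0 // => L _; exact: cmod_ge0.
  rewrite ler_wpDr ?sumr_ge0 //; first by move=> L _; exact: cmod_ge0.
  have := hF0 _ (fsubset_refl F0); have := hF0 _ (fsubsetU1 J F0).
  rewrite big_fsetU1 //=; set x := pterm _ _ J; set y := \sum_(i <- F0) _; set l := cexp _ / _ => h1 h2.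
  have -> : x = (x + y - l) - (y - l) by ring.
  by rewrite (le_trans (cmodB _ _)) // lerD.
have hA : has_pser Rad' (A^~ z) (fun t => (mgf X t)^-1 * cexp (dot t z)).
  move=> theta tR.
  have ts i : cmod (theta ord0 i) < s.
    by rewrite -lte_fin; apply: lt_le_trans (tR i) _; rewrite ge_min lexx.
  have h := hs theta (fun i => lt_trans (ts i) sdl); split; last by rewrite /pser (usumE h) mulrC.
  have M0 : 0 <= M := le_trans (cmod_ge0 _) (hMb (mzero d)).
  have q0 i : 0 <= cmod (theta ord0 i) / s by rewrite divr_ge0 ?cmod_ge0 // ltW.
  have q1 i : cmod (theta ord0 i) / s < 1 by rewrite ltr_pdivrMr // mul1r.
  have sb := @sumbound_prod R d (fun i k => (cmod (theta ord0 i) / s) ^+ k)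
    (fun i => (1 - cmod (theta ord0 i) / s)^-1) (fun i k => exprn_ge0 k (q0 i))
    (fun i n => geom_sum_le n (q0 i) (q1 i)).
  apply: (summ_le _ (sumboundZ M0 sb)) => J.
  apply: le_trans (ler_wpM2r _ (hMb J)); last by apply: prodr_ge0 => i _; rewrite exprn_ge0.
  rewrite !cmod_pterm absv_cvect; last by move=> i; rewrite mxE ltW.
  have -> : mpow (absv theta) J = mpow (const_mx s) J * \prod_(i < d) (cmod (theta ord0 i) / s) ^+ J i.
    rewrite /mpow -big_split /=; apply: eq_bigr => i _.
    by rewrite !mxE -exprMn mulrC divfK // gt_eqF.
  by rewrite le_eqVlt; apply/orP; left; apply/eqP; ring.
have e := pser_unique Rad'0 hA (has_pser_sub Rad'R hE) (fun t _ => erefl).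
by have := congr1 (fun f => f K) e.
Qed.

Lemma appell_termE a I z : appell_term A a I z = a I * ahat z I.
Proof. by rewrite /appell_term appell_ahat; field; exact: mfactC_neq0. Qed.

Lemma wbound_ahat q B z : mpos q -> wbound q nhat B ->
  wbound q (ahat z) (B * expR (dot q (absv z))).
Proof.
by move=> q0 nB; apply: wbound_mconv => //; apply: wbound_zhat => i; exact: ltW.
Qed.

Lemma appell_term_bound c q a B z : mpos q -> geom c q a -> wbound q nhat B ->
  sumbound (fun I => cmod (appell_term A a I z)) (c * (B * expR (dot q (absv z)))).
Proof.
move=> q0 ga nB.
have := mact_bound (mzero d) q0 ga (wbound_ahat z q0 nB); rewrite mpow0 mulr1.
apply: sumbound_le => K; by rewrite appell_termE madd0m.
Qed.

(** Summing against Appell polynomials inverts the operator with symbol the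
    moment-generating function. *)
Lemma appell_hassum c q a z : mpos q -> radius_lt q Rad -> geom c q a ->
  hassum (fun I => appell_term A a I z) (pser (mact nhat a) z).
Proof.
move=> q0 qR ga; have [B nB] := wbound_nhat q0 qR.
have zB := wbound_zhat z (fun i => ltW (q0 i)).
rewrite pser_mact (mact_mact q0 ga zB nB).
have -> : (fun I => appell_term A a I z) = (fun I => a (madd (mzero d) I) * ahat z I).
  apply/funext => K; by rewrite appell_termE madd0m.
exact: usumP (mact_summ (mzero d) q0 ga (wbound_ahat z q0 nB)).
Qed.

Lemma cmeasurable_appell_term a I : cmeasurable (fun w => appell_term A a I (cvec X w)).
Proof.
have [q [q0 qR]] := positive_radius Rad_gt0.
have [B nB] := wbound_nhat q0 qR.
have -> : (fun w => appell_term A a I (cvec X w)) = (fun w => a I * ahat (cvec X w) I).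
  by apply/funext => w; exact: appell_termE.
apply: cmeasurableM; first exact: cmeasurable_cst.
apply: (cmeasurable_hassum (@mbox_exhausts d)
  (Y_ := fun J w => if mleq J I then nhat (msub I J) * zhat (cvec X w) J else 0)).
  move=> J; case: (mleq J I); last exact: cmeasurable_cst.
  apply: cmeasurableM; first exact: cmeasurable_cst.
  by apply: cmeasurableM; [exact: cmeasurable_mpow|exact: cmeasurable_cst].
move=> w; apply: usumP; apply: (mconv_summ I q0 nB).
by apply: wbound_zhat => i; exact: ltW.
Qed.

Lemma expectation_expdot_fin (c : R) q : 0 <= c -> radius_lt q Rad ->
  ('E_P[fun w => (c * expdot X q w)%R] < +oo)%E.
Proof.
move=> c0 qR; rewrite expectationE; under eq_integral do rewrite EFinM.
rewrite ge0_integralZl //; last 2 first.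
- by apply/measurable_EFinP; exact: measurable_expdot.
- by move=> w _; rewrite lee_fin expdot_ge0.
by rewrite lte_mul_pinfty ?lee_fin // -expectationE (expdot_fin mgfX).
Qed.

Lemma measurable_expdotZ (c : R) q : measurable_fun [set: T] (fun w => c * expdot X q w).
Proof. by apply: measurable_funM; [exact: measurable_cst|exact: measurable_expdot]. Qed.

(** All modes of convergence come from one domination of the terms: by
    c e^(q.|z|) at each point, hence by a constant on bounded sets and by an
    integrable variable at z = X. *)
Lemma appell_expansion_geom c q a : mpos q -> radius_lt q Rad -> geom c q a ->
  appell_expansion X A Rad (pser (mact nhat a)) a.
Proof.
move=> q0 qR ga; have [B nB] := wbound_nhat q0 qR; have c0 := geom_ge0 ga.
have B0 : 0 <= B := sumbound_ge0 nB.
have maj (b : R) : 0 <= b -> exists u : multiindex d -> R, exists2 U, sumbound u U &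
    forall (z : 'rV[R[i]]_d) i, (forall k, cmod (z ord0 k) <= b) -> cmod (appell_term A a i z) <= u i.
  move=> b0; pose bv : 'rV[R[i]]_d := const_mx b%:C.
  pose n' J : R := cmod (nhat J); pose z' J : R := cmod (zhat bv J).
  have nB' : wbound q (fun J => (n' J)%:C) B.
    by apply: sumbound_le nB => J; rewrite cmod_real ger0_norm // cmod_ge0.
  have zB' : wbound q (fun J => (z' J)%:C) (expR (dot q (absv bv))).
    apply: sumbound_le (wbound_zhat bv (fun i => ltW (q0 i))) => J.
    by rewrite cmod_real ger0_norm // cmod_ge0.
  exists (fun I => c * (mpow q I * cmod (mconv (fun J => (n' J)%:C) (fun J => (z' J)%:C) I))).
  exists (c * (B * expR (dot q (absv bv)))).
    by apply: sumboundZ => //; exact: wbound_mconv.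
  move=> z I zb; rewrite appell_termE cmodM mulrA ler_pM ?cmod_ge0 //.
  apply: mconv_dom q0 _ _ nB' zB' => J //.
  rewrite /z' /zhat !cmodM !cmod_mpow ler_wpM2r ?cmod_ge0 //; apply: mpow_le => i.
  by rewrite !mxE cmod_ge0 cmod_real ger0_norm // zb.
have sumP z := appell_hassum z q0 qR ga.
have termB z := appell_term_bound z q0 ga nB.
split.
- by exists c, q.
- exists (fun z => usum (fun I => `|appell_term A a I z|)).
  apply: family_cvg.
    move=> b /maj[u [U uU hu]]; exists u, U => // z i zb.
    by rewrite normcE cmod_real ger0_norm ?cmod_ge0 // hu.
  move=> z; apply: usumP; exists (c * (B * expR (dot q (absv z)))).
  apply: sumbound_le (termB z) => I.
  by rewrite normcE cmod_real ger0_norm // cmod_ge0.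
- by apply: family_cvg => // z.
have cB0 : 0 <= c * B by rewrite mulr_ge0.
have G0 w : 0 <= c * B * expdot X q w by rewrite mulr_ge0 // expdot_ge0.
have dom w : sumbound (fun I => cmod (appell_term A a I (cvec X w))) (c * B * expdot X q w).
  by rewrite -mulrA; exact: termB.
apply/fine_cvgP; split.
  apply: nearW => F; rewrite expectationE; apply: integrable_fin_num => //.
  have mS : cmeasurable (fun w => partial_sum (fun I => appell_term A a I (cvec X w)) F -
      pser (mact nhat a) (cvec X w)).
    apply: cmeasurableD.
      under eq_fun do rewrite partial_sumE; apply: cmeasurable_sum => I.
      exact: cmeasurable_appell_term.
    apply: cmeasurableN.
    exact: (cmeasurable_hassum (@mbox_exhausts d) (cmeasurable_appell_term a) (fun w => sumP (cvec X w))).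
  apply: (integrable_cmod G0 (measurable_expdotZ _ _) (expectation_expdot_fin cB0 qR) mS) => w.
  rewrite partial_sumE; apply: hassum_tail (sumP _) _ => F' _; exact: dom.
apply/cvgrPdist_le => e e0.
have [F0 hF0] := hassum_L1 G0 (measurable_expdotZ _ _) (expectation_expdot_fin cB0 qR)
  (@mbox_exhausts d) (cmeasurable_appell_term a) dom (fun w => sumP (cvec X w)) e0.
exists F0 => // F F0F /=; rewrite sub0r normrN expectationE ger0_norm; last first.
  by apply: Rintegral_ge0 => w _; exact: cmod_ge0.
rewrite (le_trans _ (hF0 F F0F)) // le_eqVlt; apply/orP; left; apply/eqP.
by apply: eq_Rintegral => w _; rewrite partial_sumE.
Qed.

Lemma mact_mhat_nhat c q a : mpos q -> radius_lt q Rad -> geom c q a ->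
  mact mhat (mact nhat a) = a.
Proof.
move=> q0 qR ga; have [B nB] := wbound_nhat q0 qR; have [M mB] := wbound_mhat q0 qR.
by rewrite (mact_mact q0 ga mB nB) mconv_nhat_mhat mact_delta.
Qed.

Lemma mact_nhat_mhat c q a : mpos q -> radius_lt q Rad -> geom c q a ->
  mact nhat (mact mhat a) = a.
Proof.
move=> q0 qR ga; have [B nB] := wbound_nhat q0 qR; have [M mB] := wbound_mhat q0 qR.
by rewrite (mact_mact q0 ga nB mB) mconv_mhat_nhat mact_delta.
Qed.

(** With a = M(d) phi the Appell series sums to (1/M)(d) M(d) phi = phi. *)
Lemma appell_expansion_exists c q phi f : mpos q -> radius_lt q Rad -> geom c q phi ->
  has_pser (fun=> +oo%E) phi f ->
  appell_expansion X A Rad f (mact mhat phi) /\ exists c', geom c' q (mact mhat phi).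
Proof.
move=> q0 qR gphi hf; have [M mB] := wbound_mhat q0 qR.
have ga := geom_mact q0 gphi mB; split; last by exists (c * M).
have <- : pser (mact nhat (mact mhat phi)) = f; last exact: appell_expansion_geom q0 qR ga.
rewrite (mact_nhat_mhat q0 qR gphi); apply/funext => z.
by have [] := hf z (fun i => ltry _).
Qed.

(** The sum of an Appell series determines (1/M)(d) a, its derivatives at the
    origin, and therefore a. *)
Lemma appell_expansion_unique phi f a : has_pser (fun=> +oo%E) phi f ->
  appell_expansion X A Rad f a -> a = mact mhat phi.
Proof.
move=> hf ha; have [c [q [qR ca]]] := expansion_bound ha.
have [q' [q'0 q'R ga]] := geom_enlarge qR ca.
have [B nB] := wbound_nhat q'0 q'R.
rewrite -(mact_mhat_nhat q'0 q'R ga); congr mact.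
apply: (@pser_unique _ _ (fun=> +oo%E) _ _ (pser (mact nhat a)) f) => //.
- exact: pser_geom q'0 (geom_mact q'0 ga nB).
- move=> z _; have h := family_cvg_pointwise (expansion_locally_uniform ha) z.
  exact: hassum_unique (appell_hassum z q'0 q'R ga) h.
Qed.

(** The coefficient of index K is the expectation of the K-th derivative: apply
    the expectation termwise to the Taylor series of that derivative. *)
Lemma mact_mhat_expectation c q phi f K : mpos q -> radius_lt q Rad -> geom c q phi ->
  has_pser (fun=> +oo%E) phi f ->
  cintegrable P (fun w => mpartial K f (cvec X w)) /\
  mact mhat phi K = cexpectation P (fun w => mpartial K f (cvec X w)).
Proof.
move=> q0 qR gphi hf.
have gK : geom (c * mpow q K) q (fun L => phi (madd L K)).
  by move=> L; rewrite (le_trans (gphi _)) // mpowD [mpow q L * _]mulrC mulrA.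
have c0 := geom_ge0 gK.
have G0 w : 0 <= c * mpow q K * expdot X q w by rewrite mulr_ge0 // expdot_ge0.
have dom w := pterm_bound (cvec X w) q0 gK.
have sumP w : hassum (pterm (fun L => phi (madd L K)) (cvec X w)) (mpartial K f (cvec X w)).
  have [s <-] := has_pser_mpartial K hf (z := cvec X w) (fun i => ltry _).
  exact: usumP.
have mY L : cmeasurable (fun w => pterm (fun L => phi (madd L K)) (cvec X w) L).
  apply: cmeasurableM; last exact: cmeasurable_cst.
  by apply: cmeasurableM; [exact: cmeasurable_cst|exact: cmeasurable_mpow].
have mf := cmeasurable_hassum (@mbox_exhausts d) mY sumP.
have Gfin := expectation_expdot_fin c0 qR.
have mG := measurable_expdotZ (c * mpow q K) q.
split.
  by apply: (cintegrable_le G0 mG Gfin mf) => w; exact: dom_sum dom sumP w.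
apply: usumE; have := hassum_cexpectation G0 mG Gfin (@mbox_exhausts d) mY dom sumP.
congr hassum; apply/funext => L; rewrite maddC.
rewrite (_ : (fun w => _) = (fun w => phi (madd L K) / (mfact L)%:R * mpow (cvec X w) L)); last first.
  by apply/funext => w; rewrite /pterm; ring.
rewrite cexpectationZ; first by rewrite /mhat /nrm /moment; ring.
exact: cintegrable_mpow Rad_gt0 mgfX L.
Qed.


(** * The Wick product with a coordinate *)

Lemma mhat0 : mhat (mzero d) = 1.
Proof.
rewrite /mhat /nrm /moment mfact0 divr1.
have -> : (fun w => mpow (cvec X w) (mzero d)) = fun=> 1 by apply/funext => w; exact: mpow0.
rewrite cexpectationE /= !Rintegral_cst // mul0r mul1r.
by rewrite (_ : fine (P setT) = 1) // probability_setT.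
Qed.

Lemma munit_neq0 j : (munit j 1 == mzero d) = false.
Proof. by apply/eqP => /ffunP/(_ j); rewrite !ffunE eqxx. Qed.

(** The derivatives of the coordinate function at the origin, and (below,
    [coord_coef]) its Appell coefficients. *)
Definition coord_deriv j : multiindex d -> R[i] := fun K => (K == munit j 1)%:R.

Lemma has_pser_coordinate j : has_pser (fun=> +oo%E) (coord_deriv j) (coordinate j).
Proof.
move=> z _; set t := pterm _ z.
have t1 : t (munit j 1) = z ord0 j.
  by rewrite /t /pterm /coord_deriv eqxx mpow_munit mfact_munit mul1r divr1.
have t0 K : K != munit j 1 -> t K = 0.
  by rewrite /t /pterm /coord_deriv => /negPf ->; rewrite !mul0r.
have h := hassum_single t0; rewrite t1 in h; split; last exact: usumE h.
eexists; apply: (sumbound_single (i0 := munit j 1)) => [|K /t0 ->]; [exact: cmod_ge0|exact: cmod0].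
Qed.

Lemma geom_coord_deriv j q : mpos q -> geom (q ord0 j)^-1 q (coord_deriv j).
Proof.
move=> q0 K; rewrite /coord_deriv; case: eqP => [->|_].
  by rewrite cmod1 mpow_munit mulVf // gt_eqF.
by rewrite cmod0 mulr_ge0 ?invr_ge0 ?(ltW (q0 j)) // ltW // mpow_gt0.
Qed.

Definition coord_coef j : multiindex d -> R[i] := fun K =>
  (if K == mzero d then mhat (munit j 1) else 0) + (if K == munit j 1 then 1 else 0).

Lemma mact_coord j : mact mhat (coord_deriv j) = coord_coef j.
Proof.
apply/funext => K; rewrite /mact /coord_coef /coord_deriv.
have single K' (J0 : multiindex d) x : (forall J, (madd K' J == munit j 1)%:R * mhat J =
    if J == J0 then x else 0) -> usum (fun J => (madd K' J == munit j 1)%:R * mhat J) = x.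
  by move=> h; apply: usumE; rewrite (funext h); exact: hassum_delta.
have [->|K0] := eqVneq K (mzero d).
  rewrite [mzero d == _]eq_sym munit_neq0 addr0.
  apply: (single _ (munit j 1)) => J.
  rewrite maddC madd0; case: eqP => [->|_]; rewrite ?mul1r ?mul0r //.
have [->|K1] := eqVneq K (munit j 1).
  rewrite add0r; apply: (single _ (mzero d)) => J.
  have -> : (madd (munit j 1) J == munit j 1) = (J == mzero d).
    apply/eqP/eqP => [/ffunP h|->]; last exact: madd0.
    apply/ffunP => i; have := h i; rewrite !ffunE => /eqP.
    by rewrite -[X in _ == X]addn0 eqn_add2l => /eqP.
  by case: eqP => [->|_]; rewrite ?mul0r // mhat0 mul1r.
rewrite addr0; apply: (single _ (mzero d)) => J; rewrite if_same.
case: eqP => [/ffunP h|_]; last by rewrite mul0r.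
exfalso; have Ki i : i != j -> K i = 0%N.
  by move=> /negPf ij; have := h i; rewrite !ffunE ij => /eqP; rewrite addn_eq0 => /andP[/eqP].
have : (K j <= 1)%N by have := h j; rewrite !ffunE eqxx => <-; exact: leq_addr.
case Kj : (K j) => [|[|//]] _.
  case/eqP: K0; apply/ffunP => i; rewrite ffunE.
  by have [->|/Ki] := eqVneq i j.
case/eqP: K1; apply/ffunP => i; rewrite ffunE.
by have [->|/Ki] := eqVneq i j.
Qed.

(** Multiplication by the j-th variable on sequences of derivatives. *)
Definition mraise j a : multiindex d -> R[i] := fun I => (I j)%:R * a (msub I (munit j 1)).

(** The factor I_j costs an arbitrarily small increase of the rate in the j-th
    variable. *)
Lemma geom_mraise j c q a : mpos q -> radius_lt q Rad -> geom c q a ->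
  exists c' q', [/\ mpos q', radius_lt q' Rad, forall i, 0 <= q ord0 i <= q' ord0 i &
    geom c' q' (mraise j a)].
Proof.
move=> q0 qR ga; have c0 := geom_ge0 ga.
have [s qs sR] := lte_between (proj2 (qR j)).
have dl0 : 0 < s - q ord0 j by rewrite subr_gt0.
have s0 : 0 < s := lt_trans (q0 j) qs.
pose q' : 'rV[R]_d := \row_i if i == j then s else q ord0 i.
have q'0 : mpos q' by move=> i; rewrite mxE; case: eqP.
exists (c / (s - q ord0 j)), q'; split=> //.
- move=> i; split; first exact: ltW.
  by rewrite mxE; case: eqP => [->|_] //; case: (qR i).
- by move=> i; rewrite mxE ltW //=; case: eqP => [->|_] //; exact: ltW.
move=> I; rewrite /mraise cmodM cmod_nat.
rewrite (le_trans (ler_wpM2l (ler0n _ _) (ga _))) //.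
rewrite (@mpow_split _ _ q _ j) (@mpow_split _ _ q' I j) mxE eqxx.
have -> : \prod_(i < d | i != j) q' ord0 i ^+ I i = \prod_(i < d | i != j) q ord0 i ^+ I i.
  by apply: eq_bigr => i /negPf ij; rewrite mxE ij.
have -> : \prod_(i < d | i != j) q ord0 i ^+ msub I (munit j 1) i =
    \prod_(i < d | i != j) q ord0 i ^+ I i.
  by apply: eq_bigr => i /negPf ij; rewrite !ffunE ij subn0.
rewrite !ffunE eqxx subn1.
have r0 : 0 <= \prod_(i < d | i != j) q ord0 i ^+ I i.
  by apply: prodr_ge0 => i _; rewrite exprn_ge0 // ltW.
have h := expr_deriv_bound (I j) (ltW (q0 j)) dl0; rewrite addrC subrK in h.
have := ler_wpM2l c0 (ler_wpM2r r0 h); congr (_ <= _); ring.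
Qed.

(** Appell coefficients of the Wick product with the j-th coordinate: in the
    Appell basis this is multiplication by the variable plus the mean. *)
Definition wick_coef j a : multiindex d -> R[i] :=
  fun I => mraise j a I + mhat (munit j 1) * a I.

Lemma geomD c c' q (a b : multiindex d -> R[i]) : geom c q a -> geom c' q b ->
  geom (c + c') q (fun I => a I + b I).
Proof. by move=> ga gb I; rewrite mulrDl (le_trans (cmodD _ _)) // lerD. Qed.

Lemma geomZ (k : R[i]) c q (a : multiindex d -> R[i]) : geom c q a ->
  geom (cmod k * c) q (fun I => k * a I).
Proof. by move=> ga I; rewrite cmodM -mulrA ler_wpM2l ?cmod_ge0. Qed.

Lemma geom_wick_coef j c q a : mpos q -> radius_lt q Rad -> geom c q a ->
  exists c' q', [/\ mpos q', radius_lt q' Rad & geom c' q' (wick_coef j a)].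
Proof.
move=> q0 qR ga; have [c' [q' [q'0 q'R qq' gr]]] := geom_mraise j q0 qR ga.
exists (c' + cmod (mhat (munit j 1)) * c), q'; split=> //.
by apply: geomD gr _; apply: geomZ; exact: geom_mono qq' ga.
Qed.

Lemma wick_termE j a I J z : wick_term A a (coord_coef j) (I, J) z =
  (if J == mzero d then mhat (munit j 1) * appell_term A a I z else 0) +
  (if J == munit j 1 then appell_term A (mraise j a) (madd I (munit j 1)) z else 0).
Proof.
rewrite /wick_term /coord_coef /=; have [->|J0] := eqVneq J (mzero d).
  rewrite eq_sym munit_neq0 !addr0 madd0 mfact0 /appell_term; field.
  exact: mfactC_neq0.
have [->|J1] := eqVneq J (munit j 1); last by rewrite !addr0 mulr0 !mul0r.
rewrite !add0r mulr1 mfact_munit /appell_term /mraise mfactS maddK !ffunE eqxx addn1 natrM.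
by field; rewrite mfactC_neq0 /= addrC natr1 pnatr_eq0.
Qed.

(** The double series has two nonzero columns, at 0 and at e_j; summed over I
    they give the two parts of [wick_coef], the second after the shift
    I |-> I + e_j, which misses only indices where [mraise] vanishes. *)
Lemma wick_hassum j c q a z : mpos q -> radius_lt q Rad -> geom c q a ->
  (exists B, sumbound (fun IJ => cmod (wick_term A a (coord_coef j) IJ z)) B) /\
  hassum (fun IJ => wick_term A a (coord_coef j) IJ z) (pser (mact nhat (wick_coef j a)) z).
Proof.
move=> q0 qR ga; have [c' [q' [q'0 q'R qq' gr]]] := geom_mraise j q0 qR ga.
have ga' := geom_mono qq' ga; have [B nB] := wbound_nhat q'0 q'R.
pose x I := mhat (munit j 1) * appell_term A a I z.
pose y K := appell_term A (mraise j a) K z.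
pose W I J := wick_term A a (coord_coef j) (I, J) z.
have WE I : W I = fun J => (if J == mzero d then x I else 0) +
    (if J == munit j 1 then y (madd I (munit j 1)) else 0).
  by apply/funext => J; exact: wick_termE.
have xB := sumboundZ (cmod_ge0 (mhat (munit j 1))) (appell_term_bound z q'0 ga' nB).
have yB := appell_term_bound z q'0 gr nB.
have yB' := sumbound_comp (@maddK d (munit j 1)) yB.
have rowB I : sumbound (fun J => cmod (W I J)) (cmod (x I) + cmod (y (madd I (munit j 1)))).
  apply: sumbound_le (sumboundD (sumbound_delta (mzero d) (cmod_ge0 (x I)))
    (sumbound_delta (munit j 1) (cmod_ge0 (y (madd I (munit j 1)))))) => J.
  by rewrite WE (le_trans (cmodD _ _)) // lerD //; case: ifP; rewrite ?cmod0.
have vB := sumboundD xB yB'.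
have WB : sumbound (fun p => cmod (W p.1 p.2)) (cmod (mhat (munit j 1)) * (c * (B * expR (dot q' (absv z)))) +
    c' * (B * expR (dot q' (absv z)))).
  apply: (@sumbound_pair _ _ _ (fun I J => cmod (W I J)) _ _ _ rowB) => //.
    by move=> I J; exact: cmod_ge0.
  by apply: sumbound_le vB => I; rewrite cmodM.
have Weq : (fun IJ => wick_term A a (coord_coef j) IJ z) = (fun p => W p.1 p.2).
  by apply/funext => -[I J].
have WB' : exists B, sumbound (fun IJ => cmod (wick_term A a (coord_coef j) IJ z)) B.
  by eexists; move: WB; congr sumbound; apply/funext => -[I J].
split=> //; rewrite Weq.
have sW : summ (fun p => W p.1 p.2) by eexists; exact: WB.
have sx : summ x by eexists; apply: sumbound_le xB => I; rewrite cmodM.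
have sy : summ y by eexists; exact: yB.
have sy' := summ_comp (@maddK d (munit j 1)) sy.
suff -> : pser (mact nhat (wick_coef j a)) z = usum (fun p => W p.1 p.2) by exact: usumP.
have rowE : (fun I => usum (W I)) = fun I => x I + (y \o (fun K => madd K (munit j 1))) I.
  apply/funext => I; rewrite WE; apply: usumE; apply: hassumD; exact: hassum_delta.
rewrite usum_fubini // rowE usumD // -(usum_reindex (@maddK d (munit j 1))) //; last first.
  move=> K /madd_neq; rewrite mleq_munit negbK => /eqP Kj.
  by rewrite /y /appell_term /mraise Kj !mul0r.
have [c'' [q'' [q''0 q''R gw]]] := geom_wick_coef j q0 qR ga.
apply: hassum_unique (appell_hassum z q''0 q''R gw) _.
rewrite (_ : (fun I => _) = fun I => x I + y I); first exact: hassumD (usumP sx) (usumP sy).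
by apply/funext => I; rewrite /x /y /appell_term /wick_coef; ring.
Qed.

(** Uniqueness of the expansions makes the Wick product with a coordinate the
    one computed from the explicit coefficients. *)
Lemma wick_coordinate j c q phi f : mpos q -> radius_lt q Rad -> geom c q phi ->
  has_pser (fun=> +oo%E) phi f ->
  is_wick X A Rad f (coordinate j) (pser (mact nhat (wick_coef j (mact mhat phi)))) /\
  wick X A Rad f (coordinate j) = pser (mact nhat (wick_coef j (mact mhat phi))).
Proof.
move=> q0 qR gphi hf.
have [ef [c' ga]] := appell_expansion_exists q0 qR gphi hf.
have [ej _] := appell_expansion_exists q0 qR (geom_coord_deriv j q0) (has_pser_coordinate j).
have hw : is_wick X A Rad f (coordinate j) (pser (mact nhat (wick_coef j (mact mhat phi)))).
  exists (mact mhat phi), (mact mhat (coord_deriv j)); split=> // z; rewrite mact_coord.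
  have [[B WB] hW] := wick_hassum j z q0 qR ga; split; last exact/hassum_cvg.
  apply: (@le_lt_trans _ _ B%:E); last exact: ltry.
  apply: ub_ereal_sup => _ [F [finF _] <-].
  by rewrite fsbig_finite //= sumEFin lee_fin; exact: WB.
split=> //; rewrite /wick; case: xgetP => [h _ [a [b [ha hb hab]]]|/(_ _)/(_ hw)//].
apply/funext => z; have [_ /hassum_cvg] := hab z.
rewrite (appell_expansion_unique hf ha) (appell_expansion_unique (has_pser_coordinate j) hb) mact_coord.
by move=> hz; apply: hassum_unique hz _; have [] := wick_hassum j z q0 qR ga.
Qed.

Lemma mact_shift v a j : mact v (fun K => a (madd K (munit j 1))) =
  fun K => mact v a (madd K (munit j 1)).
Proof.
apply/funext => K; congr usum; apply/funext => J; congr (a _ * _).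
by rewrite -!maddA [madd J _]maddC.
Qed.

(** The commutation relation of d/dx_j and multiplication by x_j, read off from
    the coefficients; differentiation is the shift in both bases. *)
Lemma wick_coef_commutator j a I :
  wick_coef j a (madd I (munit j 1)) - wick_coef j (fun K => a (madd K (munit j 1))) I = a I.
Proof.
rewrite /wick_coef /mraise maddK !ffunE eqxx addn1 -natr1.
have [Ij|Ij] := eqVneq (I j) 0%N; first by rewrite Ij; ring.
by rewrite msubK ?mleq_munit //; ring.
Qed.

(** The three functions involved have Appell series, so the relation reduces to
    the one between their coefficients. *)
Lemma heisenberg j c q phi f : mpos q -> radius_lt q Rad -> geom c q phi ->
  has_pser (fun=> +oo%E) phi f ->
  let fx := wick X A Rad f (coordinate j) in
  let dfx := wick X A Rad (partial j f) (coordinate j) in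
  [/\ is_wick X A Rad f (coordinate j) fx,
      is_wick X A Rad (partial j f) (coordinate j) dfx,
      forall z, derivable fx z (delta_mx ord0 j)
    & forall z, partial j fx z - dfx z = f z].
Proof.
move=> q0 qR gphi hf fx dfx.
have hdf := has_pser_partial j hf.
have gdphi : geom (c * mpow q (munit j 1)) q (fun K => phi (madd K (munit j 1))).
  by move=> K; rewrite (le_trans (gphi _)) // mpowD [mpow q K * _]mulrC mulrA.
have [h1 e1] := wick_coordinate j q0 qR gphi hf.
have [h2 e2] := wick_coordinate j q0 qR gdphi hdf.
rewrite /fx /dfx e1 e2; set a := mact mhat phi in e1 h1 *.
rewrite mact_shift in h2 e2 *; rewrite -/a in h2 e2 *.
have [_ [c' ga]] := appell_expansion_exists q0 qR gphi hf; rewrite -/a in ga.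
have [c1 [q1 [q10 q1R gw]]] := geom_wick_coef j q0 qR ga.
have gda : geom (c' * mpow q (munit j 1)) q (fun K => a (madd K (munit j 1))).
  by move=> K; rewrite (le_trans (ga _)) // mpowD [mpow q K * _]mulrC mulrA.
have [c2 [q2 [q20 q2R gw2]]] := geom_wick_coef j q0 qR gda.
have [B nB] := wbound_nhat q10 q1R.
have hp := pser_geom q10 (geom_mact q10 gw nB).
split=> // z; have [_ [dz pz]] := pser_partial j hp (z := z) (fun i => ltry _); first exact: dz.
rewrite /partial pz -(mact_shift nhat (wick_coef j a) j).
have gsw : geom (c1 * mpow q1 (munit j 1)) q1 (fun K => wick_coef j a (madd K (munit j 1))).
  by move=> K; rewrite (le_trans (gw _)) // mpowD [mpow q1 K * _]mulrC mulrA.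
have hs := hassumB (appell_hassum z q10 q1R gsw) (appell_hassum z q20 q2R gw2).
have [_ <-] := hf z (fun i => ltry _).
rewrite -(mact_nhat_mhat q0 qR gphi) -/a.
apply: hassum_unique hs _.
rewrite (_ : (fun I => _) = (fun I => appell_term A a I z)); first exact: appell_hassum q0 qR ga.
apply/funext => I; rewrite /appell_term -(wick_coef_commutator j a I); ring.
Qed.

End AppellExpansions.

Theorem corollary2p5 (disp : measure_display) (T : measurableType disp)
    (R : realType) (P : probability T R) (d : nat)
    (X : 'I_d -> {RV P >-> R})
    (Rad : 'I_d -> \bar R) (Rad_gt0 : forall i, (0 < Rad i)%E)
    (mgfX : mgf_defined X Rad)
    (mgf_neq0 : forall theta, polydisc Rad theta -> mgf X theta != 0)
    (A : multiindex d -> 'rV[R[i]]_d -> R[i]) (appellA : appell_polynomials X A)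
    (f : 'rV[R[i]]_d -> R[i]) (f_entire : entire f)
    (C : R) (r : 'rV[R]_d) (C_gt0 : 0 < C) (r_lt : radius_lt r Rad)
    (f_bound : forall z, cmod (f z) <= C * expR (dot r (absv z))) :
  [/\ exists a, appell_expansion X A Rad f a,
      forall a, appell_expansion X A Rad f a ->
        forall K : multiindex d,
          cintegrable P (fun w => mpartial K f (cvec X w)) /\
          a K = cexpectation P (fun w => mpartial K f (cvec X w))
    & forall j : 'I_d,
        let fx := wick X A Rad f (coordinate j) in
        let dfx := wick X A Rad (partial j f) (coordinate j) in
        [/\ is_wick X A Rad f (coordinate j) fx,
            is_wick X A Rad (partial j f) (coordinate j) dfx,
            forall z, derivable fx z (delta_mx ord0 j)
          & forall z, partial j fx z - dfx z = f z]].
Proof.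
have [phi [hf [c [q [qR ga]]]]] := exponential_type_pser f_entire r_lt f_bound.
have [q' [q'0 q'R gphi]] := geom_enlarge qR ga.
split.
- exists (mact (mhat X) phi).
  by have [] := appell_expansion_exists Rad_gt0 mgfX mgf_neq0 appellA q'0 q'R gphi hf.
- move=> a ha K; rewrite (appell_expansion_unique Rad_gt0 mgfX mgf_neq0 appellA hf ha).
  exact: (mact_mhat_expectation Rad_gt0 mgfX K q'0 q'R gphi hf).
- by move=> j; exact: (heisenberg Rad_gt0 mgfX mgf_neq0 appellA j q'0 q'R gphi hf).
Qed.
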